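(* Let $L$ be a logical system of dimension $d_L$ and $A=A_1\otimes\cdots\otimes A_n$ a physical system with $\dim A_i=d_i<\infty$. Let $V:L\to A$ be an isometry with encoding $\mathcal{E}(\cdot)=V(\cdot)V^\dagger$ that is $SU(d_L)$-covariant with a transversal action: there are continuous unitary representations $U\mapsto U_i(U)$ of $SU(d_L)$ on $A_i$ such that, with $U_A(U)=U_1(U)\otimes\cdots\otimes U_n(U)$, $\mathcal{E}(U(\cdot)U^\dagger)=U_A(U)\mathcal{E}(\cdot)U_A(U)^\dagger$ for all $U\in SU(d_L)$. Let $\mathcal{N}$ be the single-erasure noise $\mathcal{N}(\cdot)=\sum_{i=1}^n\frac1n|i\rangle\langle i|_C\otimes|\phi_i\rangle\langle\phi_i|_{A_i}\otimes\operatorname{tr}_{A_i}(\cdot)$ and write $\epsilon_{\mathrm{worst}}=\epsilon_{\mathrm{worst}}(\mathcal{N}\circ\mathcal{E})$. Then $$\epsilon_{\mathrm{worst}}\geq\frac{1}{2n}\frac{1}{\max_i\ln d_i}+O\!\left(\frac{1}{n\,d_L}\right),$$ and moreover $$\max_i\ln d_i\geq\frac{\ln(d_L-1)}{2n\epsilon_{\mathrm{worst}}}-\frac{\ln\left(1+(2n\epsilon_{\mathrm{worst}})^{-1}\right)}{2n\epsilon_{\mathrm{worst}}},\qquad \max_i\ln d_i\geq(d_L-1)\ln\!\left(\frac{1}{2\epsilon_{\mathrm{worst}}\,n\,d_L}\right).$$ The first and third bounds also hold with $\epsilon_{\mathrm{worst}}$ replaced by $d_L\epsilon_{\mathrm 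e}(\mathcal{N}\circ\mathcal{E})/2$.
   Context: Fidelity $F(\rho,\sigma)=\|\sqrt\rho\sqrt\sigma\|_1$; for channels $\mathcal{K},\mathcal{K}'$ with input $L$ and pure $|\phi\rangle_{LR}$, $F_{|\phi\rangle}(\mathcal{K},\mathcal{K}')=F((\mathcal{K}\otimes\mathrm{id}_R)(\phi),(\mathcal{K}'\otimes\mathrm{id}_R)(\phi))$. Let $|\hat\phi\rangle=\sum_k|k\rangle|k\rangle/\sqrt{d_L}$. For a channel $\mathcal{M}$ from $L$ to $B$: $f_{\mathrm e}(\mathcal{M})=\max_{\mathcal{R}}F_{|\hat\phi\rangle}(\mathcal{R}\circ\mathcal{M},\mathrm{id}_L)$ and $f_{\mathrm{worst}}(\mathcal{M})=\max_{\mathcal{R}}\min_{|\phi\rangle}F_{|\phi\rangle}(\mathcal{R}\circ\mathcal{M},\mathrm{id}_L)$, $\mathcal{R}$ over channels $B\to L$; $\epsilon_{\mathrm e}=\sqrt{1-f_{\mathrm e}^2}$, $\epsilon_{\mathrm{worst}}=\sqrt{1-f_{\mathrm{worst}}^2}$. *)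

(* Defs.v *)
From HB Require Import structures.
From mathcomp Require Import all_boot all_order all_algebra.
From mathcomp Require Import complex.
From mathcomp Require Import boolp classical_sets reals exp.
From Stdlib Require Import ClassicalEpsilon.

Set Implicit Arguments.
Unset Strict Implicit.
Unset Printing Implicit Defensive.

Import Order.TTheory GRing.Theory Num.Theory.
Local Open Scope ring_scope.

Section QuantumDefs.
Variable R : realType.
Local Notation C := (R[i]).

(* An operator from C^T to C^S, i.e. an S x T matrix (row index first). *)
Definition Op (S T : finType) := S -> T -> C.

Definition opmul (S T U : finType) (A : Op S T) (B : Op T U) : Op S U :=
  fun x y => \sum_z A x z * B z y.

Definition adj (S T : finType) (A : Op S T) : Op T S :=
  fun x y => Num.conj (A y x).

Definition opid (T : finType) : Op T T := fun x y => (x == y)%:R.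

Definition optr (T : finType) (A : Op T T) : C := \sum_x A x x.

Definition psd (T : finType) (A : Op T T) : Prop :=
  (forall x y, A x y = Num.conj (A y x)) /\
  (forall v : T -> C, 0 <= \sum_x \sum_y Num.conj (v x) * A x y * v y).

Definition psd_sqrt (T : finType) (A : Op T T) : Op T T :=
  epsilon (inhabits (fun _ _ => 0 : C)) (fun B : Op T T => psd B /\ opmul B B = A).

Definition tnorm (S T : finType) (X : Op S T) : R :=
  complex.Re (optr (psd_sqrt (opmul (adj X) X))).

Definition fid (T : finType) (rho sigma : Op T T) : R :=
  tnorm (opmul (psd_sqrt rho) (psd_sqrt sigma)).

Definition tensid (T S U : finType) (K : Op T T -> Op S S) (X : Op (T * U)%type (T * U)%type)
  : Op (S * U)%type (S * U)%type :=
  fun x y => K (fun t t' => X (t, x.2) (t', y.2)) x.1 y.1.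

Definition is_channel (T S : finType) (K : Op T T -> Op S S) : Prop :=
  [/\ (forall (a : C) (X Y : Op T T),
          K (fun x y => a * X x y + Y x y) = (fun x y => a * K X x y + K Y x y)),
      (forall X : Op T T, optr (K X) = optr X) &
      (forall (k : nat) (X : Op (T * 'I_k)%type (T * 'I_k)%type), psd X -> psd (tensid K X))].

Definition unitv (T : finType) (v : T -> C) : Prop :=
  \sum_x Num.conj (v x) * v x = 1.

Definition proj (T : finType) (v : T -> C) : Op T T := fun x y => v x * Num.conj (v y).

Definition Fphi (T S U : finType) (phi : (T * U)%type -> C) (K K' : Op T T -> Op S S) : R :=
  fid (tensid K (proj phi)) (tensid K' (proj phi)).

Definition phihat (dL : nat) : ('I_dL * 'I_dL)%type -> C :=
  fun x => (x.1 == x.2)%:R / ((Num.sqrt (dL%:R : R))%:C)%C.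

Definition f_e (dL : nat) (B : finType) (M : Op 'I_dL 'I_dL -> Op B B) : R :=
  sup [set x : R | exists Rc : Op B B -> Op 'I_dL 'I_dL,
        is_channel Rc /\ x = Fphi (phihat (dL:=dL)) (Rc \o M) id].

Definition f_worst (dL : nat) (B : finType) (M : Op 'I_dL 'I_dL -> Op B B) : R :=
  sup [set x : R | exists Rc : Op B B -> Op 'I_dL 'I_dL,
        is_channel Rc /\
        x = inf [set y : R | exists phi : ('I_dL * 'I_dL)%type -> C,
                   unitv phi /\ y = Fphi phi (Rc \o M) id]].

Definition eps_e (dL : nat) (B : finType) (M : Op 'I_dL 'I_dL -> Op B B) : R :=
  Num.sqrt (1 - f_e M ^+ 2).

Definition eps_worst (dL : nat) (B : finType) (M : Op 'I_dL 'I_dL -> Op B B) : R :=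
  Num.sqrt (1 - f_worst M ^+ 2).

Definition is_SU (dL : nat) (U : Op 'I_dL 'I_dL) : Prop :=
  opmul (adj U) U = @opid _ /\ \det (\matrix_(i, j) U i j) = 1.

Definition is_cont_unitary_rep (dL m : nat) (rho : Op 'I_dL 'I_dL -> Op 'I_m 'I_m) : Prop :=
  [/\ (forall U, is_SU U -> opmul (adj (rho U)) (rho U) = @opid _),
      (forall U U', is_SU U -> is_SU U' -> rho (opmul U U') = opmul (rho U) (rho U')) &
      (forall U, is_SU U -> forall eps : R, 0 < eps -> exists2 delta : R, 0 < delta &
         forall U', is_SU U' -> (forall i j, `|U' i j - U i j| < (delta%:C)%C) ->
           forall i j, `|rho U' i j - rho U i j| < (eps%:C)%C)].

(* physical system A = A_1 (x) ... (x) A_n, dim A_i = d i *)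
Definition Aidx (n : nat) (d : 'I_n -> nat) := {dffun forall i : 'I_n, 'I_(d i)}.

Definition upd (n : nat) (d : 'I_n -> nat) (a : Aidx d) (i : 'I_n) (k : 'I_(d i)) : Aidx d :=
  [ffun j => dfwith (fun j => a j) k j].

Definition is_isometry (S T : finType) (V : Op S T) : Prop := opmul (adj V) V = @opid T.

Definition enc (S T : finType) (V : Op S T) (X : Op T T) : Op S S :=
  opmul (opmul V X) (adj V).

Definition UA (n : nat) (d : 'I_n -> nat) (dL : nat)
  (rep : forall i : 'I_n, Op 'I_dL 'I_dL -> Op 'I_(d i) 'I_(d i)) (U : Op 'I_dL 'I_dL)
  : Op (Aidx d) (Aidx d) :=
  fun a a' => \prod_(i < n) rep i U (a i) (a' i).

Definition covariant (n : nat) (d : 'I_n -> nat) (dL : nat) (V : Op (Aidx d) 'I_dL)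
  (rep : forall i : 'I_n, Op 'I_dL 'I_dL -> Op 'I_(d i) 'I_(d i)) : Prop :=
  forall U, is_SU U -> forall X : Op 'I_dL 'I_dL,
    enc V (opmul (opmul U X) (adj U)) =
    opmul (opmul (UA rep U) (enc V X)) (adj (UA rep U)).

(* single-erasure noise: output system C (x) A with C = 'I_n;
   N(rho) = sum_i 1/n |i><i|_C (x) |phi_i><phi_i|_{A_i} (x) tr_{A_i}(rho) *)
Definition erasure (n : nat) (d : 'I_n -> nat) (phis : forall i : 'I_n, 'I_(d i) -> C)
  (X : Op (Aidx d) (Aidx d)) : Op ('I_n * Aidx d)%type ('I_n * Aidx d)%type :=
  fun x y => \sum_(i < n) (n%:R)^-1 * ((x.1 == i) && (y.1 == i))%:R
     * (phis i (x.2 i) * Num.conj (phis i (y.2 i)))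
     * \sum_(k : 'I_(d i)) X (upd x.2 k) (upd y.2 k).

Definition maxlnd (n : nat) (d : 'I_n -> nat) : R :=
  \big[Num.max/0]_(i < n) ln ((d i)%:R : R).

End QuantumDefs.

(* Main.v *)
(** The circle [diag (u, 1, .., 1, u^-1)] acts on each A_i with integer charges; let M
    be the largest absolute value of a charge that occurs at some site.  By covariance
    the encoded states of the first and of the last level have definite total charges
    that differ by 2.  The environment of the erasure noise receives a random site, and
    n times the charge of that site is an observable of norm at most n M whose
    expectation is the total charge.  If a recovery has fidelity F on a maximally
    entangled state of a set S of levels, then the states of the environment for the
    levels in S are all close to a common one, which bounds their difference of charge:
    [4 <= 8 (n M)^2 |S| (1 - F^2)].  Two levels give [1 <= 2 n M eps_worst] and all
    levels give [1 <= n M d_L eps_e].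

    On the other hand the weights of a representation of SU(d+1) are closed under
    strings [mu - h (e_i - e_j)], [0 <= h <= mu_i - mu_j], and a set of weights closed
    under strings that contains a weight of spread M has at least [C(M + d, d)]
    elements, hence [C(M + d, d) <= dim A_i] for some i.

    Strings are obtained without passing to the Lie algebra.  Let p be the largest
    charge on a string, let [phi(g)] be the diagonal matrix coefficient of a vector of
    that charge, and let alpha be the upper left entry of g in SU(2).  As [g^-1] is
    [D(u) g D(-u)] for a suitable phase u, [phi(g^-1) alpha^p = phi(g) conj(alpha)^p].
    For [g = R D(z) R^-1] this is an identity between Laurent polynomials in z, and
    coprimality of alpha and its conjugate forces [phi(g) = alpha^p].  The binomial
    coefficients of [alpha^p] do not vanish, so each charge p, p-2, .., -p occurs. *)

Require Import Defs.
From HB Require Import structures.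
From mathcomp Require Import all_boot all_order all_algebra.
From mathcomp Require Import complex.
From mathcomp Require Import boolp classical_sets reals exp.
From mathcomp Require Import topology normedtype trigo.
From mathcomp Require Import ring lra zify.
From Stdlib Require Import ClassicalEpsilon.

Set Implicit Arguments.
Unset Strict Implicit.
Unset Printing Implicit Defensive.

Import Order.TTheory GRing.Theory Num.Theory.
Local Open Scope ring_scope.
Local Notation "M ^t*" := (map_mx Num.conj (trmx M)) : ring_scope.

(** * Sets of weights closed under strings *)

(** The entries are the coordinates of a weight, and [x'], [y'] run through its whole string along
    [e_i - e_j]; in particular the exchange of two coordinates lies on the string. *)
Definition string_closed (P : seq int -> Prop) :=
  forall s1 x s2 y s3 x' y',
    P (s1 ++ x :: s2 ++ y :: s3) -> x' + y' = x + y ->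
    (x <= x' <= y) || (y <= x' <= x) -> P (s1 ++ x' :: s2 ++ y' :: s3).

Lemma hockey_stick d m :
  (\sum_(0 <= j < m.+1) 'C(j + d, d) = 'C(m + d.+1, d.+1))%N.
Proof.
elim: m => [|m IH]; first by rewrite big_nat1 !add0n !binn.
by rewrite big_nat_recr //= IH addnC !addSn binS addnS addnC.
Qed.

(** The first branch takes the values [m - k0, .., m], the top of the sum in [hockey_stick]. The
    second, read backwards, takes [k0, .., m - 1] and dominates [0, .., m - k0 - 1] term by term. *)
Lemma folded_hockey_stick d m k0 : (k0 <= m)%N ->
  ('C(m + d.+1, d.+1) <= \sum_(0 <= k < m.+1)
     'C((if (k <= k0)%N then m - k0 + k else m + k0 - k) + d, d))%N.
Proof.
move=> k0m; rewrite -hockey_stick.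
rewrite [X in (_ <= X)%N](@big_cat_nat _ _ _ k0.+1) //= [X in (X <= _)%N](@big_cat_nat _ _ _ (m - k0)) //=; last by lia.
rewrite addnC leq_add //.
  rewrite -{1}[(m - k0)%N]addn0 addnC -{1}[(m - k0)%N]add0n big_addn.
  have -> : (m.+1 - (m - k0) = k0.+1)%N by lia.
  rewrite !big_nat; apply: leq_sum => k /andP[_ kk].
  rewrite ltnS in kk; rewrite kk; apply: leq_bin2l; lia.
rewrite [X in (_ <= X)%N]big_nat_rev /= -[k0.+1]add0n big_addn add0n.
have -> : (m.+1 - k0.+1 = m - k0)%N by lia.
rewrite !big_nat; apply: leq_sum => k /andP[_ kk].
case: ifP => H; first by lia.
apply: leq_bin2l; lia.
Qed.

Lemma seq_max_min (s : seq int) : s != [::] ->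
  exists x y, [/\ x \in s, y \in s & forall z, z \in s -> y <= z <= x].
Proof.
elim: s => //= a [|b s] IH _.
  by exists a, a; rewrite !mem_head; split=> // z; rewrite inE => /eqP->; rewrite lexx.
have [//|x [y [xs ys H]]] := IH.
exists (Num.max a x), (Num.min a y); split.
- by case: (leP a x); rewrite inE ?xs ?eqxx ?orbT.
- by case: (leP a y); rewrite inE ?ys ?eqxx ?orbT.
- move=> z; rewrite inE => /orP[/eqP->|/H /andP[yz zx]].
    by rewrite ge_min le_max lexx.
  by rewrite ge_min le_max yz zx !orbT.
Qed.

Lemma string_closed_cons P a : string_closed P -> string_closed (P \o cons a).
Proof. by move=> H s1 x s2 y s3 x' y'; exact: (H (a :: s1)). Qed.

(** Exchanging two coordinates stays on a string, so any entry can be brought to the head. *)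
Lemma string_closed_head P s (x : int) : string_closed P -> P s -> x \in s ->
  exists s', [/\ P (x :: s'), perm_eq s (x :: s') & size s = (size s').+1].
Proof.
move=> clP; case: s => // a s Ps; rewrite inE => /orP[/eqP->|xs]; first by exists s.
case/splitPr: xs Ps => s1 s2 Ps; exists (s1 ++ a :: s2).
split; last by rewrite /= !size_cat /=.
  apply: (clP [::] a s1 x s2 x a Ps); first exact: addrC.
  by rewrite /= !lexx !andbT le_total.
apply/permP => p; rewrite /= !count_cat /=; lia.
Qed.

Lemma string_closed_extremes P s (x y : int) : string_closed P -> P s ->
  x \in s -> y \in s -> x != y ->
  exists s', [/\ P (y :: x :: s'), {subset s' <= s} & size s = (size s').+2].
Proof.
move=> clP Ps xs ys xy.
have [s1 [P1 p1 z1]] := string_closed_head clP Ps ys.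
have xs1 : x \in s1.
  by move: xs; rewrite (perm_mem p1) inE (negbTE xy).
have [s2 [P2 p2 z2]] := string_closed_head (string_closed_cons (a := y) clP) P1 xs1.
exists s2; split=> //; last by rewrite z1 z2.
by move=> z zs; rewrite (perm_mem p1) inE (perm_mem p2) inE zs !orbT.
Qed.

(* Varying the first of two extreme coordinates over all its values, a third
   coordinate keeps the spread of the remaining ones large enough for
   [folded_hockey_stick]. *)
Lemma string_fibers P d s (x y : int) (m : nat) : string_closed P -> P s ->
  size s = d.+2 -> x \in s -> y \in s -> (forall z, z \in s -> y <= z <= x) ->
  x = y + m%:Z -> (0 < m)%N ->
  exists f : nat -> nat,
    ('C(m + d.+1, d.+1) <= \sum_(0 <= k < m.+1) 'C(f k + d, d))%N /\
    forall k, (k <= m)%N -> exists s' u v, [/\ P ((y + k%:Z) :: s'),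
      size s' = d.+1, u \in s', v \in s' & v + (f k)%:Z <= u].
Proof.
move=> clP Ps sz xs ys ext xE m0.
have xy : x != y by apply/eqP; lia.
(* With two coordinates only, the head determines the other one: every fiber counts 1, and there are
   [m + 1] heads. *)
have [[|w s3] [P1 sub sz1]] := string_closed_extremes clP Ps xs ys xy.
  have d0 : d = 0%N by move: sz; rewrite sz1 => -[].
  subst d; exists (fun=> 0%N); split.
    by rewrite (eq_bigr (fun=> 1%N)) ?sum_nat_const_nat ?muln1 ?subn0 ?bin1 ?addn1.
  move=> k km; exists [:: x - k%:Z], (x - k%:Z), (x - k%:Z).
  split; rewrite ?mem_head ?addr0 //.
  by apply: (clP [::] y [::] x [::] _ _ P1); lia.
have /andP[yw wx] : y <= w <= x by apply: ext; apply: sub; rewrite mem_head.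
have [k0 k0E] : exists k0 : nat, w = y + k0%:Z by exists `|w - y|%N; lia.
have k0m : (k0 <= m)%N by lia.
exists (fun k => if (k <= k0)%N then m - k0 + k else m + k0 - k)%N.
split; first exact: folded_hockey_stick.
(* Up to [w] the head [y] is raised at the expense of [w], and [x] keeps the spread large. Beyond
   [w], the entry [w] moves to the head and is raised at the expense of [x], while [y] is kept. *)
move=> k km; case: ifP => kk0.
  exists [:: x, w - k%:Z & s3], x, (w - k%:Z).
  split; rewrite ?inE ?eqxx ?orbT //.
  - by apply: (clP [::] y [:: x] w s3 _ _ P1); lia.
  - by move: sz; rewrite sz1 /= => -[->].
  - lia.
exists [:: x - (k - k0)%:Z, y & s3], (x - (k - k0)%:Z), y.
split; rewrite ?inE ?eqxx ?orbT //.
- have P2 : P [:: w, x, y & s3] by apply: (clP [::] y [:: x] w s3 _ _ P1); lia.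
  by apply: (clP [::] w [::] x (y :: s3) _ _ P2); lia.
- by move: sz; rewrite sz1 /= => -[->].
- lia.
Qed.

(** Induction on [d]: the sequences with a given head form a set closed under strings, sets with
    distinct heads are disjoint, and [string_fibers] provides a large enough spread in each. *)
Lemma string_closed_card d P (m : nat) s (x y : int) :
  string_closed P -> P s -> size s = d.+1 -> x \in s -> y \in s -> y + m%:Z <= x ->
  exists L : seq (seq int), [/\ uniq L, 'C(m + d, d) <= size L &
    forall l, l \in L -> P l /\ size l = d.+1]%N.
Proof.
elim: d P m s x y => [|d IH] P m s x y clP Ps sz xs ys mxy.
  by exists [:: s]; rewrite bin0; split=> // l; rewrite inE => /eqP->.
have sn0 : s != [::] by case: s sz {Ps xs ys}.
have [x1 [y1 [x1s y1s ext]]] := seq_max_min sn0.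
have [m1 m1E] : exists m1 : nat, x1 = y1 + m1%:Z.
  by exists `|x1 - y1|%N; have := ext _ x1s; lia.
have mm1 : (m <= m1)%N by have := ext _ xs; have := ext _ ys; lia.
(* If all entries are equal then [m = 0], and [s] alone meets the bound 1. *)
have [m10|m1_gt0] := posnP m1.
  exists [:: s]; rewrite (_ : m = 0)%N ?binn; last by lia.
  by split=> // l; rewrite inE => /eqP->.
have [f [fsum fib]] := string_fibers clP Ps sz x1s y1s ext m1E m1_gt0.
suff [L [uL zL HL]] : exists L : seq (seq int), [/\ uniq L,
    (\sum_(0 <= k < m1.+1) 'C(f k + d, d) <= size L)%N &
    forall l, l \in L -> [/\ P l, size l = d.+2 &
       exists2 k, (k < m1.+1)%N & head 0 l = y1 + k%:Z]].
  exists L; split=> //; last by move=> l /HL[].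
  apply: leq_trans zL; apply: leq_trans fsum.
  by apply: leq_bin2l; rewrite leq_add2r.
suff fibers n : (n <= m1.+1)%N -> exists L : seq (seq int), [/\ uniq L,
    (\sum_(0 <= k < n) 'C(f k + d, d) <= size L)%N &
    forall l, l \in L -> [/\ P l, size l = d.+2 &
       exists2 k, (k < n)%N & head 0 l = y1 + k%:Z]] by exact: fibers.
elim: n => [_|n IHn nm]; first by exists [::]; rewrite big_geq.
have [L [uL zL HL]] := IHn (ltnW nm).
have [s' [u [v [Ps' sz' us vs uv]]]] := fib n nm.
have [L' [uL' zL' HL']] := IH _ (f n) s' u v (string_closed_cons (a := y1 + n%:Z) clP) Ps' sz' us vs uv.
exists (L ++ map (cons (y1 + n%:Z)) L'); split.
- rewrite cat_uniq uL map_inj_uniq ?uL' ?andbT //=; last by move=> ? ? [].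
  apply/hasPn => l /mapP[l' _ ->]; apply/negP => /HL[_ _ [k kn /= /addrI[kE]]]; by move: kn; rewrite kE ltnn.
- by rewrite big_nat_recr //= size_cat size_map leq_add.
- move=> l; rewrite mem_cat => /orP[/HL[Pl sl [k kn hl]]|/mapP[l' /HL'[Pl' zl'] ->]].
    by split=> //; exists k => //; exact: ltnW.
  by split=> //=; [rewrite zl'|exists n].
Qed.

(** * Numerical estimates *)

(** This is [(n / k)^k <= 'C(n, k)], by induction from [(k + 1) 'C(n + 1, k + 1) = (n + 1) 'C(n, k)]
    and [(n + 1) / (k + 1) <= n / k]. *)
Lemma expn_le_bin n k : (k <= n)%N -> (n ^ k <= 'C(n, k) * k ^ k)%N.
Proof.
elim: k n => [|k IH] [|n] // kn; rewrite ltnS in kn.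
have [->|k0] := posnP k; first by rewrite bin1 muln1.
rewrite [X in (_ <= _ * X)%N]expnS mulnA [('C(_, _) * _)%N]mulnC -mul_bin_diag expnS -mulnA leq_mul2l /=.
rewrite -(@leq_pmul2r (k ^ k)) ?expn_gt0 ?k0 //.
apply: (@leq_trans (n ^ k * k.+1 ^ k)).
  by rewrite -!expnMn leq_exp2r //; lia.
by rewrite mulnAC leq_mul2r IH ?orbT.
Qed.

Section Numerics.
Variable R : realType.

Lemma ln_ge_oneBinv (x : R) : 0 < x -> 1 - x^-1 <= ln x.
Proof.
move=> x0; have xi : 0 < x^-1 by rewrite invr_gt0.
have := @le_ln1Dx R (x^-1 - 1) ltac:(lra).
by rewrite [1 + _]addrC subrK lnV ?posrE // => H; lra.
Qed.

Lemma ln_bin_ge m d : (0 < m)%N ->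
  m%:R * ln (1 + d%:R / m%:R) <= ln ('C(m + d, m)%:R : R).
Proof.
move=> m0; have m0' : 0 < m%:R :> R by rewrite ltr0n.
have p0 : 0 < 1 + d%:R / m%:R :> R by rewrite ltr_pwDl // divr_ge0 // ler0n.
rewrite mulr_natl -lnXn // ler_ln ?posrE ?exprn_gt0 //; last by rewrite ltr0n bin_gt0 leq_addr.
rewrite -[X in X + _](divff (lt0r_neq0 m0')) -mulrDl -natrD expr_div_n.
rewrite ler_pdivrMr ?exprn_gt0 // -!natrX -natrM ler_nat.
by apply: expn_le_bin; rewrite leq_addr.
Qed.

(** Two regimes. If [3 M <= d], then [D >= M ln 4 >= M], and the main term alone is at most [e].
    Otherwise [D >= d ln (4/3) >= d / 4], and the correction with constant 4 makes the left side
    nonpositive. *)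
Lemma eps_lower_bound n d M (D e : R) : (0 < n)%N -> (0 < d)%N -> (0 < M)%N ->
  ln ('C(M + d, d)%:R : R) <= D -> 1 <= 2 * n%:R * M%:R * e ->
  (2 * n%:R * D)^-1 - 4 / (n%:R * d.+1%:R) <= e.
Proof.
move=> n0 d0 M0 HD He.
have n0' : 0 < n%:R :> R by rewrite ltr0n.
have d0' : 0 < d%:R :> R by rewrite ltr0n.
have M0' : 0 < M%:R :> R by rewrite ltr0n.
have d1 : 1 <= d%:R :> R by rewrite ler1n.
have e0 : 0 < e by rewrite -(pmulr_rgt0 _ (mulr_gt0 (mulr_gt0 (ltr0Sn R 1) n0') M0')); apply: lt_le_trans He.
have HD1 : M%:R * ln (1 + d%:R / M%:R) <= D.
  by apply: le_trans (ln_bin_ge _ M0) _; rewrite -{2}(addnK d M) bin_sub ?leq_addl.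
have HD2 : d%:R * ln (1 + M%:R / d%:R) <= D.
  by apply: le_trans (ln_bin_ge _ d0) _; rewrite addnC.
have t0 : 0 <= 4 / (n%:R * d.+1%:R) :> R by rewrite divr_ge0 // mulr_ge0 ?ler0n.
have [H|H] := leP (3 * M%:R) (d%:R : R).
  have MD : M%:R <= D.
    apply: le_trans HD1; rewrite ler_peMr ?(ltW M0') //.
    apply: (@le_trans _ _ (ln (2 ^+ 2 : R))).
      rewrite lnXn // mulr2n; have := @ln_ge_oneBinv (2:R) ltac:(lra); lra.
    have H3 : 3 <= d%:R / M%:R :> R by rewrite ler_pdivlMr.
    by rewrite ler_ln ?posrE ?exprn_gt0 //; lra.
  have D0 : 0 < D by exact: lt_le_trans MD.
  rewrite lerBlDr (@le_trans _ _ e) ?lerDl //.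
  rewrite -div1r ler_pdivrMr ?mulr_gt0 //; apply: le_trans He _.
  have : n%:R * e * M%:R <= n%:R * e * D by rewrite ler_pM2l // mulr_gt0.
  lra.
have HD3 : d%:R / 4 <= D.
  apply: le_trans HD2; rewrite ler_pM2l //.
  have : 3^-1 < M%:R / d%:R :> R by rewrite ltr_pdivlMr //; lra.
  move=> H3; have := @ln_ge_oneBinv (4 / 3 : R) ltac:(lra).
  rewrite invf_div => H4; apply: (@le_trans _ _ (ln (4 / 3 : R))); first lra.
  by rewrite ler_ln ?posrE //; lra.
have D0 : 0 < D by apply: lt_le_trans HD3; lra.
rewrite (@le_trans _ _ 0) ?(ltW e0) // subr_le0.
rewrite -div1r ler_pdivrMr ?mulr_gt0 // mulrAC ler_pdivlMr ?mulr_gt0 ?ltr0Sn //.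
have : n%:R * d.+1%:R <= n%:R * (8 * D) by rewrite ler_pM2l // -natr1; lra.
lra.
Qed.

(** The binomial is at least [(1 + M / d)^d], and the bound on [e] gives [1 / (2 e n (d + 1)) <= M /
    (d + 1) <= M / d]. *)
Lemma ln_dim_bound_polynomial n d M (D e : R) : (0 < n)%N -> (0 < d)%N -> (0 < M)%N ->
  ln ('C(M + d, d)%:R : R) <= D -> 1 <= 2 * n%:R * M%:R * e ->
  d%:R * ln ((2 * e * n%:R * d.+1%:R)^-1) <= D.
Proof.
move=> n0 d0 M0 HD He.
have n0' : 0 < n%:R :> R by rewrite ltr0n.
have d0' : 0 < d%:R :> R by rewrite ltr0n.
have M0' : 0 < M%:R :> R by rewrite ltr0n.
have e0 : 0 < e by rewrite -(pmulr_rgt0 _ (mulr_gt0 (mulr_gt0 (ltr0Sn R 1) n0') M0')); apply: lt_le_trans He.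
apply: le_trans HD; rewrite addnC; apply: le_trans (ln_bin_ge _ d0).
rewrite ler_pM2l // ler_ln ?posrE ?invr_gt0 ?mulr_gt0 //; last first.
  by rewrite ltr_pwDl // divr_ge0 // ltW.
apply: (@le_trans _ _ (M%:R / d%:R)); last by rewrite lerDr.
rewrite -div1r ler_pdivrMr ?mulr_gt0 // mulrAC ler_pdivlMr // mul1r.
rewrite -natr1; have : d%:R <= 2 * n%:R * M%:R * e * d%:R by rewrite ler_peMl // ltW.
have : 0 <= M%:R * (2 * e * n%:R) by rewrite !mulr_ge0 // ltW.
lra.
Qed.

(** With [r = 1 / (2 n e) <= M], the binomial is estimated at the integer [m] next above [r] instead
    of [M]: its logarithm is at least [m ln (1 + d / m) >= r ln (d / (1 + r))]. *)
Lemma ln_dim_bound_entropic n d M (D e : R) : (0 < n)%N -> (0 < d)%N -> (0 < M)%N ->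
  ln ('C(M + d, d)%:R : R) <= D -> 1 <= 2 * n%:R * M%:R * e ->
  ln d%:R / (2 * n%:R * e) - ln (1 + (2 * n%:R * e)^-1) / (2 * n%:R * e) <= D.
Proof.
move=> n0 d0 M0 HD He.
have n0' : 0 < n%:R :> R by rewrite ltr0n.
have d0' : 0 < d%:R :> R by rewrite ltr0n.
have M0' : 0 < M%:R :> R by rewrite ltr0n.
have e0 : 0 < e by rewrite -(pmulr_rgt0 _ (mulr_gt0 (mulr_gt0 (ltr0Sn R 1) n0') M0')); apply: lt_le_trans He.
set r := (2 * n%:R * e)^-1.
have r0 : 0 < r by rewrite invr_gt0 !mulr_gt0.
have rM : r <= M%:R by rewrite -[r]div1r ler_pdivrMr ?mulr_gt0 //; lra.
have D0 : 0 <= D by apply: le_trans HD; rewrite ln_ge0 // ler1n bin_gt0 leq_addl.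
have r1 : 0 < 1 + r by lra.
rewrite -mulrBl -ln_div ?posrE // mulrC.
(* A nonpositive logarithm makes the claim follow from [0 <= D]; below, the logarithm may be
   multiplied by [m >= r]. *)
have [H|H] := leP (ln (d%:R / (1 + r))) 0.
  by apply: le_trans D0; rewrite mulr_ge0_le0 // ltW.
(* Minimality of [m] gives both [m <= M] and [m <= 1 + r]; the latter is the source of the term
   [1 + (2 n e)^-1]. *)
have ex : exists k, r <= k%:R by exists M.
case: (ex_minnP ex) => m rm mmin.
have m0 : (0 < m)%N by rewrite -(ltr0n R); exact: lt_le_trans rm.
have m0' : 0 < m%:R :> R by rewrite ltr0n.
have mM : (m <= M)%N by exact: mmin.
have mr : m%:R <= 1 + r.
  rewrite leNgt; apply/negP => rm1; have : (m <= m.-1)%N.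
    by apply: mmin; rewrite -subn1 natrB //; lra.
  by case: (m) m0 => // k _; rewrite ltnn.
apply: (@le_trans _ _ (ln ('C(m + d, m)%:R))); last first.
  apply: le_trans HD; rewrite ler_ln ?posrE ?ltr0n ?bin_gt0 ?leq_addr ?leq_addl //.
  rewrite ler_nat -{2}(addnK d m) bin_sub ?leq_addl //.
  by apply: leq_bin2l; rewrite leq_add2r.
apply: le_trans (ln_bin_ge _ m0).
apply: (@le_trans _ _ (m%:R * ln (d%:R / (1 + r)))); first by rewrite ler_wpM2r // ltW.
rewrite ler_pM2l // ler_ln ?posrE ?divr_gt0 //; last first.
  by rewrite ltr_pwDl // divr_ge0 // ltW.
apply: (@le_trans _ _ (d%:R / m%:R)); last by rewrite lerDr.
by rewrite ler_pM2l // lef_pV2 ?posrE.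
Qed.
End Numerics.

(** * Square roots of positive operators and fidelity *)

Section PositiveOperators.
Variable R : realType.
Local Notation C := (R[i]).

Lemma psd_gram (T K : finType) (c : K -> C) (w : K -> T -> C) :
  (forall k, 0 <= c k) ->
  psd (fun x y => \sum_k c k * ((w k x)^* * w k y)).
Proof.
move=> c0; split=> [x y|v].
  rewrite rmorph_sum; apply: eq_bigr => k _.
  by rewrite !rmorphM /= conjCK (geC0_conj (c0 k)) [_ * w k y]mulrC.
have -> : \sum_x \sum_y (v x)^* * (\sum_k c k * ((w k x)^* * w k y)) * v y
    = \sum_k c k * `|\sum_y w k y * v y| ^+ 2.
  transitivity (\sum_x \sum_k \sum_y c k * ((w k x * v x)^* * (w k y * v y))).
    apply: eq_bigr => x _; rewrite exchange_big /=; apply: eq_bigr => y _.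
    rewrite mulr_sumr mulr_suml; apply: eq_bigr => k _; rewrite rmorphM /=; ring.
  rewrite exchange_big; apply: eq_bigr => k _ /=.
  rewrite normCKC rmorph_sum mulr_suml mulr_sumr; apply: eq_bigr => x _.
  by rewrite mulr_sumr mulr_sumr.
by apply: sumr_ge0 => k _; rewrite mulr_ge0 // exprn_ge0.
Qed.

(** The spectral theorem for Hermitian matrices, carried over along the enumeration of [T]; the form
    evaluated at an eigenvector gives the sign of its eigenvalue. *)
Lemma psd_spectral (T : finType) (A : Op R T T) : psd A ->
  exists c : 'I_#|T| -> C, exists w : 'I_#|T| -> T -> C,
  [/\ forall k, 0 <= c k,
      forall k l, \sum_x w k x * (w l x)^* = (k == l)%:R &
      A = fun x y => \sum_k c k * ((w k x)^* * w k y)].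
Proof.
move=> [Ah Ap].
pose M := \matrix_(i, j < #|T|) A (enum_val i) (enum_val j).
have Mh : M \is hermsymmx.
  apply/is_hermitianmxP/matrixP => i j.
  by rewrite expr0 scale1r !mxE.
have /orthomx_spectralP := hermitian_normalmx Mh.
have Pu := spectral_unitarymx M; rewrite invmx_unitary //.
move: (spectralmx M) (spectral_diag M) Pu => P sp Pu ME.
have ortho k l : \sum_x P k x * (P l x)^* = (k == l)%:R.
  have /unitarymxP/matrixP/(_ k l) := Pu; rewrite !mxE => <-.
  by apply: eq_bigr => x _; rewrite !mxE.
have enumE (F : T -> C) : \sum_x F x = \sum_(i < #|T|) F (enum_val i).
  by rewrite (reindex (fun i : 'I_#|T| => enum_val i)) //; apply/onW_bij/enum_val_bij.
have orthoT k l : \sum_x P k (enum_rank x) * (P l (enum_rank x))^* = (k == l)%:R.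
  by rewrite -ortho enumE; apply: eq_bigr => i _; rewrite enum_valK.
have AE x y : A x y = \sum_k sp 0 k * ((P k (enum_rank x))^* * P k (enum_rank y)).
  have /matrixP/(_ (enum_rank x) (enum_rank y)) := ME.
  rewrite !mxE !enum_rankK => ->; apply: eq_bigr => k _.
  by rewrite mul_mx_diag !mxE; ring.
exists (fun k => sp 0 k), (fun k x => P k (enum_rank x)); split.
- move=> l; pose v x := (P l (enum_rank x))^*.
  have := Ap v; congr (_ <= _).
  transitivity (\sum_k sp 0 k * (k == l)%:R); last first.
    by rewrite (bigD1 l) //= eqxx mulr1 big1 ?addr0 // => k /negbTE->; rewrite mulr0.
  transitivity (\sum_x \sum_k \sum_y sp 0 k * ((P l (enum_rank x) * (P k (enum_rank x))^*) * (P k (enum_rank y) * (P l (enum_rank y))^*))).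
    apply: eq_bigr => x _; rewrite exchange_big /=; apply: eq_bigr => y _.
    rewrite AE mulr_sumr mulr_suml /v conjCK; apply: eq_bigr => k _; ring.
  rewrite exchange_big; apply: eq_bigr => k _ /=.
  transitivity (sp 0 k * ((l == k)%:R * (k == l)%:R)).
    rewrite -!orthoT mulr_suml mulr_sumr; apply: eq_bigr => x _.
    by rewrite !mulr_sumr.
  by case: eqVneq => _; rewrite ?mul1r ?mul0r ?mulr0.
- exact: orthoT.
- by apply/funext => x; apply/funext => y; rewrite AE.
Qed.

(** Roots of the eigenvalues show that the choice in [psd_sqrt] is not vacuous. Uniqueness of the
    root is established only in rank one, by [psd_sqrt_rank1]. *)
Lemma psd_sqrtP (T : finType) (A : Op R T T) : psd A ->
  psd (psd_sqrt A) /\ opmul (psd_sqrt A) (psd_sqrt A) = A.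
Proof.
move=> Apsd.
apply: (@epsilon_spec _ _ (fun B : Op R T T => psd B /\ opmul B B = A)).
have [c [w [c0 ortho ->]]] := psd_spectral Apsd.
exists (fun x y => \sum_k sqrtC (c k) * ((w k x)^* * w k y)); split.
  by apply: psd_gram => k; rewrite sqrtC_ge0.
apply/funext => x; apply/funext => y; rewrite /opmul.
transitivity (\sum_k \sum_l sqrtC (c k) * sqrtC (c l) * (w k x)^* * w l y * (k == l)%:R).
  under eq_bigr do rewrite mulr_suml.
  rewrite exchange_big /=; apply: eq_bigr => k _.
  under eq_bigr do rewrite mulr_sumr.
  rewrite exchange_big /=; apply: eq_bigr => l _.
  rewrite -ortho mulr_sumr; apply: eq_bigr => z _; ring.
apply: eq_bigr => k _; rewrite (bigD1 k) //= big1 ?addr0 => [|l].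
  by rewrite eqxx mulr1 -expr2 sqrtCK; ring.
by rewrite eq_sym => /negbTE->; rewrite mulr0.
Qed.

Lemma psd_proj (T : finType) (phi : T -> C) : psd (proj phi).
Proof.
have -> : proj phi = fun x y => \sum_(k : 'I_1) 1 * ((phi x)^*^* * (phi y)^*).
  by apply/funext => x; apply/funext => y; rewrite big_ord1 mul1r conjCK.
by apply: (@psd_gram _ 'I_1 (fun=> 1) (fun _ x => (phi x)^*)) => _; exact: ler01.
Qed.

(** With [a = Q phi], the columns of [Q] are at distance 0 from those of [|a><phi|]. Hermitian
    symmetry makes [a] a multiple [b] of [phi], positivity gives [0 <= b], and [b^2 = s]. *)
Lemma psd_sqrt_rank1 (T : finType) (Q : Op R T T) (phi : T -> C) (s : C) :
  psd Q -> unitv phi -> 0 <= s -> opmul Q Q = (fun x y => s * proj phi x y) ->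
  Q = fun x y => sqrtC s * proj phi x y.
Proof.
move=> [Qh Qp] phi1 s0 QQ.
have QQE x y : \sum_z Q x z * Q z y = s * (phi x * (phi y)^*).
  by have := congr1 (fun F => F x y) QQ.
pose a x := \sum_y Q x y * phi y.
have Qa x : \sum_y Q x y * a y = s * phi x.
  under eq_bigr do rewrite mulr_sumr.
  rewrite exchange_big /=.
  transitivity (\sum_y s * (phi x * (phi y)^*) * phi y).
    by apply: eq_bigr => y _; rewrite -QQE mulr_suml; apply: eq_bigr => z _; ring.
  rewrite -[RHS]mulr1 -[in RHS]phi1 mulr_sumr; apply: eq_bigr => y _; ring.
have ac x : (a x)^* = \sum_y (phi y)^* * Q y x.
  by rewrite rmorph_sum; apply: eq_bigr => y _; rewrite rmorphM /= -Qh mulrC.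
have aa : \sum_x (a x)^* * a x = s.
  transitivity (\sum_y (phi y)^* * \sum_x Q y x * a x).
    under eq_bigr do rewrite ac mulr_suml.
    rewrite exchange_big; apply: eq_bigr => y _ /=.
    by rewrite mulr_sumr; apply: eq_bigr => z _; ring.
  under eq_bigr do rewrite Qa.
  rewrite -[RHS]mulr1 -[in RHS]phi1 mulr_sumr; apply: eq_bigr => y _; ring.
have QE x y : Q x y = a x * (phi y)^*.
  suff : \sum_z `|Q z y - a z * (phi y)^*| ^+ 2 = 0.
    move/eqP; rewrite psumr_eq0 => [/allP/(_ x)|z _]; last exact: exprn_ge0.
    rewrite mem_index_enum => /(_ isT) /=.
    by rewrite expf_eq0 /= normr_eq0 subr_eq0 => /eqP.
  transitivity ((\sum_z Q y z * Q z y) - (\sum_z Q y z * a z) * (phi y)^*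
      - phi y * (\sum_z Q y z * a z)^* + phi y * (\sum_z (a z)^* * a z) * (phi y)^*).
    rewrite rmorph_sum mulr_suml !mulr_sumr mulr_suml -!sumrB -big_split /=.
    apply: eq_bigr => z _; rewrite normCKC rmorphB !rmorphM /= conjCK -!Qh; ring.
  rewrite QQE Qa aa rmorphM /= (geC0_conj s0); ring.
pose b := \sum_x phi x * (a x)^*.
have aE y : a y = b * phi y.
  rewrite -[LHS]mulr1 -phi1 mulr_sumr mulr_suml; apply: eq_bigr => x _.
  have := Qh y x; rewrite !QE rmorphM /= conjCK => H.
  by rewrite mulrA H; ring.
have b0 : 0 <= b.
  have H : 0 <= \sum_x (phi x)^* * a x.
    have := Qp phi; congr (_ <= _); apply: eq_bigr => x _.
    by rewrite mulr_sumr; apply: eq_bigr => y _; rewrite mulrA.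
  have -> : b = (\sum_x (phi x)^* * a x)^*; last by rewrite (geC0_conj H).
  by rewrite rmorph_sum; apply: eq_bigr => x _; rewrite rmorphM /= conjCK.
have bb : b ^+ 2 = s.
  rewrite -aa -[LHS]mulr1 -phi1 mulr_sumr; apply: eq_bigr => x _.
  by rewrite aE rmorphM /= (geC0_conj b0); ring.
apply/funext => x; apply/funext => y.
by rewrite QE aE -bb sqrCK // mulrA.
Qed.

(** Against a pure state both the second root and the root in the trace norm have rank one, so their
    values are forced although [psd_sqrt] is a mere choice. *)
Lemma fid_proj (T : finType) (sigma : Op R T T) (phi : T -> C) :
  psd sigma -> unitv phi -> 0 <= fid sigma (proj phi) /\
  ((fid sigma (proj phi))%:C)%C ^+ 2
    = \sum_x \sum_y (phi x)^* * sigma x y * phi y.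
Proof.
move=> sp phi1.
have [[rh _] rE] := psd_sqrtP sp.
have [pp pE] := psd_sqrtP (psd_proj phi).
have PE : psd_sqrt (proj phi) = proj phi.
  rewrite (psd_sqrt_rank1 (s := 1) pp phi1 ler01) ?sqrtC1.
    by apply/funext => x; apply/funext => y; rewrite mul1r.
  by rewrite pE; apply/funext => x; apply/funext => y; rewrite mul1r.
set s := RHS; have s0 : 0 <= s by have [_] := sp; exact.
pose X := opmul (psd_sqrt sigma) (proj phi).
have XE : opmul (adj X) X = fun x y => s * proj phi x y.
  apply/funext => x; apply/funext => y; rewrite /opmul /adj /X /opmul /s -[in RHS]rE /proj.
  transitivity (\sum_z \sum_u \sum_v phi x * (phi y)^* *
    ((phi u)^* * psd_sqrt sigma u z * psd_sqrt sigma z v * phi v)).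
    apply: eq_bigr => z _; rewrite rmorph_sum mulr_suml; apply: eq_bigr => u _.
    rewrite mulr_sumr; apply: eq_bigr => v _.
    rewrite !rmorphM /= conjCK -rh; ring.
  rewrite exchange_big mulr_suml; apply: eq_bigr => u _ /=.
  rewrite exchange_big mulr_suml; apply: eq_bigr => v _ /=.
  rewrite /opmul mulr_sumr !mulr_suml; apply: eq_bigr => z _; ring.
have Xp : psd (opmul (adj X) X).
  rewrite XE; have := @psd_gram T 'I_1 (fun=> s) (fun _ x => (phi x)^*) (fun=> s0).
  congr psd; apply/funext => x; apply/funext => y.
  by rewrite big_ord1 conjCK.
have [qp qE] := psd_sqrtP Xp.
have tE : fid sigma (proj phi) = complex.Re (sqrtC s).
  rewrite /fid PE /tnorm -/X (psd_sqrt_rank1 qp phi1 s0 (etrans qE XE)).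
  congr complex.Re; rewrite /optr -[RHS]mulr1 -[in RHS]phi1 mulr_sumr.
  by apply: eq_bigr => x _; rewrite /proj [_^* * _]mulrC.
have q0 : 0 <= sqrtC s by rewrite sqrtC_ge0.
have qRe : ((complex.Re (sqrtC s))%:C)%C = sqrtC s.
  by apply/RRe_real; exact: ger0_real.
rewrite tE qRe sqrtCK; split=> //.
by move: q0; rewrite -{1}qRe; rewrite lecR.
Qed.
End PositiveOperators.

(** * The environment of the recovery *)

Section Expectation.
Variable R : realType.
Local Notation C := (R[i]).

(** By Lagrange's identity, twice the gap is a double sum of squares. *)
Lemma cauchy_schwarz_real (I : finType) (f g : I -> C) :
  (forall i, f i \is Num.real) -> (forall i, g i \is Num.real) ->
  (\sum_i f i * g i) ^+ 2 <= (\sum_i f i ^+ 2) * (\sum_i g i ^+ 2).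
Proof.
move=> fr gr; rewrite -subr_ge0.
have : 0 <= \sum_i \sum_j (f i * g j - f j * g i) ^+ 2.
  apply: sumr_ge0 => i _; apply: sumr_ge0 => j _.
  by rewrite real_exprn_even_ge0 // rpredB // rpredM.
suff -> : \sum_i \sum_j (f i * g j - f j * g i) ^+ 2 =
   2 * ((\sum_i f i ^+ 2) * (\sum_i g i ^+ 2) - (\sum_i f i * g i) ^+ 2).
  by rewrite pmulr_rge0 // ltr0n.
have prodE (a b : I -> C) : (\sum_i a i) * (\sum_j b j) = \sum_i \sum_j a i * b j.
  by rewrite mulr_suml; apply: eq_bigr => i _; rewrite mulr_sumr.
transitivity ((\sum_i f i ^+ 2) * (\sum_i g i ^+ 2) + (\sum_i g i ^+ 2) * (\sum_i f i ^+ 2)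
  - 2 * ((\sum_i f i * g i) * (\sum_i f i * g i))); last by ring.
rewrite !prodE mulr_sumr -!big_split -sumrB /=; apply: eq_bigr => i _.
rewrite mulr_sumr -!big_split -sumrB /=; apply: eq_bigr => j _; ring.
Qed.

(** Factor [|u|^2 - |w|^2] as [(|u| - |w|) (|u| + |w|)] and apply Cauchy-Schwarz: the two factors
    have square sums [2 - 2 B] and [2 + 2 B], and [B] is at least the modulus of the overlap. *)
Lemma expectation_diff (Y : finType) (Z : Y -> C) (z : C) (u w : Y -> C) :
  (forall y, `|Z y| <= z) ->
  \sum_y `|u y| ^+ 2 = 1 -> \sum_y `|w y| ^+ 2 = 1 ->
  `|(\sum_y Z y * `|u y| ^+ 2) - \sum_y Z y * `|w y| ^+ 2| ^+ 2
    <= 4 * z ^+ 2 * (1 - `|\sum_y (w y)^* * u y| ^+ 2).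
Proof.
move=> Zz u1 w1.
pose B := \sum_y `|w y| * `|u y|.
have z0 (y : Y) : 0 <= z by exact: le_trans (Zz y).
have bound : `|(\sum_y Z y * `|u y| ^+ 2) - \sum_y Z y * `|w y| ^+ 2|
    <= \sum_y z * (`| `|u y| - `|w y| | * (`|u y| + `|w y|)).
  rewrite -sumrB; apply: le_trans (ler_norm_sum _ _ _) _.
  apply: ler_sum => y _; rewrite -mulrBr subr_sqr normrM.
  rewrite ler_pM // normrM ler_wpM2l // ger0_norm // addr_ge0 //.
have cs := @cauchy_schwarz_real Y (fun y => `| `|u y| - `|w y| |) (fun y => `|u y| + `|w y|).
have := cs (fun=> normr_real _) (fun y => realD (normr_real _) (normr_real _)).
have -> : \sum_y `| `|u y| - `|w y| | ^+ 2 = 2 - 2 * B.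
  transitivity (\sum_y `|u y| ^+ 2 + \sum_y `|w y| ^+ 2 - 2 * B).
    rewrite /B mulr_sumr -big_split -sumrB /=; apply: eq_bigr => y _.
    by rewrite real_normK ?realB ?normr_real //; ring.
  by rewrite u1 w1.
have -> : \sum_y (`|u y| + `|w y|) ^+ 2 = 2 + 2 * B.
  transitivity (\sum_y `|u y| ^+ 2 + \sum_y `|w y| ^+ 2 + 2 * B).
    rewrite /B mulr_sumr -!big_split /=; apply: eq_bigr => y _; ring.
  by rewrite u1 w1.
have Bge : `|\sum_y (w y)^* * u y| <= B.
  apply: le_trans (ler_norm_sum _ _ _) _; apply: ler_sum => y _.
  by rewrite normrM norm_conjC.
move=> cs'.
apply: (@le_trans _ _ (z ^+ 2 * ((2 - 2 * B) * (2 + 2 * B)))).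
  apply: le_trans (_ : (\sum_y z * (`| `|u y| - `|w y| | * (`|u y| + `|w y|))) ^+ 2 <= _).
    by rewrite ler_sqr ?nnegrE ?normr_ge0 //; exact: le_trans bound.
  rewrite -mulr_sumr exprMn; apply: ler_wpM2l cs'.
  (* The sign of [z] is known only through a point of [Y]; one exists because [u] has norm 1. *)
  have [y _|noy] := pickP (@predT Y); first by rewrite exprn_ge0 // (z0 y).
  by move: u1; rewrite big1 => [/eqP|y]; [rewrite eq_sym oner_eq0|have := noy y].
have zz : 0 <= z ^+ 2.
  have [y _|noy] := pickP (@predT Y); first by rewrite exprn_ge0 // (z0 y).
  by move: u1; rewrite big1 => [/eqP|y]; [rewrite eq_sym oner_eq0|have := noy y].
have -> : z ^+ 2 * ((2 - 2 * B) * (2 + 2 * B)) = 4 * z ^+ 2 * (1 - B ^+ 2) by ring.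
apply: ler_wpM2l; first by rewrite mulr_ge0.
by rewrite lerD2l lerN2 ler_sqr ?nnegrE //; exact: le_trans Bge.
Qed.

End Expectation.

Section Environment.
Variable R : realType.
Local Notation C := (R[i]).

Lemma channel_sum (S T I : finType) (K : Op R S S -> Op R T T) (c : I -> C) (X : I -> Op R S S) :
  is_channel K ->
  K (fun x y => \sum_i c i * X i x y) = fun x y => \sum_i c i * K (X i) x y.
Proof.
move=> [lin _ _].
have K0 : K (fun _ _ => 0) = fun _ _ => 0.
  have := lin 1 (fun _ _ => 0) (fun _ _ => 0).
  have -> : (fun _ _ : S => 1 * 0 + 0) = (fun _ _ => 0 : C).
    by apply/funext => x; apply/funext => y; rewrite mulr0 addr0.
  move=> E; apply/funext => x; apply/funext => y.
  have := congr1 (fun F => F x y) E; rewrite mul1r => /eqP.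
  by rewrite -subr_eq subrr eq_sym => /eqP.
elim: (index_enum I) => [|i s IH].
  have -> : (fun x y => \sum_(i <- [::]) c i * X i x y) = (fun _ _ : S => 0 : C).
    by apply/funext => x; apply/funext => y; rewrite big_nil.
  by rewrite K0; apply/funext => x; apply/funext => y; rewrite big_nil.
have -> : (fun x y => \sum_(j <- i :: s) c j * X j x y) =
   (fun x y => c i * X i x y + \sum_(j <- s) c j * X j x y).
  by apply/funext => x; apply/funext => y; rewrite big_cons.
by rewrite lin IH; apply/funext => x; apply/funext => y; rewrite big_cons.
Qed.

(* Complete positivity applied to [sum_(x, a) N x a (x) |x, a>] makes the
   matrix of all the [K (|N x a><N x' a'|)] positive, hence a Gram matrix. *)
Lemma channel_dilation (L B X : finType) (K : Op R B B -> Op R L L)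
    (N : X -> L -> B -> C) : is_channel K ->
  exists m, exists u : L -> L -> 'I_m * X -> C, forall a b l l' x x',
    K (fun s t => N x a s * (N x' b t)^*) l l'
      = \sum_(i < m) u a l (i, x) * (u b l' (i, x'))^*.
Proof.
move=> [_ _ cp].
(* Complete positivity is stated for reference systems ['I_k], so the pairs [(x, a)] are
   enumerated. *)
pose k := #|{: X * L}|.
pose Psi (s : (B * 'I_k)%type) : C :=
  N (enum_val s.2).1 (enum_val s.2).2 s.1.
have [c [w [c0 _ wE]]] := psd_spectral (cp k _ (psd_proj Psi)).
exists #|{: L * 'I_k}|, (fun a l y => sqrtC (c y.1) * (w y.1 (l, enum_rank (y.2, a)))^*).
move=> a b l l' x x'.
have := congr1 (fun F => F (l, enum_rank (x, a)) (l', enum_rank (x', b))) wE.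
rewrite /tensid /proj /Psi /= !enum_rankK /= => ->.
apply: eq_bigr => i _; rewrite rmorphM /= conjCK -[in LHS](sqrtCK (c i)).
by rewrite (geC0_conj (_ : 0 <= sqrtC (c i))) ?sqrtC_ge0 //; ring.
Qed.
End Environment.

(** * Fidelity of a recovery on maximally entangled states *)

Section MaximallyEntangled.
Variable R : realType.
Local Notation C := (R[i]).

(** [N x a] is the image of level [a] under the Kraus operator labelled [x]; the labels also index a
    basis of the environment of the noise. *)
Definition kraus (L B X : finType) (N : X -> L -> B -> C) (A : Op R L L) : Op R B B :=
  fun s t => \sum_x \sum_a \sum_b A a b * (N x a s * (N x b t)^*).

(** A pair of levels gives a test state for [f_worst], and the set of all levels gives [phihat]. *)
Definition max_entangled (d : nat) (S : {set 'I_d}) (x : 'I_d * 'I_d) : C :=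
  ((x.1 == x.2) && (x.1 \in S))%:R / ((Num.sqrt (#|S|%:R : R))%:C)%C.

Lemma sum_pair (I J : finType) (F : I * J -> C) : \sum_p F p = \sum_i \sum_j F (i, j).
Proof. by rewrite pair_bigA; apply: eq_bigr => -[]. Qed.

Lemma psd_tensid_kraus (L B X U : finType) (N : X -> L -> B -> C) (phi : L * U -> C) :
  psd (tensid (kraus N) (proj phi)).
Proof.
have := @psd_gram R (B * U)%type X (fun=> 1)
  (fun x y => (\sum_a phi (a, y.2) * N x a y.1)^*) (fun=> ler01).
congr psd; apply/funext => s; apply/funext => t; rewrite /tensid /kraus /proj.
apply: eq_bigr => x _; rewrite mul1r conjCK rmorph_sum mulr_suml.
apply: eq_bigr => a _; rewrite mulr_sumr; apply: eq_bigr => b _.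
by rewrite rmorphM /=; ring.
Qed.

Lemma psd_channel_kraus (L B X : finType) (k : nat) (N : X -> L -> B -> C)
  (K : Op R B B -> Op R L L) (phi : L * 'I_k -> C) : is_channel K ->
  psd (tensid (K \o kraus N) (proj phi)).
Proof. by move=> [_ _ cp]; apply: (cp k _ (psd_tensid_kraus N phi)). Qed.

Lemma Fphi_sqr (d : nat) (B X : finType) (N : X -> 'I_d -> B -> C)
  (K : Op R B B -> Op R 'I_d 'I_d) (phi : 'I_d * 'I_d -> C) : is_channel K -> unitv phi ->
  0 <= Fphi phi (K \o kraus N) id /\
  ((Fphi phi (K \o kraus N) id)%:C)%C ^+ 2 =
    \sum_x \sum_y (phi x)^* * tensid (K \o kraus N) (proj phi) x y * phi y.
Proof.
move=> chK phi1; have := fid_proj (psd_channel_kraus N phi chK) phi1.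
suff -> : Fphi phi (K \o kraus N) id = fid (tensid (K \o kraus N) (proj phi)) (proj phi) by [].
congr fid; apply/funext => -[x1 x2]; apply/funext => -[y1 y2]; reflexivity.
Qed.

Lemma max_entangled_unit (d : nat) (S : {set 'I_d}) : (0 < #|S|)%N -> unitv (max_entangled S).
Proof.
move=> S0; have Sn0 : #|S|%:R != 0 :> C by rewrite pnatr_eq0 -lt0n.
have sq : ((Num.sqrt (#|S|%:R : R))%:C)%C ^+ 2 = #|S|%:R :> C.
  by rewrite -rmorphXn /= sqr_sqrtr ?ler0n // rmorph_nat.
rewrite /unitv sum_pair.
transitivity (\sum_a (a \in S)%:R / #|S|%:R : C).
  apply: eq_bigr => a _; rewrite (bigD1 a) //= big1 ?addr0 => [|b ba].
    rewrite /max_entangled /= eqxx /= rmorphM /= conjC_nat.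
    rewrite fmorphV /= (_ : _^* = ((Num.sqrt (#|S|%:R : R))%:C)%C).
      by rewrite mulrACA -natrM mulnb andbb -invfM -expr2 sq.
    exact: conjc_real.
  by rewrite /max_entangled /= eq_sym (negbTE ba) /= mul0r mulr0.
rewrite -mulr_suml -natr_sum (_ : (\sum_a (a \in S))%N = #|S|) ?divff //.
by rewrite -sum1_card [RHS]big_mkcond; apply: eq_bigr => a _; case: (a \in S).
Qed.

Lemma max_entangled_sum (d : nat) (S : {set 'I_d}) (G : 'I_d * 'I_d -> C) :
  \sum_x max_entangled S x * G x
    = (((Num.sqrt (#|S|%:R : R))%:C)%C)^-1 * \sum_(a in S) G (a, a).
Proof.
rewrite sum_pair.
rewrite mulr_sumr [RHS]big_mkcond; apply: eq_bigr => a _.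
rewrite (bigD1 a) //= big1 ?addr0 => [|b ba].
  by rewrite /max_entangled /= eqxx /=; case: (a \in S); rewrite ?mul1r ?mul0r.
by rewrite /max_entangled /= eq_sym (negbTE ba) /= !mul0r.
Qed.

Lemma conjC_max_entangled (d : nat) (S : {set 'I_d}) x :
  (max_entangled S x)^* = max_entangled S x.
Proof.
rewrite /max_entangled rmorphM /= conjC_nat fmorphV /=; congr (_ / _).
exact: conjc_real.
Qed.

Lemma sqr_inv_sqrtC (d : nat) : (((Num.sqrt (d%:R : R))%:C)%C)^-1 ^+ 2 = d%:R^-1 :> C.
Proof. by rewrite exprVn -rmorphXn /= sqr_sqrtr ?ler0n // rmorph_nat. Qed.

(** Projecting the dilated output onto the input state averages the environment vectors [u a a] over
    [S]; the fidelity is the norm of this average. *)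
Lemma Fphi_max_entangled (d : nat) (B X : finType) (N : X -> 'I_d -> B -> C)
  (K : Op R B B -> Op R 'I_d 'I_d) (S : {set 'I_d}) m (u : 'I_d -> 'I_d -> 'I_m * X -> C) :
  is_channel K -> (0 < #|S|)%N ->
  (forall a b l l' x x', K (fun s t => N x a s * (N x' b t)^*) l l'
      = \sum_(i < m) u a l (i, x) * (u b l' (i, x'))^*) ->
  ((Fphi (max_entangled S) (K \o kraus N) id)%:C)%C ^+ 2
    = \sum_y `|(\sum_(a in S) u a a y) / #|S|%:R| ^+ 2.
Proof.
move=> chK S0 uE; have [_ ->] := Fphi_sqr N chK (max_entangled_unit S0).
have Sn0 : #|S|%:R != 0 :> C by rewrite pnatr_eq0 -lt0n.
set q := (((Num.sqrt (#|S|%:R : R))%:C)%C)^-1.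
have qq : q * q = (#|S|%:R)^-1 by rewrite -expr2 sqr_inv_sqrtC.
have chK' (a b : 'I_d) : a \in S -> b \in S -> kraus N (fun t t' =>
   proj (max_entangled S) (t, a) (t', b)) =
    fun s t => \sum_x (#|S|%:R)^-1 * (N x a s * (N x b t)^*).
  move=> aS bS; apply/funext => s; apply/funext => t; apply: eq_bigr => x _.
  rewrite (bigD1 a) //= [X in _ + X]big1 ?addr0 => [|c ca]; last first.
    by apply: big1 => e _; rewrite /proj /max_entangled /= (negbTE ca) /= !mul0r.
  rewrite (bigD1 b) //= big1 ?addr0 => [|c cb].
    by rewrite /proj conjC_max_entangled /max_entangled /= !eqxx aS bS /= !mul1r -/q qq.
  by rewrite /proj conjC_max_entangled /max_entangled /= (negbTE cb) /= !(mul0r, mulr0).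
transitivity (\sum_(a in S) \sum_(b in S) (#|S|%:R)^-1 *
   tensid (K \o kraus N) (proj (max_entangled S)) (a, a) (b, b)).
  under eq_bigr => x _.
    under eq_bigr => y _ do rewrite conjC_max_entangled -mulrA.
    rewrite -mulr_sumr; over.
  rewrite max_entangled_sum -/q mulr_sumr; apply: eq_bigr => a _.
  under eq_bigr => y _ do rewrite mulrC.
  by rewrite max_entangled_sum -/q mulrA qq mulr_sumr.
transitivity (\sum_(a in S) \sum_(b in S) \sum_y (#|S|%:R)^-1 * (#|S|%:R)^-1 * (u a a y * (u b b y)^*)).
  apply: eq_bigr => a aS; apply: eq_bigr => b bS.
  rewrite /tensid /= chK' //.
  rewrite (@channel_sum R _ _ X K (fun=> (#|S|%:R)^-1) (fun x s t => N x a s * (N x b t)^*) chK).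
  rewrite mulr_sumr sum_pair exchange_big /=.
  apply: eq_bigr => x _; rewrite uE !mulr_sumr; apply: eq_bigr => i _; ring.
under eq_bigr do rewrite exchange_big /=.
rewrite exchange_big /=; apply: eq_bigr => y _.
rewrite normCK rmorphM fmorphV /= conjC_nat rmorph_sum mulrACA mulr_suml mulr_suml.
apply: eq_bigr => a _; rewrite mulr_sumr mulr_suml; apply: eq_bigr => b _; ring.
Qed.
End MaximallyEntangled.

(** * Fidelity bounds what the environment can distinguish *)

Section EnvironmentBound.
Variable R : realType.
Local Notation C := (R[i]).

(** The variance of [c] about its mean [F] is nonnegative. *)
Lemma sum_norm_sqr_mean (I : finType) (S : {set I}) (c : I -> C) (F : C) :
  F \is Num.real -> \sum_(a in S) c a = #|S|%:R * F ->
  #|S|%:R * F ^+ 2 <= \sum_(a in S) `|c a| ^+ 2.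
Proof.
move=> Fr cF; rewrite -subr_ge0.
suff -> : \sum_(a in S) `|c a| ^+ 2 - #|S|%:R * F ^+ 2 = \sum_(a in S) `|c a - F| ^+ 2.
  by apply: sumr_ge0 => a _; rewrite exprn_ge0.
have FE : F^* = F by apply/CrealP.
have cE : \sum_(a in S) (c a)^* = #|S|%:R * F.
  by rewrite -rmorph_sum /= cF rmorphM /= FE conjC_nat.
transitivity (\sum_(a in S) `|c a| ^+ 2 - (\sum_(a in S) c a) * F - F * (\sum_(a in S) (c a)^*)
    + \sum_(a in S) F ^+ 2).
  by rewrite cE cF sumr_const -[F ^+ 2 *+ _]mulr_natl; ring.
rewrite mulr_suml mulr_sumr -!sumrB -big_split /=; apply: eq_bigr => a _.
by rewrite !normCK rmorphB /= FE; ring.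
Qed.

Lemma sqr_normB_le (x y : C) : `|x - y| ^+ 2 <= 2 * (`|x| ^+ 2 + `|y| ^+ 2).
Proof.
apply: (@le_trans _ _ ((`|x| + `|y|) ^+ 2)).
  by rewrite ler_sqr ?nnegrE ?addr_ge0 // ler_normB.
rewrite -subr_ge0.
have -> : 2 * (`|x| ^+ 2 + `|y| ^+ 2) - (`|x| + `|y|) ^+ 2 = (`|x| - `|y|) ^+ 2 by ring.
by rewrite real_exprn_even_ge0 // realB ?normr_real.
Qed.

Lemma sum2_le_sum (d : nat) (S : {set 'I_d}) (f : 'I_d -> C) (a b : 'I_d) :
  (forall i, i \in S -> 0 <= f i) -> a \in S -> b \in S -> a != b ->
  f a + f b <= \sum_(i in S) f i.
Proof.
move=> f0 aS bS ab; rewrite (bigD1 a) //= lerD2l (bigD1 b) /=; last by rewrite bS eq_sym.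
by rewrite lerDl; apply: sumr_ge0 => i /andP[/andP[iS _] _]; exact: f0.
Qed.

(** The dilated output [U a] is compared with [w a = |a> kap], where [kap] does not depend on the
    level. The overlaps [c a] have mean [F] over [S], so the defects [1 - |c a|^2] add up to at most
    [|S| (1 - F^2)]. By [expectation_diff] the expectations at [p0] and [p1] are both near that of
    [kap]. *)
Lemma environment_bound (d : nat) (B X : finType) (N : X -> 'I_d -> B -> C)
  (K : Op R B B -> Op R 'I_d 'I_d) (Z : X -> C) (z : C) (S : {set 'I_d}) (p0 p1 : 'I_d) :
  is_channel K -> (forall a, \sum_x \sum_s `|N x a s| ^+ 2 = 1) ->
  (forall x, `|Z x| <= z) -> p0 \in S -> p1 \in S -> p0 != p1 ->
  `|(\sum_x Z x * \sum_s `|N x p0 s| ^+ 2) - \sum_x Z x * \sum_s `|N x p1 s| ^+ 2| ^+ 2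
   <= 8 * z ^+ 2 * #|S|%:R * (1 - ((Fphi (max_entangled R S) (K \o kraus N) id)%:C)%C ^+ 2).
Proof.
move=> chK N1 Zz p0S p1S p01.
pose e a := \sum_x Z x * \sum_s `|N x a s| ^+ 2; rewrite -/(e p0) -/(e p1).
have S0 : (0 < #|S|)%N by apply/card_gt0P; exists p0.
have S2 : (2 <= #|S|)%N.
  by apply: leq_trans (subset_leq_card (_ : [set p0; p1] \subset S)); rewrite ?cards2 ?p01 // finset.subUset !finset.sub1set p0S.
have [F0 _] := Fphi_sqr N chK (max_entangled_unit R S0).
have [m [u uE]] := channel_dilation N chK.
have FE := Fphi_max_entangled chK S0 uE.
move: (Fphi _ _ _) F0 FE => F F0 FE.
have z0 : 0 <= z.
  have [x _|noX] := pickP (@predT X); first by apply: le_trans (Zz x).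
  have := N1 p0; rewrite big1 => [/eqP|x]; first by rewrite eq_sym oner_eq0.
  by have := noX x.
have Sn0 : #|S|%:R != 0 :> C by rewrite pnatr_eq0 -lt0n.
(* The recovery preserves the trace, so it leaves the distribution of the environment label
   unchanged. *)
have trK a (W : X -> C) : \sum_l \sum_y W y.2 * `|u a l y| ^+ 2 = \sum_x W x * \sum_s `|N x a s| ^+ 2.
  under eq_bigr do rewrite sum_pair exchange_big /=.
  rewrite exchange_big /=; apply: eq_bigr => x _.
  have [_ tr _] := chK; have := tr (fun s t => N x a s * (N x a t)^*).
  rewrite /optr => E; rewrite mulr_sumr.
  transitivity (W x * \sum_l K (fun s t => N x a s * (N x a t)^*) l l).
    rewrite mulr_sumr; apply: eq_bigr => l _; rewrite uE mulr_sumr.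
    by apply: eq_bigr => i _; rewrite normCK.
  by rewrite E mulr_sumr; apply: eq_bigr => s _; rewrite normCK.
pose U a (y : 'I_d * ('I_m * X)) := u a y.1 y.2.
pose Z2 (y : 'I_d * ('I_m * X)) := Z y.2.2.
have U1 a : \sum_y `|U a y| ^+ 2 = 1.
  rewrite -(N1 a); transitivity (\sum_x 1 * \sum_s `|N x a s| ^+ 2).
    rewrite -(trK a (fun=> 1)) sum_pair; apply: eq_bigr => l _.
    by apply: eq_bigr => y _; rewrite mul1r.
  by apply: eq_bigr => x _; rewrite mul1r.
have Ue a : \sum_y Z2 y * `|U a y| ^+ 2 = e a by rewrite sum_pair trK.
(* For [F = 0] the vector [kap] cannot be normalised, but the trivial bound [4 z^2] on the left side
   suffices. *)
have [FF0|FF0] := eqVneq F 0.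
  have e1 a : `|e a| <= z.
    rewrite /e (le_trans (ler_norm_sum _ _ _)) // -[leRHS]mulr1 -(N1 a) mulr_sumr.
    apply: ler_sum => x _; rewrite normrM ler_pM ?sumr_ge0 // ger0_norm ?sumr_ge0 // => s _; exact: exprn_ge0.
  rewrite FF0 expr0n subr0 mulr1; apply: le_trans (sqr_normB_le _ _) _.
  apply: (@le_trans _ _ (2 * (z ^+ 2 + z ^+ 2))).
    by rewrite ler_wpM2l // lerD // ler_sqr ?nnegrE.
  have -> : 2 * (z ^+ 2 + z ^+ 2) = 4 * z ^+ 2 * 1 by ring.
  apply: (@le_trans _ _ (4 * z ^+ 2 * #|S|%:R)).
    by rewrite ler_wpM2l ?mulr_ge0 ?exprn_ge0 // ler1n.
  apply: ler_wpM2r => //; apply: ler_wpM2r; first exact: exprn_ge0.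
  by rewrite ler_nat.
(* By [FE] the average has norm [F], so dividing by [F] gives a unit vector. *)
pose kap y := (\sum_(a in S) u a a y) / #|S|%:R / (F%:C)%C.
have Fc0 : (F%:C)%C != 0 :> C by apply: contraNneq FF0 => /complexI ->.
have Fcr : ((F%:C)%C : C) \is Num.real by apply/complex_realP; exists F.
have Fcc : ((F%:C)%C : C)^* = (F%:C)%C by apply/CrealP.
have kap1 : \sum_y `|kap y| ^+ 2 = 1.
  transitivity ((\sum_y `|(\sum_(a in S) u a a y) / #|S|%:R| ^+ 2) / ((F%:C)%C) ^+ 2).
    rewrite mulr_suml; apply: eq_bigr => y _.
    by rewrite /kap [`|_ / (F%:C)%C|]normf_div expr_div_n [X in _ / X]real_normK.
  by rewrite -FE divff // expf_neq0.
pose w a (y : 'I_d * ('I_m * X)) := (y.1 == a)%:R * kap y.2.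
have wsum a (G : 'I_d * ('I_m * X) -> C) (g : C -> C) : g 0 = 0 ->
   \sum_y G y * g (w a y) = \sum_y G (a, y) * g (kap y).
  move=> g0; rewrite sum_pair (bigD1 a) //= [X in _ + X]big1 ?addr0 => [|l la].
    by apply: eq_bigr => y _; rewrite /w /= eqxx mul1r.
  by apply: big1 => y _; rewrite /w /= (negbTE la) mul0r g0 mulr0.
have w1 a : \sum_y `|w a y| ^+ 2 = 1.
  rewrite -kap1; have := wsum a (fun=> 1) (fun t => `|t| ^+ 2).
  rewrite normr0 expr0n => /(_ erefl) E.
  transitivity (\sum_y 1 * `|w a y| ^+ 2); first by apply: eq_bigr => y _; rewrite mul1r.
  by rewrite E; apply: eq_bigr => y _; rewrite mul1r.
pose c a := \sum_y (w a y)^* * U a y.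
have cS : \sum_(a in S) c a = #|S|%:R * (F%:C)%C.
  transitivity (\sum_(a in S) \sum_y u a a y * (kap y)^*).
    apply: eq_bigr => a _; rewrite -(wsum a (U a) Num.conj) ?conjC0 //.
    by apply: eq_bigr => y _; rewrite mulrC.
  rewrite exchange_big /= -[RHS]mulr1 -[X in _ = _ * X]kap1 mulr_sumr; apply: eq_bigr => y _.
  by rewrite normCK mulrA -mulr_suml /kap; congr (_ * _); rewrite [RHS]mulrC [#|S|%:R * _]mulrC mulrA !divfK.
have diff a : `|e a - \sum_y Z y.2 * `|kap y| ^+ 2| ^+ 2 <= 4 * z ^+ 2 * (1 - `|c a| ^+ 2).
  have := expectation_diff (Z := Z2) (z := z) (fun y => Zz y.2.2) (U1 a) (w1 a).
  by rewrite Ue (wsum a Z2 (fun t => `|t| ^+ 2)) // normr0 expr0n.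
set r := \sum_y _ in diff.
have -> : e p0 - e p1 = (e p0 - r) - (e p1 - r) by ring.
apply: le_trans (sqr_normB_le _ _) _.
have -> : 8 * z ^+ 2 * #|S|%:R * (1 - ((F%:C)%C) ^+ 2) =
    2 * (4 * z ^+ 2 * (#|S|%:R - #|S|%:R * ((F%:C)%C) ^+ 2)) :> C by ring.
rewrite ler_wpM2l //; apply: le_trans (lerD (diff p0) (diff p1)) _.
have d0 i : i \in S -> 0 <= 4 * z ^+ 2 * (1 - `|c i| ^+ 2).
  by move=> _; apply: le_trans (diff i); rewrite exprn_ge0.
apply: le_trans (sum2_le_sum d0 p0S p1S p01) _.
rewrite -mulr_sumr ler_wpM2l ?mulr_ge0 ?exprn_ge0 //.
by rewrite sumrB sumr_const lerD2l lerN2 (sum_norm_sqr_mean Fcr cS).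
Qed.
End EnvironmentBound.

(** * Weights of unitary representations of SU(d) *)

Section Circle.
Import numFieldNormedType.Exports.
Local Open Scope classical_set_scope.
Variable R : realType.
Local Notation C := (R[i]).

Definition cis (t : R) : C := Complex (cos t) (sin t).

Lemma cis0 : cis 0 = 1. Proof. by rewrite /cis cos0 sin0. Qed.

Lemma cisD s t : cis (s + t) = cis s * cis t.
Proof. by rewrite /cis cosD sinD; simpc; congr (_ +i* _)%C; rewrite addrC mulrC [X in _ + X]mulrC. Qed.

Lemma norm_cis t : `|cis t| = 1.
Proof. by rewrite normc_def /= cos2Dsin2 sqrtr1. Qed.

Lemma cis_neq0 t : cis t != 0.
Proof. by rewrite -normr_gt0 norm_cis ltr01. Qed.

Lemma cisMn t n : cis (t *+ n) = cis t ^+ n.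
Proof. by elim: n => [|n IH]; rewrite ?cis0 // mulrS exprS cisD IH. Qed.

Lemma cisN t : cis (- t) = (cis t)^-1.
Proof.
apply: (mulfI (cis_neq0 t)); rewrite -cisD subrr cis0 divff // cis_neq0 //.
Qed.

Lemma cisMz t (q : int) : cis (t *~ q) = cis t ^ q.
Proof.
case: q => n; first by rewrite -pmulrn -exprnP cisMn.
by rewrite NegzE mulrNz -pmulrn cisN cisMn -exprnN.
Qed.

Lemma cis_2pi : cis (pi *+ 2) = 1.
Proof. by rewrite /cis cos2pi sin2pi. Qed.

Lemma cis_pi : cis pi = -1.
Proof. by rewrite /cis cospi sinpi; simpc. Qed.

Lemma cis_surj (u : C) : `|u| = 1 -> exists2 t, 0 <= t & u = cis t.
Proof.
case: u => a b; rewrite normc_def /= => -[H].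
have ab : a ^+ 2 + b ^+ 2 = 1.
  rewrite -[LHS]sqr_sqrtr ?H ?expr1n // addr_ge0 ?sqr_ge0 //.
have a1 : -1 <= a <= 1.
  have : a ^+ 2 <= 1 by rewrite -ab lerDl sqr_ge0.
  by move=> a2; rewrite -ler_norml -(@expr_le1 _ 2) ?normr_ge0 // real_normK ?num_real.
have s0 : Num.sqrt (1 - a ^+ 2) = `|b| by rewrite -ab addrAC subrr add0r sqrtr_sqr.
have [b0|b0] := leP 0 b.
  exists (acos a); first exact: acos_ge0.
  by rewrite /cis acosK ?in_itv // sin_acos // s0 ger0_norm.
exists (pi *+ 2 - acos a).
  rewrite subr_ge0; apply: le_trans (acos_lepi a1) _.
  by rewrite mulr2n lerDl pi_ge0.
rewrite cisD cis_2pi mul1r /cis cosN sinN acosK ?in_itv // sin_acos // s0 ltr0_norm //.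
by rewrite opprK.
Qed.

Lemma norm_cisB1 t : `|cis t - 1| ^+ 2 = ((2 - 2 * cos t)%:C)%C.
Proof.
rewrite -add_Re2_Im2; congr (_%:C)%C; rewrite /= oppr0 addr0.
have := cos2Dsin2 t; lra.
Qed.

Lemma cis_near0 (e : R) : 0 < e ->
  exists2 d : R, 0 < d & forall t, `|t| < d -> `|cis t - 1| < ((e%:C)%C : C).
Proof.
move=> e0; have /cvgrPdist_lt cvg0 : cos x @[x --> (0 : R)] --> cos (0 : R).
  exact: continuous_cos.
have := cvg0 (e ^+ 2 / 2) (divr_gt0 (exprn_gt0 2 e0) (ltr0Sn R 1)).
rewrite cos0 => -[d /= d0 H]; exists d => // t td.
have := H t; rewrite /= sub0r normrN => /(_ td) ct.
have c1 := cos_le1 t; rewrite ger0_norm ?subr_ge0 // in ct.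
have ec0 : 0 < (e%:C)%C :> C by rewrite ltcR.
rewrite -(@ltr_pXn2r _ 2) ?nnegrE ?(ltW ec0) // norm_cisB1 -rmorphXn ltcR /=.
lra.
Qed.

Lemma Re_cis_ge0 t : `|t| <= pi / 2 -> 0 <= complex.Re (cis t).
Proof. by rewrite ler_norml => ?; exact: cos_ge0_pihalf. Qed.

Definition dyadic_angle (k : nat) : R := (pi *+ 2) / 2 ^+ k.

Lemma dyadic_angleS k : dyadic_angle k = dyadic_angle k.+1 *+ 2.
Proof. by rewrite /dyadic_angle exprS; field; rewrite expf_neq0 // pnatr_eq0. Qed.

Lemma dyadic_angle_gt0 k : 0 < dyadic_angle k.
Proof. by rewrite divr_gt0 ?exprn_gt0 // pmulrn_lgt0 // pi_gt0. Qed.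

Lemma dyadic_angle_small (d : R) : 0 < d ->
  exists K, forall k, (K <= k)%N -> dyadic_angle k < d.
Proof.
move=> d0; have [K HK] : exists K : nat, pi *+ 2 / d < K%:R.
  by exists (Num.trunc (pi *+ 2 / d)).+1; apply: truncnS_gt.
exists K => k Kk; rewrite /dyadic_angle ltr_pdivrMr ?exprn_gt0 // mulrC -ltr_pdivrMr //.
apply: lt_le_trans HK _; rewrite -natrX ler_nat; apply: leq_trans Kk _.
exact/ltnW/ltn_expl.
Qed.

(** Induction through square roots; the sign left undetermined is the [2^K]-th power of the next
    root of unity. *)
Lemma dyadic_root (K : nat) (l : C) : l ^+ (2 ^ K) = 1 ->
  exists j : nat, l = cis (dyadic_angle K) ^+ j.
Proof.
elim: K l => [|K IH] l lK; first by exists 0%N; rewrite expr0 -lK expn0 expr1.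
have [|j lj] := IH (l ^+ 2); first by rewrite -exprM -expnS.
have : l ^+ 2 = (cis (dyadic_angle K.+1) ^+ j) ^+ 2.
  by rewrite lj dyadic_angleS cisMn -!exprM mulnC.
move/eqP; rewrite eqf_sqr => /orP[/eqP->|/eqP->]; first by exists j.
exists (2 ^ K + j)%N; rewrite exprD -[cis _ ^+ (2 ^ K)]cisMn.
have -> : dyadic_angle K.+1 *+ 2 ^ K = pi.
  by rewrite /dyadic_angle -[LHS]mulr_natr natrX exprS; field; rewrite expf_neq0 // pnatr_eq0.
by rewrite cis_pi mulN1r.
Qed.

(** The exponent is taken in the symmetric range, so that [q] times any later dyadic angle stays
    within [pi / 2] of 0. *)
Lemma dyadic_root_int (K : nat) (l : C) : l ^+ (2 ^ K) = 1 ->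
  exists2 q : int, l = cis (dyadic_angle K) ^ q & (`|q| *+ 2 <= (2 ^ K)%:Z)%R.
Proof.
move=> /dyadic_root [j ->].
set w := cis _.
have wN : w ^+ (2 ^ K) = 1.
  rewrite /w -cisMn (_ : _ *+ _ = pi *+ 2) ?cis_2pi //.
  by rewrite /dyadic_angle -[LHS]mulr_natr natrX; field; rewrite expf_neq0 // pnatr_eq0.
have w0 : w != 0 by exact: cis_neq0.
have jE : w ^+ j = w ^+ (j %% 2 ^ K).
  by rewrite {1}(divn_eq j (2 ^ K)) exprD mulnC exprM wN expr1n mul1r.
have jlt : (j %% 2 ^ K < 2 ^ K)%N by rewrite ltn_mod expn_gt0.
rewrite jE; set i := (j %% 2 ^ K)%N in jlt *.
have [H|H] := leqP (i * 2) (2 ^ K); first by exists i => //; lia.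
exists (i%:Z - (2 ^ K)%:Z); last by lia.
by rewrite expfzDr // -exprnN -!exprnP wN invr1 mulr1.
Qed.
End Circle.

(** * Integer weights of continuous representations of the circle *)

Section CircleWeights.
Variable R : realType.
Local Notation C := (R[i]).

Lemma mulmx_nearby (m : nat) (v : 'rV[C]_m) (A : 'M[C]_m) (e : C) :
  (forall i j, `|A i j - (i == j)%:R| < e) ->
  forall j, `|(v *m A - v) 0 j| <= (\sum_i `|v 0 i|) * e.
Proof.
move=> HA j; rewrite -[X in _ - X]mulmx1 -mulmxBr mxE mulr_suml.
apply: le_trans (ler_norm_sum _ _ _) _; apply: ler_sum => i _.
by rewrite normrM ler_wpM2l // !mxE ltW.
Qed.

(** Summing the entries of [v A - v] in modulus bounds [|l - 1|] by [m / (m + 1)]. *)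
Lemma eigenvalue_near1 (m : nat) (v : 'rV[C]_m) (A : 'M[C]_m) (l : C) :
  (forall i j, `|A i j - (i == j)%:R| < (m.+1%:R)^-1) ->
  v != 0 -> v *m A = l *: v -> `|l - 1| < 1.
Proof.
move=> HA v0 vA.
have sv0 : 0 < \sum_i `|v 0 i|.
  rewrite lt_neqAle sumr_ge0 // andbT eq_sym; apply: contra_neq v0 => s0.
  apply/rowP => j; rewrite mxE; apply/eqP; rewrite -normr_le0 -s0.
  by rewrite (bigD1 j) //= lerDl sumr_ge0.
have : `|l - 1| * \sum_i `|v 0 i| <= \sum_(j < m) (\sum_i `|v 0 i|) * (m.+1%:R)^-1.
  rewrite mulr_sumr; apply: ler_sum => j _; apply: le_trans (mulmx_nearby v HA j).
  by rewrite vA !mxE -[X in _ <= `|_ - X|]mul1r -mulrBl normrM.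
rewrite sumr_const card_ord -[leRHS]mulr_natl mulrCA [leRHS]mulrC ler_pM2r //.
move=> /le_lt_trans; apply.
by rewrite ltr_pdivrMr ?ltr0Sn // mul1r ltr_nat.
Qed.

(** Rules out the wrong one of two square roots near 1. *)
Lemma Re_sub1_ge (k : C) : 0 <= complex.Re k -> 1 <= `|- k - 1|.
Proof.
move=> k0; have H : 1 <= `|complex.Re (- k - 1)|.
  by case: k k0 => a b /= a0; rewrite ler0_norm; lra.
by rewrite -lecR in H; apply: le_trans H (normc_ge_Re _).
Qed.

Section Homomorphism.
Variables (m : nat) (phi : C -> 'M[C]_m).
Hypothesis phi1 : phi 1 = 1%:M.
Hypothesis phiM : forall u v, `|u| = 1 -> `|v| = 1 -> phi (u * v) = phi u *m phi v.
Hypothesis phi_cont1 : forall e : R, 0 < e -> exists2 d : R, 0 < d &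
  forall u, `|u| = 1 -> `|u - 1| < ((d%:C)%C : C) ->
  forall i j, `|phi u i j - (i == j)%:R| < ((e%:C)%C : C).

Lemma phiX u n : `|u| = 1 -> forall (v : 'rV_m) l, v *m phi u = l *: v ->
  v *m phi (u ^+ n) = l ^+ n *: v.
Proof.
move=> u1 v l vl; elim: n => [|n IH]; first by rewrite !expr0 phi1 mulmx1 scale1r.
by rewrite exprS phiM ?normrX ?u1 ?expr1n // mulmxA vl -scalemxAl IH scalerA exprS.
Qed.

Lemma phi_cis_cont1 (e : R) : 0 < e -> exists2 d : R, 0 < d &
  forall t : R, `|t| < d -> forall i j, `|phi (cis t) i j - (i == j)%:R| < ((e%:C)%C : C).
Proof.
move=> /phi_cont1[d d0 H]; have [d' d'0 H'] := cis_near0 d0.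
by exists d' => // t td; apply: H; [rewrite norm_cis|exact: H'].
Qed.

(* The square root [phi (w (k+1))] of [phi (w k)] is close to 1, which selects
   its eigenvalue among the two square roots. *)
Lemma dyadic_eigenvector K (v : 'rV[C]_m) (q : int) :
  (forall k, (K <= k)%N -> forall i j,
     `|phi (cis (dyadic_angle R k)) i j - (i == j)%:R| < (m.+1%:R)^-1) ->
  v *m phi (cis (dyadic_angle R K)) = cis (dyadic_angle R K) ^ q *: v ->
  `|q| *+ 2 <= (2 ^ K)%:Z ->
  forall k, (K <= k)%N -> v *m phi (cis (dyadic_angle R k)) = cis (dyadic_angle R k) ^ q *: v.
Proof.
move=> near1 vK qK k /subnK <-; elim: (k - K)%N => [|n IH].
  by rewrite add0n; exact: vK.
rewrite addSn; set k' := (n + K)%N in IH *.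
have [w wE] : exists w, w = cis (dyadic_angle R k'.+1) by exists (cis (dyadic_angle R k'.+1)).
rewrite -wE.
have w1 : `|w| = 1 by rewrite wE; exact: norm_cis.
have w2 : cis (dyadic_angle R k') = w * w by rewrite dyadic_angleS cisMn expr2 wE.
rewrite w2 in IH.
have near_w := near1 k'.+1; rewrite -wE in near_w.
set l := w ^ q; have ll : (w * w) ^ q = l * l by rewrite expfzMl.
set x := v *m phi w - l *: v.
have xE : x *m phi w = (- l) *: x.
  rewrite /x mulmxBl -mulmxA -phiM // IH ll -scalemxAl scalerBr !scaleNr !scalerA opprK.
  by rewrite addrC.
have [x0|x0] := eqVneq x 0; first by apply/eqP; rewrite -subr_eq0 -/x x0.
have Kk' : (K <= k'.+1)%N by apply: leqW; exact: leq_addl.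
have lt1 := eigenvalue_near1 (near_w Kk') x0 xE.
suff l0 : 0 <= complex.Re l.
  by have := lt_le_trans lt1 (Re_sub1_ge l0); rewrite ltxx.
rewrite /l wE -cisMz; apply: Re_cis_ge0.
have qk : `|q%:~R : R| * 2 <= 2 ^+ k'.
  have : (`|q| * 2)%:~R <= ((2 ^ K)%:Z)%:~R :> R by rewrite ler_int; lia.
  rewrite intrM intr_norm => /le_trans; apply.
  by rewrite -pmulrn natrX ler_eXn2l ?ltr1n // leq_addl.
rewrite -[dyadic_angle _ _ *~ q]mulrzr normrM (ger0_norm (ltW (dyadic_angle_gt0 _ _))).
rewrite /dyadic_angle exprS mulrAC ler_pdivrMr ?mulr_gt0 ?exprn_gt0 //.
have -> : pi / 2 * (2 * 2 ^+ k') = pi * 2 ^+ k' :> R by field.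
by rewrite mulrnAl -mulrnAr ler_pM2l ?pi_gt0 // -[leLHS]mulr_natr.
Qed.

(** One element [w] of small dyadic angle controls the whole circle: its eigenvalue is a root of
    unity [w^q], [dyadic_eigenvector] passes to all finer angles, and density with continuity does
    the rest. Diagonalising a torus thereby reduces to finitely many matrices. *)
Lemma circle_weights : exists w : C, `|w| = 1 /\
  forall (v : 'rV[C]_m) l, v != 0 -> v *m phi w = l *: v ->
  exists q : int, forall u, `|u| = 1 -> v *m phi u = u ^ q *: v.
Proof.
have e0 : 0 < (m.+1%:R)^-1 :> R by rewrite invr_gt0 ltr0Sn.
have [d d0 near0] := phi_cis_cont1 e0.
have [K HK] := dyadic_angle_small d0.
exists (cis (dyadic_angle R K)); split; first exact: norm_cis.
move=> v l v0 vl.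
have near1 k : (K <= k)%N -> forall i j,
     `|phi (cis (dyadic_angle R k)) i j - (i == j)%:R| < (m.+1%:R)^-1.
  move=> Kk i j; have := near0 (dyadic_angle R k).
  rewrite gtr0_norm ?dyadic_angle_gt0 // => /(_ (HK k Kk) i j).
  by rewrite fmorphV rmorph_nat.
have lK : l ^+ (2 ^ K) = 1.
  have := phiX (2 ^ K) (norm_cis _) vl.
  rewrite -cisMn (_ : _ *+ _ = pi *+ 2); last first.
    by rewrite /dyadic_angle -[LHS]mulr_natr natrX; field; rewrite expf_neq0 // pnatr_eq0.
  rewrite cis_2pi phi1 mulmx1 => /eqP; rewrite -{1}[v]scale1r -subr_eq0 -scalerBl.
  by rewrite scaler_eq0 (negbTE v0) orbF subr_eq0 => /eqP.
have [q lq qK] := dyadic_root_int lK; rewrite lq in vl.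
have dy := dyadic_eigenvector near1 vl qK.
exists q => u /cis_surj[t t0 ->].
apply/eqP; rewrite -subr_eq0; apply/eqP/rowP => j; rewrite [RHS]mxE; apply/eqP.
set V := \sum_i `|v 0 i|.
have bound (e : R) : 0 < e -> `|(v *m phi (cis t) - cis t ^ q *: v) 0 j| <= V * ((e%:C)%C *+ 2).
  move=> e_gt0; have [d1 d10 near2] := phi_cis_cont1 e_gt0.
  have [d2 d20 near3] := cis_near0 e_gt0.
  have d3 : 0 < d2 / (`|q|%:~R + 1) by rewrite divr_gt0 // ltr_wpDl // ler0z.
  have [k0 Hk0] := @dyadic_angle_small R (Num.min d1 (d2 / (`|q|%:~R + 1))) ltac:(by rewrite lt_min d10 d3).
  set k := maxn k0 K.
  set h := dyadic_angle R k; have h0 : 0 < h by exact: dyadic_angle_gt0.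
  have := Hk0 k (leq_maxl _ _); rewrite lt_min => /andP[hd1 hd2].
  (* On the multiple [h *+ n] of a dyadic angle the character is exact; the remainder [r] is so
     small that both sides are within [e] of [v], up to the factor [V]. *)
  have [n [r [r0 rh tE]]] : exists n : nat, exists r, [/\ 0 <= r, r < h & t = h *+ n + r].
    have th : 0 <= t / h by rewrite divr_ge0 // ltW.
    have /andP[n1 n2] := truncn_itv th.
    exists (Num.truncn (t / h)), (t - h *+ Num.truncn (t / h)).
    rewrite ler_pdivlMr // mulr_natl in n1; rewrite ltr_pdivrMr // mulr_natl mulrS in n2.
    by split; lra.
  have step : v *m phi (cis (h *+ n)) = cis (h *+ n) ^ q *: v.
    rewrite cisMn (phiX n (norm_cis _) (dy k (leq_maxr _ _))); congr (_ *: _).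
    by rewrite !exprnP !exprz_exp mulrC.
  rewrite tE cisD phiM ?norm_cis // mulmxA step -scalemxAl expfzMl -scalerA -scalerBr mxE.
  rewrite normrM -cisMz norm_cis mul1r.
  have rn : `|r| = r by rewrite ger0_norm.
  have n2 := near2 r; rewrite rn in n2; have {}n2 := mulmx_nearby v (n2 (lt_trans rh hd1)).
  have n3 : `|cis r ^ q - 1| <= (e%:C)%C.
    rewrite -cisMz ltW // near3 // -mulrzr normrM rn -intr_norm.
    have q1 : 0 < `|q|%:~R + 1 :> R by rewrite ltr_wpDl // ler0z.
    have := lt_trans rh hd2; rewrite ltr_pdivlMr // => H.
    by apply: le_lt_trans H; rewrite ler_wpM2l // lerDl.
  have -> : (v *m phi (cis r) - cis r ^ q *: v) 0 j
      = (v *m phi (cis r) - v) 0 j - (cis r ^ q - 1) * v 0 j.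
    by rewrite !mxE; ring.
  apply: le_trans (ler_normB _ _) _; rewrite mulr2n mulrDr lerD //.
  rewrite normrM mulrC ler_pM // /V (bigD1 j) //= lerDl; exact: sumr_ge0.
set x := _ 0 j in bound *.
have V0 : 0 <= V by exact: sumr_ge0.
have VE : V = ((complex.Re V)%:C)%C by rewrite RRe_real // ger0_real.
have xE : `|x| = ((complex.Re `|x|)%:C)%C by rewrite RRe_real // normr_real.
have V0' : 0 <= complex.Re V by move: V0; rewrite {1}VE lecR.
rewrite -normr_le0 xE lecR leNgt; apply/negP => x0.
(* Taking [e = |x| / (4 (V + 1))] in [bound] would give [|x| <= |x| / 2]. *)
have W0 : 0 < 4 * (complex.Re V + 1) by lra.
have := bound _ (divr_gt0 x0 W0); rewrite xE VE -rmorphMn -rmorphM lecR.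
move: (complex.Re V) (complex.Re `|x|) V0' x0 W0 => a b a0 b0 W0.
have -> : a * (b / (4 * (a + 1)) *+ 2) = (2 * (a * b)) / (4 * (a + 1)) by rewrite mulr2n; ring.
have ab := mulr_ge0 a0 (ltW b0).
by rewrite ler_pdivlMr // => H; lra.
Qed.
End Homomorphism.
End CircleWeights.

(** A common unitary basis makes all members triangular; their adjoints are members too, so the
    off-diagonal entries vanish on both sides. *)
Lemma unitary_codiagonalization (C : numClosedFieldType) n (As : seq 'M[C]_n) :
  {in As &, forall A B, comm_mx A B} -> {in As, forall A, A ^t* \in As} ->
  exists2 P : 'M[C]_n, P \is unitarymx &
    {in As, forall A, forall k, exists l, row k P *m A = l *: row k P}.
Proof.
move=> comm stab; have [P Pu /allP PA] := cotrigonalization comm.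
have Punit := unitarymx_unit Pu.
exists P => // A As_A k.
have offdiag i j : i != j -> (P *m A *m P ^t*) i j = 0.
  rewrite -val_eqE /=;
  rewrite -invmx_unitary // -conjumx //; case: ltngtP => // [lt_ij|lt_ji] _.
    by have /is_trig_mxP-> := PA _ As_A.
  have /is_trig_mxP -/(_ j i lt_ji)/eqP := PA _ (stab _ As_A).
  rewrite !conjumx// invmx_unitary// -[P as X in X *m _]trmxCK.
  by rewrite -!map_mxM -!trmx_mul mulmxA 2!mxE conjC_eq0 => /eqP.
have := mulmxKtV (P *m A) Pu erefl; move: (P *m A *m P ^t*) offdiag => D offdiag DE.
exists (D k k); rewrite -row_mul -DE.
apply/rowP => j; rewrite !mxE (bigD1 k) //= big1 ?addr0 // => i ik.
by rewrite offdiag ?mul0r // eq_sym.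
Qed.

(** * The diagonal torus of SU(d) and its circles *)

Section OperatorMatrix.
Variable R : realType.
Local Notation C := (R[i]).

Definition opmx (m n : nat) (A : Op R 'I_m 'I_n) : 'M[C]_(m, n) := \matrix_(i, j) A i j.

Lemma opmx_mul (m n p : nat) (A : Op R 'I_m 'I_n) (B : Op R 'I_n 'I_p) :
  opmx (opmul A B) = opmx A *m opmx B.
Proof.
by apply/matrixP => i j; rewrite !mxE; apply: eq_bigr => k _; rewrite !mxE.
Qed.

Lemma opmx_adj (m n : nat) (A : Op R 'I_m 'I_n) : opmx (adj A) = (opmx A) ^t*.
Proof. by apply/matrixP => i j; rewrite !mxE. Qed.

Lemma opmx_id (m : nat) : opmx (@opid R 'I_m) = 1%:M.
Proof. by apply/matrixP => i j; rewrite !mxE. Qed.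

Lemma opmx_inj (m n : nat) : injective (@opmx m n).
Proof.
move=> A B /matrixP E; apply/funext => i; apply/funext => j.
by have := E i j; rewrite !mxE.
Qed.

Lemma is_SU_mul (d : nat) (U V : Op R 'I_d 'I_d) : is_SU U -> is_SU V -> is_SU (opmul U V).
Proof.
move=> [U1 Ud] [V1 Vd]; split; last first.
  by rewrite -[X in \det X]/(opmx _) opmx_mul det_mulmx /opmx Ud Vd mulr1.
apply: opmx_inj; rewrite opmx_mul opmx_adj opmx_mul trmx_mul map_mxM.
move: U1 V1 => /(congr1 (@opmx _ _)) U1 /(congr1 (@opmx _ _)).
rewrite !opmx_mul !opmx_adj opmx_id in U1 *.
by rewrite mulmxA -[_ *m _ *m opmx U]mulmxA U1 mulmx1 => ->.
Qed.

Definition torus_elt (d : nat) (t : 'I_d -> C) : Op R 'I_d 'I_d :=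
  fun x y => (x == y)%:R * t y.

Definition in_torus (d : nat) (t : 'I_d -> C) :=
  (forall a, `|t a| = 1) /\ \prod_a t a = 1.

Lemma torus_eltM d (s t : 'I_d -> C) :
  opmul (torus_elt s) (torus_elt t) = torus_elt (fun a => s a * t a).
Proof.
apply/funext => x; apply/funext => y; rewrite /opmul /torus_elt (bigD1 y) //= big1 ?addr0.
  by rewrite eqxx mul1r mulrA.
by move=> z /negbTE zy; rewrite zy mul0r mulr0.
Qed.

Lemma torus_elt1 d : torus_elt (fun=> 1) = @opid R 'I_d.
Proof. by apply/funext => x; apply/funext => y; rewrite /torus_elt mulr1. Qed.

Lemma in_torusM d (s t : 'I_d -> C) :
  in_torus s -> in_torus t -> in_torus (fun a => s a * t a).
Proof.
move=> [s1 sp] [t1 tp]; split=> [a|]; first by rewrite normrM s1 t1 mulr1.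
by rewrite big_split sp tp /= mulr1.
Qed.

Lemma in_torus1 d : in_torus (fun _ : 'I_d => 1 : C).
Proof. by split=> [a|]; rewrite ?normr1 // big1. Qed.

Lemma torus_SU d (t : 'I_d -> C) : in_torus t -> is_SU (torus_elt t).
Proof.
move=> [t1 tp]; split.
  have -> : adj (torus_elt t) = torus_elt (fun a => (t a)^*).
    apply/funext => x; apply/funext => y; rewrite /adj /torus_elt rmorphM /= conjC_nat eq_sym.
    by case: eqVneq => [->|]; rewrite ?mul0r.
  rewrite torus_eltM -torus_elt1; congr torus_elt; apply/funext => a.
  by rewrite -normCKC t1 expr1n.
rewrite (_ : \matrix_(i, j) _ = diag_mx (\row_a t a)).
  by rewrite det_diag -[RHS]tp; apply: eq_bigr => a _; rewrite mxE.
apply/matrixP => i j; rewrite !mxE /torus_elt.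
by case: eqVneq => [->|]; rewrite ?mul1r ?mul0r.
Qed.

Definition circle (d : nat) (a b : 'I_d) (u : C) : 'I_d -> C :=
  fun c => if c == a then u else if c == b then u^-1 else 1.

Lemma prod_circle (d : nat) (a b : 'I_d) (F : 'I_d -> C -> C) u : a != b ->
  (forall c, F c 1 = 1) -> \prod_c F c (circle a b u c) = F a u * F b u^-1.
Proof.
move=> ab F1; rewrite (bigD1 a) //= (bigD1 b) /=; last by rewrite eq_sym.
rewrite big1 ?mulr1 => [|c /andP[/negbTE ca /negbTE cb]].
  by rewrite /circle eqxx eqxx [b == a]eq_sym (negbTE ab).
by rewrite /circle ca cb F1.
Qed.

Lemma norm1_neq0 (u : C) : `|u| = 1 -> u != 0.
Proof. by move=> u1; rewrite -normr_gt0 u1 ltr01. Qed.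

Lemma in_torus_circle d (a b : 'I_d) u : a != b -> `|u| = 1 -> in_torus (circle a b u).
Proof.
move=> ab u1; split=> [c|].
  by rewrite /circle; case: ifP => // _; case: ifP; rewrite ?normfV ?u1 ?invr1 ?normr1.
by rewrite (prod_circle (F := fun _ x => x)) // divff // norm1_neq0.
Qed.

Lemma circleM d (a b : 'I_d) u v c : circle a b (u * v) c = circle a b u c * circle a b v c.
Proof. by rewrite /circle; do 2 (case: ifP => // _); rewrite ?mulr1 ?invfM. Qed.

Lemma circle1 d (a b : 'I_d) c : circle a b 1 c = 1.
Proof. by rewrite /circle invr1 !if_same. Qed.

Section Rep.
Variables (d m : nat) (rho : Op R 'I_d 'I_d -> Op R 'I_m 'I_m).
Hypothesis rho_rep : is_cont_unitary_rep rho.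

Lemma repM U V : is_SU U -> is_SU V -> opmx (rho (opmul U V)) = opmx (rho U) *m opmx (rho V).
Proof. by have [_ H _] := rho_rep => SU SV; rewrite H // opmx_mul. Qed.

Lemma rep_unitary U : is_SU U -> (opmx (rho U)) ^t* *m opmx (rho U) = 1%:M.
Proof. by have [H _ _] := rho_rep => /H E; rewrite -opmx_adj -opmx_mul E opmx_id. Qed.

(** The image of 1 is both idempotent and unitary. *)
Lemma rep1 : opmx (rho (@opid R 'I_d)) = 1%:M.
Proof.
have SU1 : is_SU (@opid R 'I_d) by rewrite -torus_elt1; exact/torus_SU/in_torus1.
have := rep_unitary SU1; set A := opmx _ => AA.
have E : A *m A = A.
  rewrite /A -repM // -torus_elt1 torus_eltM; congr (opmx (rho (torus_elt _))).
  by apply/funext => a; rewrite mulr1.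
by rewrite -[LHS]mul1mx -{1}AA -mulmxA E AA.
Qed.

Let phi (a b : 'I_d) (u : C) := opmx (rho (torus_elt (circle a b u))).

Lemma rep_torusM s t : in_torus s -> in_torus t ->
  opmx (rho (torus_elt (fun a => s a * t a))) = opmx (rho (torus_elt s)) *m opmx (rho (torus_elt t)).
Proof. by move=> Ts Tt; rewrite -torus_eltM repM //; exact: torus_SU. Qed.

Lemma rep_circle_weights a b : a != b -> exists w : C, `|w| = 1 /\
  forall (v : 'rV[C]_m) l, v != 0 -> v *m phi a b w = l *: v ->
  exists q : int, forall u, `|u| = 1 -> v *m phi a b u = u ^ q *: v.
Proof.
move=> ab; apply: circle_weights.
- rewrite /phi (_ : circle a b 1 = fun=> 1) ?torus_elt1 ?rep1 //.
  by apply/funext => c; rewrite circle1.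
- move=> u v u1 v1; rewrite /phi -rep_torusM; try exact: in_torus_circle.
  by congr (opmx (rho (torus_elt _))); apply/funext => c; rewrite circleM.
move=> e e0; have SU1 : is_SU (@opid R 'I_d) by rewrite -torus_elt1; exact/torus_SU/in_torus1.
have [_ _ /(_ _ SU1 e e0)[de de0 H]] := rho_rep.
exists de => // u u1 ud i j.
have := H _ (torus_SU (in_torus_circle ab u1)) _ i j.
have /matrixP/(_ i j) := rep1; rewrite !mxE => -> ; apply => x y.
rewrite /torus_elt /opid; case: eqVneq => _; last first.
  by rewrite mul0r subrr normr0; apply: le_lt_trans ud.
rewrite mul1r /circle; case: ifP => // _; case: ifP => _; last first.
  by rewrite subrr normr0; apply: le_lt_trans ud.
have un0 := norm1_neq0 u1.
have -> : u^-1 - 1 = - (u^-1 * (u - 1)) by rewrite mulrBr mulVf // mulr1 opprB.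
by rewrite normrN normrM normfV u1 invr1 mul1r.
Qed.
End Rep.
End OperatorMatrix.

(** * Weight bases for the torus *)

Section TorusWeights.
Variable R : realType.
Local Notation C := (R[i]).

(** On the torus the entries of [t] have product 1, so adding a constant to [s] does not change the
    character. *)
Definition character (d : nat) (s : 'I_d -> int) (t : 'I_d -> C) : C := \prod_a t a ^ s a.

Lemma in_torusV d (t : 'I_d -> C) : in_torus t -> in_torus (fun a => (t a)^-1).
Proof.
move=> [t1 tp]; split=> [a|]; first by rewrite normfV t1 invr1.
by rewrite prodfV tp invr1.
Qed.

Lemma characterM d (s : 'I_d -> int) (t t' : 'I_d -> C) :
  character s (fun a => t a * t' a) = character s t * character s t'.
Proof. by rewrite /character -big_split; apply: eq_bigr => a _; rewrite expfzMl. Qed.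

Lemma character_circle d (s : 'I_d -> int) (a b : 'I_d) u : a != b -> `|u| = 1 ->
  character s (circle a b u) = u ^ (s a - s b).
Proof.
move=> ab u1; rewrite /character (prod_circle (F := fun c x => x ^ s c)) //.
  by rewrite exprz_inv -expfzDr // norm1_neq0.
by move=> c; rewrite exp1rz.
Qed.

Variables (d m : nat) (rho : Op R 'I_d.+1 'I_d.+1 -> Op R 'I_m 'I_m).
Hypothesis rho_rep : is_cont_unitary_rep rho.

Lemma rep_torusV t : in_torus t ->
  (opmx (rho (torus_elt t))) ^t* = opmx (rho (torus_elt (fun a => (t a)^-1))).
Proof.
move=> Tt; have := rep_unitary rho_rep (torus_SU Tt).
have := rep_torusM rho_rep (in_torusV Tt) Tt; rewrite (_ : (fun a => _ * _) = fun=> 1); last first.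
  by apply/funext => a; rewrite mulVf // norm1_neq0 // (proj1 Tt).
rewrite torus_elt1 (rep1 rho_rep) => BA /mulmx1C AA.
by rewrite -[LHS]mul1mx BA -mulmxA AA mulmx1.
Qed.

Lemma rep_torusC s t : in_torus s -> in_torus t ->
  comm_mx (opmx (rho (torus_elt s))) (opmx (rho (torus_elt t))).
Proof.
move=> Ts Tt; rewrite /comm_mx -!rep_torusM //.
by congr (opmx (rho (torus_elt _))); apply/funext => a; rewrite mulrC.
Qed.

(** The circles through [o] generate the torus; the entry at [o] comes out right because the product
    of all entries is 1. *)
Lemma torus_circle_prod (o : 'I_d.+1) (t : 'I_d.+1 -> C) : in_torus t ->
  t = fun c => \prod_(a | a != o) circle a o (t a) c.
Proof.
move=> [t1 tp]; apply/funext => c; have [->|co] := eqVneq c o.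
  rewrite (eq_bigr (fun a => (t a)^-1)) => [|a ao].
    have p0 : \prod_(a | a != o) t a != 0 by apply/prodf_neq0 => a _; exact: norm1_neq0.
    rewrite prodfV; apply: (mulfI p0); rewrite divff //.
    by rewrite -[RHS]tp [RHS](bigD1 o) //= mulrC.
  by rewrite /circle eq_sym (negbTE ao) eqxx.
rewrite (bigD1 c) //= big1 ?mulr1 => [|a /andP[ao ac]].
  by rewrite /circle eqxx.
by rewrite /circle eq_sym (negbTE ac) (negbTE co).
Qed.

Lemma unitary_row_neq0 (P : 'M[C]_m) k : P \is unitarymx -> row k P != 0.
Proof.
move=> /unitarymxP/matrixP/(_ k k) H; apply/eqP => rk.
move: H; rewrite !mxE eqxx big1 => [/eqP|i _]; first by rewrite eq_sym oner_eq0.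
by have /rowP/(_ i) := rk; rewrite !mxE => ->; rewrite mul0r.
Qed.

(** Each circle through [o] is controlled by one element [w a]. These elements and their inverses
    commute, and a common eigenbasis for them is a weight basis for every circle, hence for the
    torus. *)
Theorem torus_weights : exists2 P : 'M[C]_m, P \is unitarymx &
  exists mu : 'I_m -> 'I_d.+1 -> int, forall t, in_torus t -> forall k,
    row k P *m opmx (rho (torus_elt t)) = character (mu k) t *: row k P.
Proof.
pose o : 'I_d.+1 := ord0.
have /choice[w wP] : forall a : 'I_d.+1, exists w : C, a != o -> `|w| = 1 /\
  forall (v : 'rV[C]_m) l, v != 0 -> v *m opmx (rho (torus_elt (circle a o w))) = l *: v ->
  exists q : int, forall u, `|u| = 1 -> v *m opmx (rho (torus_elt (circle a o u))) = u ^ q *: v.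
  move=> a; have [ao|ao] := eqVneq a o; first by exists 1.
  by have [w wP] := rep_circle_weights rho_rep ao; exists w.
(* The boolean adds the inverses, whose images are the adjoints needed by
   [unitary_codiagonalization]. *)
pose gen (x : 'I_d.+1 * bool) := circle x.1 o (if x.2 then w x.1 else (w x.1)^-1).
pose As := [seq opmx (rho (torus_elt (gen x))) | x <- enum [pred x | x.1 != o]].
have tT x : x.1 != o -> in_torus (gen x).
  move=> xo; have [w1 _] := wP _ xo; apply: in_torus_circle => //.
  by case: x.2; rewrite ?normfV w1 ?invr1.
have AsP A : A \in As -> exists2 x, x.1 != o & A = opmx (rho (torus_elt (gen x))).
  by move=> /mapP[x]; rewrite mem_enum => xo ->; exists x.
have inAs x : x.1 != o -> opmx (rho (torus_elt (gen x))) \in As.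
  by move=> xo; apply/mapP; exists x; rewrite ?mem_enum.
have [|A /AsP[x xo ->]|P Pu PA] := @unitary_codiagonalization _ _ As.
- by move=> A B /AsP[x xo ->] /AsP[y yo ->]; apply: rep_torusC; exact: tT.
- rewrite (rep_torusV (tT _ xo)).
  rewrite (_ : (fun a => _) = gen (x.1, ~~ x.2)); first exact: inAs.
  apply/funext => a; rewrite /gen /circle; case: x.2 => /=;
    by case: ifP => // _; rewrite ?invrK //; case: ifP => _; rewrite ?invrK ?invr1.
have /choice[q qP] : forall ka : 'I_m * 'I_d.+1, exists q : int, ka.2 != o -> forall u, `|u| = 1 ->
    row ka.1 P *m opmx (rho (torus_elt (circle ka.2 o u))) = u ^ q *: row ka.1 P.
  move=> [k a] /=; have [ao|ao] := eqVneq a o; first by exists 0.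
  have [w1 wl] := wP a ao.
  have [l lP] := PA _ (inAs (a, true) ao) k.
  by have [q0 qP] := wl _ _ (unitary_row_neq0 k Pu) lP; exists q0.
(* Weights are determined up to a constant; the coordinate at [o] is normalised to 0. *)
exists P => //; exists (fun k a => if a == o then 0 else q (k, a)) => t Tt k.
rewrite {1}(torus_circle_prod o Tt).
have Tc a : a != o -> in_torus (circle a o (t a)).
  by move=> ao; apply: in_torus_circle => //; exact: (proj1 Tt).
transitivity ((\prod_(a | a != o) t a ^ q (k, a)) *: row k P); last first.
  congr (_ *: _); rewrite /character [RHS](bigD1 o) //= expr0z mul1r.
  by apply: eq_bigr => a /negbTE->.
suff [] : in_torus (fun c => \prod_(a | a != o) circle a o (t a) c) /\
  row k P *m opmx (rho (torus_elt (fun c => \prod_(a | a != o) circle a o (t a) c))) =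
  (\prod_(a | a != o) t a ^ q (k, a)) *: row k P by [].
elim: (index_enum _) => [|a r [IHT IH]].
  rewrite (_ : (fun c => _) = fun=> 1); last by apply/funext => c; rewrite big_nil.
  by rewrite big_nil torus_elt1 rep1 // mulmx1 scale1r; split=> //; exact: in_torus1.
rewrite (_ : (fun c => _) = (fun c => if a != o then circle a o (t a) c *
  \prod_(j <- r | j != o) circle j o (t j) c else \prod_(j <- r | j != o) circle j o (t j) c)); last first.
  by apply/funext => c; rewrite big_cons.
rewrite big_cons; case: ifP => [ao|_]; last by split.
split; first by apply: in_torusM => //; exact: Tc.
rewrite (rep_torusM rho_rep (Tc _ ao) IHT) mulmxA (qP (k, a)) //; last exact: (proj1 Tt).
by rewrite -scalemxAl IH scalerA.
Qed.
End TorusWeights.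

(** * Laurent polynomials on the unit circle *)

Section UnitCirclePolynomials.
Variable C : numClosedFieldType.

Lemma natBi_neq0 (t : nat) : (t%:R - 'i : C) != 0.
Proof.
apply/eqP => /eqP; rewrite subr_eq0 => /eqP ti.
have : (t%:R ^+ 2 : C) = -1 by rewrite ti sqrCi.
move=> E; have : 0 <= (t%:R ^+ 2 : C) by rewrite exprn_ge0 ?ler0n.
by rewrite E ler0N1.
Qed.

(** The Cayley transform of [t], a source of infinitely many points of the circle. *)
Definition unit_point (t : nat) : C := (t%:R + 'i) / (t%:R - 'i).

Lemma norm_unit_point t : `|unit_point t| = 1.
Proof.
rewrite normrM normfV (_ : t%:R + 'i = (t%:R - 'i)^*).
  by rewrite norm_conjC divff // normr_eq0 natBi_neq0.
by rewrite rmorphB /= conjC_nat conjCi opprK.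
Qed.

Lemma unit_point_inj : injective unit_point.
Proof.
move=> s t /eqP; rewrite /unit_point eqr_div ?natBi_neq0 // => /eqP E.
have : 'i * (s%:R - t%:R) * 2 = 0 :> C.
  transitivity ((t%:R + 'i) * (s%:R - 'i) - (s%:R + 'i) * (t%:R - 'i) : C); first by ring.
  by rewrite -E; ring.
move/eqP; rewrite !mulf_eq0 pnatr_eq0 orbF (negbTE (neq0Ci _)) /= subr_eq0 eqr_nat.
by move/eqP.
Qed.

Lemma poly_eq_on_circle (p q : {poly C}) :
  (forall z, `|z| = 1 -> p.[z] = q.[z]) -> p = q.
Proof.
move=> H; apply/eqP; rewrite -subr_eq0; apply/eqP.
apply: (@roots_geq_poly_eq0 _ _ [seq unit_point t | t <- iota 0 (size (p - q)).+1]).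
- apply/allP => z /mapP[t _ ->]; rewrite /root !hornerE H ?subrr //.
  exact: norm_unit_point.
- by rewrite map_inj_uniq ?iota_uniq //; exact: unit_point_inj.
- by rewrite size_map size_iota.
Qed.

Lemma quad_pow_coef (a b : C) (n : nat) : 0 < a -> 0 < b ->
  (forall j, 0 <= ((a *: 'X^2 + b%:P) ^+ n)`_j) /\
  (forall j, (j <= n)%N -> 0 < ((a *: 'X^2 + b%:P) ^+ n)`_(j.*2)).
Proof.
move=> a0 b0; elim: n => [|n [IH0 IH]].
  split=> [j|j]; first by rewrite expr0 coef1 ler0n.
  by rewrite leqn0 => /eqP->; rewrite expr0 coef1.
set U := _ + _ in IH0 IH *.
have cE j : (U ^+ n.+1)`_j = a * (if (j < 2)%N then 0 else (U ^+ n)`_(j - 2)) + b * (U ^+ n)`_j.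
  rewrite exprS {1}/U mulrDl -scalerAl coefD coefZ mul_polyC coefZ.
  by rewrite -commr_polyXn coefMXn.
split=> j.
  rewrite cE; apply: addr_ge0; apply: mulr_ge0; rewrite ?(ltW a0) ?(ltW b0) ?IH0 //.
  by case: ifP => // _; exact: IH0.
move=> jn; rewrite cE; case: j jn => [|j] jn.
  by rewrite mulr0 add0r mulr_gt0 ?IH.
have -> : (j.+1.*2 - 2 = j.*2)%N by lia.
by apply: ltr_pwDl; [apply: mulr_gt0 => //; exact: IH | apply: mulr_ge0 => //; exact: ltW].
Qed.

(* The functional equation forces [\sum_l b l * z ^ q l] to be the [p]-th power
   of [(c z + s / z) / (c + s)]. *)
Lemma circle_power_support (I : finType) (b : I -> C) (q : I -> int) (p : nat) (c s : C) :
  0 < c -> 0 < s -> c != s ->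
  (forall l, b l != 0 -> `|q l| <= p%:Z) -> \sum_l b l = 1 ->
  (forall z, `|z| = 1 ->
    (\sum_l b l * z ^ (- q l)) * (c * z + s * z^-1) ^+ p =
    (\sum_l b l * z ^ q l) * (s * z + c * z^-1) ^+ p) ->
  forall h, (h <= p)%N -> exists l, b l != 0 /\ q l = p%:Z - h.*2%:Z.
Proof.
move=> c0 s0 cs bq b1 feq h hp.
(* Multiplication by [z^p] clears the denominators. Where [b l != 0] the exponents are nonnegative,
   so [absz] is harmless. *)
pose A := \sum_l b l *: 'X^(absz (p%:Z + q l)) : {poly C}.
pose B := \sum_l b l *: 'X^(absz (p%:Z - q l)) : {poly C}.
pose U := c *: 'X^2 + s%:P : {poly C}.
pose W := s *: 'X^2 + c%:P : {poly C}.
have evalE (f : I -> int) z : `|z| = 1 -> (forall l, b l != 0 -> 0 <= p%:Z + f l) ->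
   (\sum_l b l *: 'X^(absz (p%:Z + f l))).[z] = z ^+ p * \sum_l b l * z ^ f l.
  move=> z1 pf; have z0 : z != 0 by rewrite -normr_gt0 z1 ltr01.
  rewrite horner_sum mulr_sumr; apply: eq_bigr => l _; rewrite hornerZ hornerXn.
  have [->|/pf bl] := eqVneq (b l) 0; first by rewrite !mul0r mulr0.
  by rewrite mulrCA !exprnP -expfzDr // gez0_abs.
have UW : B * U ^+ p = A * W ^+ p.
  apply: poly_eq_on_circle => z z1; have z0 : z != 0 by rewrite -normr_gt0 z1 ltr01.
  rewrite !hornerM !horner_exp.
  have -> : U.[z] = z * (c * z + s * z^-1) by rewrite hornerD hornerZ hornerXn hornerC; field.
  have -> : W.[z] = z * (s * z + c * z^-1) by rewrite hornerD hornerZ hornerXn hornerC; field.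
  have -> : B.[z] = z ^+ p * \sum_l b l * z ^ (- q l).
    by apply: evalE => // l /bq; lia.
  have -> : A.[z] = z ^+ p * \sum_l b l * z ^ (q l).
    by apply: evalE => // l /bq; lia.
  rewrite !exprMn; transitivity (z ^+ p * z ^+ p * ((\sum_l b l * z ^ (- q l)) * (c * z + s * z^-1) ^+ p)).
    by ring.
  by rewrite feq //; ring.
(* The combination [s U - c W] is the constant [s^2 - c^2], nonzero as [c] and [s] are positive and
   distinct. *)
have copUW : coprimep (U ^+ p) (W ^+ p).
  apply/coprimep_expl/coprimep_expr/Bezout_coprimepP; exists (s%:P, - c%:P) => /=.
  have -> : s%:P * U + - c%:P * W = (s ^+ 2 - c ^+ 2)%:P.
    by rewrite /U /W -!mul_polyC polyCB !polyC_exp; ring.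
  rewrite polyC_eqp1 subr_sqr; apply: mulf_neq0; first by rewrite subr_eq0 eq_sym.
  by apply/lt0r_neq0/addr_gt0.
have sU : size U = 3%N.
  rewrite /U size_polyDl ?size_scale ?size_polyXn ?gt_eqF //.
  by rewrite size_polyC gt_eqF.
have U0 : U != 0 by rewrite -size_poly_eq0 sU.
have sUp : size (U ^+ p) = (p.*2).+1.
  have Up0 : (0 < size (U ^+ p))%N by rewrite size_poly_gt0 expf_neq0.
  by rewrite -(prednK Up0) size_exp sU mul2n.
(* Both [A] and [U^p] have degree at most [2 p], the latter exactly, so the quotient [k] is a
   constant. *)
have /dvdpP[k kE] : U ^+ p %| A.
  by rewrite -(Gauss_dvdpl _ copUW) -UW dvdp_mull.
have A1 : A.[1] = 1.
  rewrite horner_sum -[RHS]b1; apply: eq_bigr => l _.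
  by rewrite hornerZ hornerXn expr1n mulr1.
have k0 : k != 0.
  by apply: contra_eq_neq A1 => k0; rewrite kE k0 mul0r horner0 eq_sym oner_eq0.
have sA : (size A <= (p.*2).+1)%N.
  apply: leq_trans (size_sum _ _ _) _; apply/bigmax_leqP => l _.
  have [->|/bq bl] := eqVneq (b l) 0; first by rewrite scale0r size_poly0.
  by apply: leq_trans (size_scale_leq _ _) _; rewrite size_polyXn; lia.
have [ka kaE] : exists ka, k = ka%:P.
  exists k`_0; apply: size1_polyC.
  have := sA; rewrite kE size_mul ?expf_neq0 // sUp; by rewrite addnS /= -addn1 addnC leq_add2l.
have ka0 : ka != 0 by move: k0; rewrite kaE polyC_eq0.
have coefA n : A`_n = \sum_l b l * (n == absz (p%:Z + q l))%:R.
  by rewrite coef_sum; apply: eq_bigr => l _; rewrite coefZ coefXn.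
(* The charge [p - 2 h] sits in [A] at degree [2 (p - h)], where [U^p] has a positive binomial
   coefficient. *)
have : A`_((p - h).*2) != 0.
  rewrite kE kaE mul_polyC coefZ mulf_neq0 // gt_eqF //.
  by have [_] := quad_pow_coef p c0 s0; apply; rewrite leq_subr.
rewrite coefA => nz.
have [l /andP[bl /eqP ql]|none] := pickP (fun l => (b l != 0) && ((p - h).*2 == absz (p%:Z + q l))).
  by exists l; split=> //; have := bq _ bl; lia.
case/eqP: nz; apply: big1 => l _; have := none l.
by case: eqVneq => [->|_] /=; rewrite ?mul0r // => ->; rewrite mulr0.
Qed.
End UnitCirclePolynomials.

(** * Two by two matrices acting on a pair of levels *)

Section Embedding.
Variables (R : realType) (d : nat) (i j : 'I_d).
Local Notation C := (R[i]).
Hypothesis ij : i != j.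

Definition emb (a b c e : C) : Op R 'I_d 'I_d := fun x y =>
  if x == i then (if y == i then a else if y == j then b else 0)
  else if x == j then (if y == i then c else if y == j then e else 0)
  else (x == y)%:R.

Lemma emb_mul a b c e a' b' c' e' :
  opmul (emb a b c e) (emb a' b' c' e') =
  emb (a * a' + b * c') (a * b' + b * e') (c * a' + e * c') (c * b' + e * e').
Proof.
have ji : (j == i) = false by rewrite eq_sym (negbTE ij).
apply/funext => x; apply/funext => y; rewrite /opmul.
rewrite (bigD1 i) //= (bigD1 j) /=; last by rewrite ji.
have [xi|xi] := eqVneq x i.
  rewrite big1 => [|z /andP[/negbTE zi /negbTE zj]].
    by rewrite /emb xi !eqxx ji addr0; case: ifP => // _; case: ifP => // _; rewrite !mulr0 addr0.
  by rewrite /emb xi eqxx zi zj mul0r.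
have [xj|xj] := eqVneq x j.
  rewrite big1 => [|z /andP[/negbTE zi /negbTE zj]].
    by rewrite /emb xj !eqxx ji addr0; case: ifP => // _; case: ifP => // _; rewrite !mulr0 addr0.
  by rewrite /emb xj eqxx ji zi zj mul0r.
rewrite (bigD1 x) /=; last by rewrite xi xj.
rewrite big1 => [|z /andP[_ zx]].
  by rewrite /emb !(negbTE xi) !(negbTE xj) !eqxx !mul0r !add0r mul1r addr0.
by rewrite /emb (negbTE xi) (negbTE xj) eq_sym (negbTE zx) mul0r.
Qed.

Lemma emb_adj a b c e : adj (emb a b c e) = emb a^* c^* b^* e^*.
Proof.
have ji : (j == i) = false by rewrite eq_sym (negbTE ij).
apply/funext => x; apply/funext => y; rewrite /adj /emb.
case: (eqVneq y i) => [yi|yi]; case: (eqVneq x i) => [xi|xi] //.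
- by case: ifP => // xj; rewrite yi (negbTE xi) conjC0.
- case: ifP => // yj; rewrite xi (negbTE yi) conjC_nat //.
- case: (eqVneq y j) => [yj|yj]; case: (eqVneq x j) => [xj|xj] //.
  + by rewrite yj (negbTE xj) conjC0.
  + by rewrite xj (negbTE yj) conjC_nat.
  + by rewrite eq_sym conjC_nat.
Qed.

Lemma emb1 : emb 1 0 0 1 = @opid R 'I_d.
Proof.
apply/funext => x; apply/funext => y; rewrite /emb /opid [x == y]eq_sym.
have [->|xi] := eqVneq x i; first by case: eqVneq => // _; case: ifP.
have [->|xj] := eqVneq x j; first by case: eqVneq => [->|_]; [rewrite (negbTE ij)|case: ifP].
by [].
Qed.

Lemma torus_elt_circle u : torus_elt (circle i j u) = emb u 0 0 u^-1.
Proof.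
apply/funext => x; apply/funext => y; rewrite /torus_elt /circle /emb [x == y]eq_sym.
have [->|xi] := eqVneq x i.
  by case: (eqVneq y i) => _; rewrite ?mul1r // !mul0r; case: ifP.
have [->|xj] := eqVneq x j.
  case: (eqVneq y i) => [->|_]; first by rewrite (negbTE ij) mul0r.
  by case: (eqVneq y j) => _; rewrite ?mul1r ?mul0r.
case: (eqVneq y x) => [->|_]; last by rewrite mul0r.
by rewrite (negbTE xi) (negbTE xj) mulr1.
Qed.

Lemma torus_emb_comm t a b c e : t i = t j ->
  opmul (torus_elt t) (emb a b c e) = opmul (emb a b c e) (torus_elt t).
Proof.
move=> tij; apply/funext => x; apply/funext => y; rewrite /opmul /torus_elt.
rewrite (bigD1 x) //= big1 => [|z zx]; last by rewrite eq_sym (negbTE zx) !mul0r.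
rewrite [RHS](bigD1 y) //= [X in _ = _ + X]big1 => [|z zy]; last by rewrite (negbTE zy) mul0r mulr0.
rewrite !eqxx !addr0 !mul1r mulrC /emb.
have [->|xi] := eqVneq x i.
  by case: (eqVneq y i) => [->|_] //; case: (eqVneq y j) => [->|_]; rewrite ?tij ?mul0r.
have [->|xj] := eqVneq x j.
  by case: (eqVneq y i) => [->|_]; rewrite ?tij //; case: (eqVneq y j) => [->|_]; rewrite ?mul0r.
by case: (eqVneq x y) => [->|_]; rewrite ?mul0r.
Qed.

(* A rotation has determinant 1 because it is the square of the rotation by
   half the angle. *)
Lemma rotation_square_SU (c s : C) : c^* = c -> s^* = s -> c ^+ 2 + s ^+ 2 = 1 ->
  is_SU (opmul (emb c (- s) s c) (emb c (- s) s c)).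
Proof.
move=> cr sr cs; set r := emb _ _ _ _.
have rr : opmul (adj r) r = @opid R 'I_d.
  by rewrite emb_adj emb_mul -emb1 rmorphN /= cr sr; congr emb; rewrite -?cs; ring.
have trE : opmx (adj r) = (opmx r)^T.
  apply/matrixP => x y; rewrite !mxE /adj /r /emb.
  by do !case: ifP => _; rewrite ?rmorphN /= ?cr ?sr ?conjC0 ?conjC_nat.
have det2 : \det (opmx r) * \det (opmx r) = 1.
  by rewrite -{1}det_tr -trE -det_mulmx -opmx_mul rr opmx_id det1.
split; last by rewrite -[LHS]/(\det (opmx _)) opmx_mul det_mulmx det2.
apply: opmx_inj; move: rr => /(congr1 (@opmx _ _ _)).
rewrite !opmx_mul !opmx_adj !opmx_mul opmx_id trmx_mul map_mxM => rr.
by rewrite mulmxA -[X in X *m _]mulmxA rr mulmx1 rr.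
Qed.
End Embedding.

(** * Strings of weights from matrix coefficients *)

Section Strings.
Variables (R : realType) (d m : nat).
Local Notation C := (R[i]).
Variables (sig : Op R 'I_d 'I_d -> 'M[C]_m) (mu : 'I_m -> 'I_d -> int).
Hypothesis sigM : forall U V, is_SU U -> is_SU V -> sig (opmul U V) = sig U *m sig V.
Hypothesis sig_torus : forall t, in_torus t ->
  sig (torus_elt t) = diag_mx (\row_k character (mu k) t).

(* The subtorus [t i = t j] commutes with the copy of SU(2) acting on the levels
   [i] and [j], so two weights agree on it when they lie on a common string. *)
Definition same_fiber (i j : 'I_d) (k l : 'I_m) :=
  forall t : 'I_d -> C, in_torus t -> t i = t j -> character (mu k) t = character (mu l) t.

(* For [s = 1] and [s = -1], the rotation with cosine 7/25 and sine [s * 24/25]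
   and its inverse; [circle_power_support] needs unequal squares of both. *)
Let rot i j (s : C) : Op R 'I_d 'I_d :=
  opmul (emb i j (4 / 5) (- (s * (3 / 5))) (s * (3 / 5)) (4 / 5))
        (emb i j (4 / 5) (- (s * (3 / 5))) (s * (3 / 5)) (4 / 5)).

Lemma rotE i j s : i != j -> s ^+ 2 = 1 ->
  rot i j s = emb i j (7 / 25) (- (s * (24 / 25))) (s * (24 / 25)) (7 / 25).
Proof.
move=> ij s2; rewrite /rot emb_mul //.
have E : s * s = 1 by rewrite -expr2.
have D : 4 / 5 * (4 / 5) - s * s * (9 / 25) = 7 / 25 :> C by rewrite E; field.
congr emb; first by rewrite -D; field.
- by field.
- by field.
- by rewrite -D; field.
Qed.

Lemma rot_SU i j s : i != j -> s \is Num.real -> s ^+ 2 = 1 -> is_SU (rot i j s).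
Proof.
move=> ij sr s2; apply: rotation_square_SU => //.
- by apply/CrealP; rewrite rpredM ?rpredV ?realn.
- by apply/CrealP; rewrite !rpredM ?rpredV ?realn.
- by rewrite [(s * _) ^+ 2]exprMn s2; field.
Qed.

(* [(7/25)^2 z + (24/25)^2 / z], the upper left entry of [conj_circle]. *)
Let al (z : C) : C := 49 / 625 * z + 576 / 625 * z^-1.

Let conj_circle i j (z : C) := opmul (opmul (rot i j 1) (torus_elt (circle i j z))) (rot i j (-1)).

Lemma conj_circleE i j z : i != j -> z != 0 -> conj_circle i j z =
  emb i j (al z) (168 / 625 * (z - z^-1)) (168 / 625 * (z - z^-1)) (al z^-1).
Proof.
move=> ij z0; rewrite /conj_circle !rotE ?expr1n ?sqrrN ?expr1n // torus_elt_circle // !emb_mul //.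
by congr emb; rewrite /al; field.
Qed.

(** The two terms have the distinct moduli 49/625 and 576/625. *)
Lemma al_neq0 z : `|z| = 1 -> al z != 0.
Proof.
move=> z1; rewrite /al addr_eq0; apply/eqP => /(congr1 Num.norm).
rewrite normrN !normrM !normfV z1 invr1 !mulr1 !normr_nat => /eqP.
rewrite eqr_div ?pnatr_eq0 // -!natrM eqr_nat //.
Qed.

Lemma al_conj z : `|z| = 1 -> al z^-1 = (al z)^*.
Proof.
move=> z1; have zi : z^-1 = z^* by rewrite invC_norm z1 expr1n invr1 mul1r.
rewrite /al rmorphD !rmorphM !fmorphV /= !conjC_nat invrK zi.
have -> : (z^*)^-1 = z by rewrite -zi invrK.
by [].
Qed.

(* Conjugating by circle elements of the phase of [- al z^-1 / al z] inverts
   [conj_circle z]. *)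
Lemma conj_circle_inv i j z : i != j -> `|z| = 1 -> exists2 u : C, `|u| = 1 &
  [/\ - u ^+ 2 * al z = al z^-1 &
      opmul (opmul (torus_elt (circle i j u)) (conj_circle i j z)) (torus_elt (circle i j (- u)))
      = conj_circle i j z^-1].
Proof.
move=> ij z1; have z0 := norm1_neq0 z1; have a0 := al_neq0 z1.
have zi1 : `|z^-1| = 1 by rewrite normfV z1 invr1.
have zi0 := norm1_neq0 zi1; have b0 := al_neq0 zi1.
exists (sqrtC (- al z^-1 / al z)).
  apply/eqP; rewrite -(@pexpr_eq1 _ _ 2) // -normrX sqrtCK normrM normrN normfV.
  by rewrite al_conj // norm_conjC divff // normr_eq0.
have := sqrtCK (- al z^-1 / al z); move: (sqrtC _) => u u2.
have uu : - u ^+ 2 * al z = al z^-1 by rewrite u2; field.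
have u0 : u != 0.
  by apply: contraNneq b0 => u0; rewrite -uu u0 expr0n /= oppr0 mul0r.
split=> //; rewrite !conj_circleE // !torus_elt_circle // !emb_mul // invrK.
rewrite !mul0r !mulr0 !add0r !addr0.
congr emb; rewrite ?invrN.
- by rewrite -uu; ring.
- by field; rewrite ?u0 ?z0.
- by field; rewrite ?u0 ?z0.
- by rewrite -uu; field; rewrite ?u0 ?z0.
Qed.

Let q i j (l : 'I_m) : int := mu l i - mu l j.

Lemma sig_torusl t (A : 'M[C]_m) k l : in_torus t ->
  (sig (torus_elt t) *m A) k l = character (mu k) t * A k l.
Proof. by move=> Tt; rewrite sig_torus // mul_diag_mx !mxE. Qed.

Lemma sig_torusr t (A : 'M[C]_m) k l : in_torus t ->
  (A *m sig (torus_elt t)) k l = A k l * character (mu l) t.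
Proof. by move=> Tt; rewrite sig_torus // mul_mx_diag !mxE. Qed.

(** The rotation commutes with the subtorus [t i = t j], so its matrix in the weight basis links
    only weights that agree there. *)
Lemma rot_same_fiber i j k l : i != j -> sig (rot i j 1) k l != 0 -> same_fiber i j k l.
Proof.
move=> ij nz t Tt tij; apply: (mulIf nz); rewrite -sig_torusl // mulrC -sig_torusr //.
have Srot : is_SU (rot i j 1) by apply: rot_SU; rewrite ?rpred1 ?expr1n.
rewrite -!sigM //; try exact: torus_SU.
by rewrite rotE ?expr1n // torus_emb_comm.
Qed.

Lemma conj_circle_coef i j k z : i != j -> `|z| = 1 ->
  sig (conj_circle i j z) k k =
  \sum_l (sig (rot i j 1) k l * sig (rot i j (-1)) l k) * z ^ (q i j l).
Proof.
move=> ij z1; have Tz := in_torus_circle ij z1.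
have Srot : is_SU (rot i j 1) by apply: rot_SU; rewrite ?rpred1 ?expr1n.
have Srot' : is_SU (rot i j (-1)) by apply: rot_SU; rewrite ?rpredN ?rpred1 ?sqrrN ?expr1n.
have Sz := torus_SU Tz.
rewrite /conj_circle sigM //; last exact: is_SU_mul.
rewrite sigM // mxE; apply: eq_bigr => l _.
by rewrite sig_torusr // character_circle // mulrAC.
Qed.

(** The products [b l] are the coefficients of the diagonal matrix coefficient at [k], a Laurent
    polynomial by [conj_circle_coef]. Conjugation by the circle gives its functional equation, and
    [circle_power_support] then finds every charge of the string among the [l] with [b l != 0]. *)
Lemma string_top i j k (p : nat) : i != j -> q i j k = p%:Z ->
  (forall l, same_fiber i j k l -> `|q i j l| <= p%:Z) ->
  forall h, (h <= p)%N -> exists l, same_fiber i j k l /\ q i j l = p%:Z - h.*2%:Z.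
Proof.
move=> ij qk qmax h hp.
pose b l := sig (rot i j 1) k l * sig (rot i j (-1)) l k.
have bfib l : b l != 0 -> same_fiber i j k l.
  by rewrite mulf_eq0 negb_or => /andP[/(rot_same_fiber ij)].
have c0 : 0 < 49 / 625 :> C by rewrite divr_gt0 ?ltr0n.
have s0 : 0 < 576 / 625 :> C by rewrite divr_gt0 ?ltr0n.
have cs : 49 / 625 != 576 / 625 :> C.
  by rewrite eqr_div ?pnatr_eq0 // -!natrM eqr_nat.
have F1 : \sum_l b l = 1.
  transitivity (sig (conj_circle i j 1) k k).
    by rewrite conj_circle_coef ?normr1 //; apply: eq_bigr => l _; rewrite exp1rz mulr1.
  rewrite conj_circleE ?oner_neq0 // (_ : emb _ _ _ _ _ _ = torus_elt (fun=> 1)).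
    rewrite sig_torus; last exact: in_torus1.
    by rewrite !mxE eqxx /character big1 // => a _; rewrite exp1rz.
  by rewrite torus_elt1 -(emb1 R ij) /al invr1; congr emb; field.
have [|z z1|l [bl ql]] := @circle_power_support _ _ b (q i j) p _ _ c0 s0 cs _ F1 _ h hp.
- by move=> l /bfib/qmax.
- have z0 := norm1_neq0 z1; have zi1 : `|z^-1| = 1 by rewrite normfV z1 invr1.
  have [u u1 [uu uE]] := conj_circle_inv ij z1.
  have u1' : `|- u| = 1 by rewrite normrN.
  (* The two circle factors act on the coefficient at [k] through its charge, as [u^p] and
     [(-u)^p]. *)
  have FzV : sig (conj_circle i j z^-1) k k = (- u ^+ 2) ^+ p * sig (conj_circle i j z) k k.
    have Su := torus_SU (in_torus_circle ij u1).
    have Su' := torus_SU (in_torus_circle ij u1').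
    have Sz : is_SU (conj_circle i j z).
      rewrite /conj_circle; apply: is_SU_mul.
        apply: is_SU_mul; last exact/torus_SU/in_torus_circle.
        by apply: rot_SU; rewrite ?rpred1 ?expr1n.
      by apply: rot_SU; rewrite ?rpredN ?rpred1 ?sqrrN ?expr1n.
    rewrite -uE sigM //; last exact: is_SU_mul.
    rewrite sigM // sig_torusr ?sig_torusl //; try exact: in_torus_circle.
    rewrite !character_circle // -/(q i j k) qk -!exprnP mulrAC -exprMn.
    by rewrite mulrN -expr2.
  have E1 : \sum_l b l * z ^ (- q i j l) = sig (conj_circle i j z^-1) k k.
    by rewrite conj_circle_coef //; apply: eq_bigr => l _; rewrite exprz_inv.
  rewrite E1 -conj_circle_coef // FzV mulrAC -exprMn -[_ * z + _]/(al z) uu mulrC.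
  by congr (_ * _ ^+ _); rewrite /al invrK addrC.
by exists l; split=> //; exact: bfib.
Qed.

Lemma same_fiber_sym i j k l : same_fiber i j k l -> same_fiber j i k l.
Proof. by move=> H t Tt tij; apply: H. Qed.

(** The circle at [u = -1] has equal entries at [i] and [j], so it lies in the subtorus on which the
    two weights agree. *)
Lemma same_fiber_parity i j k l : i != j -> same_fiber i j k l ->
  exists e : int, q i j k - q i j l = e * 2.
Proof.
move=> ij H; have N1 : `|-1 : C| = 1 by rewrite normrN1.
have := H _ (in_torus_circle ij N1); rewrite !character_circle // -/(q i j k) -/(q i j l).
have -> : circle i j (-1 : C) i = circle i j (-1) j.
  by rewrite /circle eqxx eq_sym (negbTE ij) eqxx invrN invr1.
move=> /(_ erefl) E.
have : (-1 : C) ^ (q i j k - q i j l) = 1.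
  by rewrite expfzDr ?oppr_eq0 ?oner_eq0 // E -expfzDr ?oppr_eq0 ?oner_eq0 // subrr.
move: (_ - _) => e {E}.
have half n : (-1 : C) ^+ n = 1 -> exists f, n = f.*2.
  rewrite -signr_odd => H1; exists n./2; rewrite -[LHS]odd_double_half.
  case: (odd n) H1 => // /eqP; rewrite expr1 -subr_eq0 -opprD oppr_eq0.
  by rewrite -(natrD _ 1 1) pnatr_eq0.
case: e => n.
  by rewrite -exprnP => /half[f ->]; exists f%:Z; lia.
rewrite NegzE -exprnN => /(congr1 (@GRing.inv _)); rewrite invrK invr1 => /half[f fE].
by exists (- f%:Z); lia.
Qed.

(** A weight of largest absolute charge in the fiber of [k] is the end of a string that covers all
    smaller charges of its parity. If its charge is negative, [i] and [j] trade places. *)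
Lemma string_weights i j k (e : int) : i != j ->
  `|e| <= `|q i j k| -> (exists f, q i j k - e = f * 2) ->
  exists l, same_fiber i j k l /\ q i j l = e.
Proof.
move=> ij ek [f fE].
have ji : j != i by rewrite eq_sym.
have [k' kk' kmax] : exists2 k', same_fiber i j k k' &
    forall l, same_fiber i j k l -> `|q i j l| <= `|q i j k'|.
  have kk : asbool (same_fiber i j k k) by apply/asboolP.
  case: (@Order.TotalTheory.arg_maxP _ _ _ k (fun l => asbool (same_fiber i j k l)) (fun l => `|q i j l|) kk).
  by move=> k' /asboolP kk' kmax; exists k' => // l /asboolP /kmax.
have [g gE] := same_fiber_parity ij kk'.
have fib l : same_fiber i j k' l -> same_fiber i j k l.
  by move=> H t Tt tij; rewrite kk' // H.
have qji l : q j i l = - q i j l by rewrite /q opprB.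
have ek' : `|e| <= `|q i j k'| by apply: le_trans ek (kmax _ _).
have [q0|q0] := leP 0 (q i j k').
  have [|||l [kl ql]] := @string_top i j k' (absz (q i j k')) ij _ _ (absz (f - g)).
  - by lia.
  - by move=> l /fib/kmax; lia.
  - by lia.
  - by exists l; split; [exact: fib | lia].
have [|||l [kl ql]] := @string_top j i k' (absz (q i j k')) ji _ _ (absz (f - g)).
- by rewrite qji; lia.
- by move=> l /same_fiber_sym/fib/kmax; rewrite qji; lia.
- by lia.
- by exists l; split; [exact/fib/same_fiber_sym | rewrite qji in ql; lia].
Qed.
End Strings.

(** * Counting weights *)

Section Dimension.
Variable R : realType.
Local Notation C := (R[i]).

(** If [n = |a - b|] were positive, the point of angle [pi / n] would have [n]-th power -1. *)
Lemma expz_unit_inj (a b : int) : (forall u : C, `|u| = 1 -> u ^ a = u ^ b) -> a = b.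
Proof.
move=> H; apply/eqP; rewrite -subr_eq0 -absz_eq0; apply/negPn/negP => n0.
set n := absz (a - b) in n0.
pose u : C := cis (pi / n%:R).
have u1 : `|u| = 1 by exact: norm_cis.
have u0 := norm1_neq0 u1.
have un : u ^+ n = -1.
  rewrite -cisMn -[pi / n%:R *+ n]mulr_natr divfK ?cis_pi //.
  by rewrite pnatr_eq0.
have uab : u ^ (a - b) = 1 by rewrite expfzDr // H // -expfzDr // subrr.
have : u ^+ n = 1.
  rewrite /n; case: (a - b) uab => k; first by rewrite absz_nat -exprnP.
  by rewrite NegzE abszN absz_nat -exprnN => /(congr1 (@GRing.inv _)); rewrite invrK invr1.
rewrite un => /eqP; rewrite -subr_eq0 -opprD oppr_eq0 -(natrD _ 1 1) pnatr_eq0 //.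
Qed.

Section WithFibers.
Variables (d m : nat) (mu : 'I_m -> 'I_d.+1 -> int).
Hypothesis strings : forall i j k (e : int), i != j ->
  `|e| <= `|mu k i - mu k j| -> (exists f, (mu k i - mu k j) - e = f * 2) ->
  exists l, (forall t : 'I_d.+1 -> C, in_torus t -> t i = t j ->
     character (mu k) t = character (mu l) t) /\ mu l i - mu l j = e.

Definition seq_character (s : seq int) (t : 'I_d.+1 -> C) : C := character (fun a => s`_a) t.

(** Fixing the sum of the entries removes the freedom of adding a constant, so that distinct
    sequences have distinct characters. *)
Let weight_seq (s0 : int) (s : seq int) := [/\ size s = d.+1, \sum_(x <- s) x = s0 &
  exists k, forall t, in_torus t -> seq_character s t = character (mu k) t].

(** With [y] a square root of [t i / t j], dividing by the circle at [y] equalises the two entries.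
    Characters thus need comparison only on the circle and on the subtorus [t i = t j]. *)
Lemma torus_split (i j : 'I_d.+1) (t : 'I_d.+1 -> C) : i != j -> in_torus t ->
  exists y t', [/\ `|y| = 1, in_torus t', t' i = t' j & t = fun a => t' a * circle i j y a].
Proof.
move=> ij Tt; have [t1 _] := Tt.
have ji : (j == i) = false by rewrite eq_sym (negbTE ij).
have := sqrtCK (t i / t j); move: (sqrtC _) => y y2.
have y1 : `|y| = 1.
  apply/eqP; rewrite -(@pexpr_eq1 _ _ 2) // -normrX y2 normrM normfV !t1.
  by rewrite invr1 mulr1.
have y0 := norm1_neq0 y1; have tj0 := norm1_neq0 (t1 j).
exists y, (fun a => t a * (circle i j y a)^-1); split=> //.
- apply: in_torusM => //; apply: in_torusV; exact: in_torus_circle.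
- rewrite /circle eqxx ji eqxx invrK.
  by apply: (mulIf y0); rewrite mulfVK // -mulrA -expr2 y2 mulrC divfK.
- apply/funext => a; rewrite mulfVK //.
  by apply: norm1_neq0; apply: (proj1 (in_torus_circle ij y1)).
Qed.

Lemma character_split (s : 'I_d.+1 -> int) (t : 'I_d.+1 -> C) (i j : 'I_d.+1) : i != j ->
  character s t = t i ^ s i * t j ^ s j * \prod_(a | (a != i) && (a != j)) t a ^ s a.
Proof.
by move=> ij; rewrite /character (bigD1 i) //= (bigD1 j) /= ?mulrA // eq_sym.
Qed.

(** The weight supplied by [strings] agrees with the changed sequence on the subtorus, where only
    [x + y] matters, and on the circle, where only the difference matters. *)
Lemma weight_seq_closed s0 : string_closed (weight_seq s0).
Proof.
move=> s1 x s2 y s3 x' y' [sz sum [k kP]] xy btw.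
have szi : (size s1 < d.+1)%N by rewrite -sz size_cat /=; lia.
have szj : (size s1 + (size s2).+1 < d.+1)%N by rewrite -sz !size_cat /= size_cat /=; lia.
pose i := Ordinal szi; pose j := Ordinal szj.
have ij : i != j by rewrite -val_eqE /= ; lia.
have nthi (u v : int) : (s1 ++ u :: s2 ++ v :: s3)`_i = u by rewrite nth_cat ltnn subnn.
have nthj (u v : int) : (s1 ++ u :: s2 ++ v :: s3)`_j = v.
  by rewrite nth_cat /= ifN ?addKn /= ?nth_cat ?ltnn ?subnn // -leqNgt leq_addr.
have ntha (u v u' v' : int) (a : 'I_d.+1) : a != i -> a != j ->
   (s1 ++ u :: s2 ++ v :: s3)`_a = (s1 ++ u' :: s2 ++ v' :: s3)`_a.
  rewrite -!val_eqE /= => ai aj; rewrite !nth_cat; case: ltnP => // h.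
  have -> : (a - size s1 = (a - size s1).-1.+1)%N by lia.
  rewrite /= !nth_cat; case: ltnP => // h'.
  by have -> : ((a - size s1).-1 - size s2 = ((a - size s1).-1 - size s2).-1.+1)%N by lia.
split.
- by rewrite -sz !size_cat /= !size_cat.
- by rewrite -sum !big_cat !big_cons !big_cat !big_cons /=; lia.
have qk : mu k i - mu k j = x - y.
  apply: expz_unit_inj => u u1; have Tu := in_torus_circle ij u1.
  by rewrite -character_circle // -kP // /seq_character character_circle // nthi nthj.
have [||l [kl ql]] := @strings i j k (x' - y') ij.
- by rewrite qk; lia.
- by exists (x - x'); rewrite qk; lia.
exists l => t Tt; have [u [t' [u1 Tt' tij tE]]] := torus_split ij Tt.
rewrite tE /seq_character !characterM !character_circle // ql nthi nthj -kl // -kP //.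
congr (_ * _); rewrite /seq_character !(character_split _ _ ij) !nthi !nthj -tij.
have ti0 : t' i != 0 by apply: norm1_neq0; exact: (proj1 Tt').
rewrite -!expfzDr // xy; congr (_ * _); apply: eq_bigr => a /andP[ai aj].
by rewrite (ntha x' y' x y).
Qed.

Lemma weight_count k (i j : 'I_d.+1) : ('C(absz (mu k i - mu k j) + d, d) <= m)%N.
Proof.
wlog ge : i j / mu k j <= mu k i.
  move=> H; have [/H //|/ltW/H] := leP (mu k j) (mu k i).
  by rewrite -opprB abszN.
pose s := [seq mu k a | a <- enum 'I_d.+1].
pose s0 := \sum_(x <- s) x.
have sN a : s`_(nat_of_ord a) = mu k a.
  by rewrite (nth_map ord0) ?size_enum_ord // nth_ord_enum.
have sz : size s = d.+1 by rewrite size_map size_enum_ord.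
have Ws : weight_seq s0 s.
  split=> //; exists k => t Tt; apply: eq_bigr => a _; by rewrite sN.
have si (a : 'I_d.+1) : mu k a \in s by rewrite -sN mem_nth ?sz.
have [L [uL zL LP]] := string_closed_card (m := absz (mu k i - mu k j)) (@weight_seq_closed s0) Ws sz (si i) (si j) ltac:(lia).
apply: leq_trans zL _.
have /choice[f fP] : forall l : seq int, exists k' : 'I_m, l \in L ->
    forall t, in_torus t -> seq_character l t = character (mu k') t.
  move=> l; have [/LP[[_ _ [k' k'P]] _]|] := boolP (l \in L); last by exists k.
  by exists k'.
(* Equal characters force equal differences of coordinates, and the common sum then forces equal
   sequences. *)
have finj : {in L &, injective f}.
  move=> l l' lL l'L ff.
  have [[szl suml _] _] := LP _ lL; have [[szl' suml' _] _] := LP _ l'L.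
  have E t : in_torus t -> seq_character l t = seq_character l' t.
    by move=> Tt; rewrite (fP _ lL) // (fP _ l'L) // ff.
  have dE (a b : 'I_d.+1) : l`_a - l`_b = l'`_a - l'`_b.
    have [->|ab] := eqVneq a b; first by rewrite !subrr.
    apply: expz_unit_inj => u u1; rewrite -!(character_circle (fun a : 'I_d.+1 => _`_a) ab u1).
    exact: E (in_torus_circle ab u1).
  have sumE (r : seq int) : size r = d.+1 -> \sum_(x <- r) x = \sum_(a < d.+1) r`_a.
    by move=> <-; rewrite (big_nth 0) big_mkord.
  have : \sum_(a < d.+1) (l`_a - l'`_a) = 0.
    by rewrite sumrB -!sumE // suml suml' subrr.
  rewrite (eq_bigr (fun=> l`_(@ord0 d) - l'`_(@ord0 d))) => [|a _]; last first.
    by have := dE a ord0; lia.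
  rewrite sumr_const card_ord => /eqP; rewrite mulrn_eq0 /= => /eqP l0.
  apply: (@eq_from_nth _ 0); first by rewrite szl szl'.
  move=> n; rewrite szl => nd; have := dE (Ordinal nd) ord0; rewrite /=; lia.
rewrite -(size_map f) -[X in (_ <= X)%N](card_ord m).
have /card_uniqP <- : uniq (map f L) by rewrite map_inj_in_uniq.
exact: max_card.
Qed.
End WithFibers.

Theorem rep_weights (d m : nat) (rho : Op R 'I_d.+1 'I_d.+1 -> Op R 'I_m 'I_m) (i j : 'I_d.+1) :
  i != j -> is_cont_unitary_rep rho ->
  exists2 P : 'M[C]_m, P \is unitarymx & exists q : 'I_m -> int,
   (forall u k, `|u| = 1 -> row k P *m opmx (rho (torus_elt (circle i j u))) = u ^ q k *: row k P)
   /\ forall k, ('C(absz (q k) + d, d) <= m)%N.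
Proof.
move=> ij rep; have [P Pu [mu muP]] := torus_weights rep.
exists P => //; exists (fun k => mu k i - mu k j); split=> [u k u1|k].
  by rewrite muP ?character_circle //; exact: in_torus_circle.
apply: weight_count.
pose sig U := P *m opmx (rho U) *m P ^t*.
have PP := unitarymxP Pu.
have PP' : P ^t* *m P = 1%:M by apply: mulmx1C.
apply: (@string_weights R d.+1 m sig mu).
  move=> U V SU SV; rewrite /sig repM // !mulmxA; congr (_ *m _ *m _).
  by rewrite -[RHS]mulmxA PP' mulmx1.
move=> t Tt; rewrite /sig.
suff -> : P *m opmx (rho (torus_elt t)) = diag_mx (\row_k character (mu k) t) *m P.
  by rewrite -mulmxA PP mulmx1.
apply/matrixP => k' l; have /rowP/(_ l) := muP t Tt k'.
by rewrite -row_mul mxE => ->; rewrite mul_diag_mx !mxE.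
Qed.
End Dimension.

(** * Erasure noise on a tensor product *)

(** Distributivity for dependent functions, obtained from the version for [fprod] by reindexing. *)
Lemma sum_prod_dffun (A : comPzRingType) (I : finType) (T : I -> finType) (F : forall i, T i -> A) :
  \sum_(a : {dffun forall i, T i}) \prod_i F i (a i) = \prod_i \sum_(b : T i) F i b.
Proof.
rewrite (reindex (@dffun_of_fprod I T)) /=; last exact/onW_bij/dffun_of_fprod_bij.
transitivity (\sum_(t : fprod T) \prod_(i in I) [ffun b : T i => F i b] (t i)).
  by apply: eq_bigr => t _; apply: eq_bigr => i _; rewrite !ffunE.
rewrite (@big_fprod _ _ _ _ _ I T (fun i => [ffun b : T i => F i b])) -(bigA_distr_big_dep _ (fun i j => untag 0 [ffun b : T i => F i b] j)).
apply: eq_bigr => i _; transitivity (\sum_(b : T i) [ffun b : T i => F i b] b).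
  exact/esym/(big_tag (fun i (b : T i) => [ffun b : T i => F i b] b)).
by apply: eq_bigr => b _; rewrite ffunE.
Qed.

Section Tensor.
Variable R : realType.
Local Notation C := (R[i]).
Variables (n : nat) (d : 'I_n -> nat).
Implicit Types (K : forall i : 'I_n, Op R 'I_(d i) 'I_(d i)).

Definition tens K : Op R (Aidx d) (Aidx d) := fun a a' => \prod_i K i (a i) (a' i).

Lemma opmul_tens K K' : opmul (tens K) (tens K') = tens (fun i => opmul (K i) (K' i)).
Proof.
apply/funext => a; apply/funext => a'; rewrite /opmul /tens.
transitivity (\sum_(b : Aidx d) \prod_i (K i (a i) (b i) * K' i (b i) (a' i))).
  by apply: eq_bigr => b _; rewrite big_split.
exact: (sum_prod_dffun (fun i b => K i (a i) b * K' i b (a' i))).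
Qed.

Lemma adj_tens K : adj (tens K) = tens (fun i => adj (K i)).
Proof.
by apply/funext => a; apply/funext => a'; rewrite /adj /tens rmorph_prod.
Qed.

Lemma tens_id : tens (fun i => @opid R 'I_(d i)) = @opid R (Aidx d).
Proof.
apply/funext => a; apply/funext => a'; rewrite /tens /opid.
case: eqVneq => [->|aa]; first by apply: big1 => i _; rewrite eqxx.
have [i ai] : exists i, a i != a' i.
  apply: contrapT => H; case/eqP: aa; apply/ffunP => i.
  by apply/eqP/negPn/negP => ai; apply: H; exists i.
by rewrite (bigD1 i) //= (negbTE ai) mul0r.
Qed.

Lemma upd_in (a : Aidx d) i (k : 'I_(d i)) : upd a k i = k.
Proof. by rewrite ffunE dfwith_in. Qed.

Lemma upd_out (a : Aidx d) i (k : 'I_(d i)) j : j != i -> upd a k j = a j.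
Proof. by move=> ji; rewrite ffunE dfwith_out // eq_sym. Qed.

Lemma updP (a b : Aidx d) i (k : 'I_(d i)) : b i = k -> (forall j, j != i -> b j = a j) -> b = upd a k.
Proof.
move=> bi bj; apply/ffunP => j; have [->|ji] := eqVneq j i; first by rewrite upd_in.
by rewrite upd_out // bj.
Qed.

Lemma upd_id (a : Aidx d) i : upd a (a i) = a.
Proof. by apply/esym/updP. Qed.

Lemma upd_upd (a : Aidx d) i (k l : 'I_(d i)) : upd (upd a k) l = upd a l.
Proof.
by apply: updP => [|j ji]; rewrite ?upd_in // !upd_out.
Qed.

(** Exchanging [b] with the [i]-th entry of [a] is an involution on the pairs. *)
Lemma sum_upd_swap i (F : Aidx d -> 'I_(d i) -> C) :
  \sum_a \sum_b F a b = \sum_a \sum_(b : 'I_(d i)) F (upd a b) (a i).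
Proof.
rewrite !pair_bigA /= (reindex (fun p : Aidx d * 'I_(d i) => (upd p.1 p.2, p.1 i))) //=.
exists (fun p : Aidx d * 'I_(d i) => (upd p.1 p.2, p.1 i)) => -[a b] _ /=;
  by rewrite upd_upd upd_id upd_in.
Qed.

Definition site i (A : Op R 'I_(d i) 'I_(d i)) : forall j, Op R 'I_(d j) 'I_(d j) :=
  fun j => if i =P j is ReflectT ij then ecast z (Op R 'I_(d z) 'I_(d z)) ij A else @opid R _.

Arguments site {i} A j.

Lemma site_in i (A : Op R 'I_(d i) 'I_(d i)) : site A i = A.
Proof. by rewrite /site; case: eqP => // ii; rewrite eq_axiomK. Qed.

Lemma site_out i (A : Op R 'I_(d i) 'I_(d i)) j : j != i -> site A j = @opid R _.
Proof. by rewrite /site; case: eqP => // ij /eqP; case; rewrite ij. Qed.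

Lemma tens_site i (A : Op R 'I_(d i) 'I_(d i)) (psi : Aidx d -> C) a :
  \sum_a' tens (site A) a a' * psi a' = \sum_b A (a i) b * psi (upd a b).
Proof.
transitivity (\sum_b \sum_a' (a' == upd a b)%:R * (A (a i) b * psi a')); last first.
  apply: eq_bigr => b _; rewrite (bigD1 (upd a b)) //= eqxx mul1r big1 ?addr0 // => a' /negbTE->.
  by rewrite mul0r.
rewrite exchange_big; apply: eq_bigr => a' _ /=.
have [E|E] := eqVneq a' (upd a (a' i)).
  rewrite (bigD1 (a' i)) //= -E eqxx mul1r big1 ?addr0 => [|b bi]; last first.
    case: eqVneq => [E'|]; last by rewrite mul0r.
    by move: bi; rewrite E' upd_in eqxx.
  congr (_ * _); rewrite /tens (bigD1 i) //= site_in big1 ?mulr1 // => j ji.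
  by rewrite site_out // E upd_out // /opid eqxx.
rewrite big1 => [|b _]; last first.
  case: eqVneq => [E'|]; last by rewrite mul0r.
  by case/eqP: E; rewrite {1}E' E' upd_in.
have [j ji aj] : exists2 j, j != i & a j != a' j.
  apply: contrapT => H; case/eqP: E; apply: updP => // j ji.
  by apply/esym/eqP/negPn/negP => aj; apply: H; exists j.
by rewrite /tens (bigD1 j) //= site_out // /opid (negbTE aj) !mul0r.
Qed.
End Tensor.

Section Erasure.
Variable R : realType.
Local Notation C := (R[i]).
Variables (n : nat) (d : 'I_n -> nat).
Variable W : forall i : 'I_n, Op R 'I_(d i) 'I_(d i).
Arguments W : clear implicits.
Hypothesis W_unitary : forall i, opmul (adj (W i)) (W i) = @opid R _.

Definition local_coords (psi : Aidx d -> C) (k : Aidx d) : C := \sum_a tens W k a * psi a.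

Let dia i (g : 'I_(d i) -> C) : Op R 'I_(d i) 'I_(d i) := fun k l => (k == l)%:R * g k.

(** The local observable with eigenvalues [g] in the eigenbasis [W i]. *)
Let twist i (g : 'I_(d i) -> C) : Op R 'I_(d i) 'I_(d i) := opmul (adj (W i)) (opmul (dia g) (W i)).

Lemma opmul_dia i (g : 'I_(d i) -> C) k b : opmul (dia g) (W i) k b = g k * W i k b.
Proof.
rewrite /opmul (bigD1 k) //= big1 ?addr0 => [|l lk]; first by rewrite /dia eqxx mul1r.
by rewrite /dia eq_sym (negbTE lk) !mul0r.
Qed.

Lemma twistE i (g : 'I_(d i) -> C) b b' :
  twist g b b' = \sum_k (W i k b)^* * (g k * W i k b').
Proof. by apply: eq_bigr => k _; rewrite opmul_dia. Qed.

Lemma tens_twist i (g : 'I_(d i) -> C) a a' :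
  tens (site (twist g)) a a' = \sum_(k : Aidx d) (tens W k a)^* * (g (k i) * tens W k a').
Proof.
transitivity (opmul (adj (tens W)) (opmul (tens (site (dia g))) (tens W)) a a').
  rewrite opmul_tens adj_tens opmul_tens; apply: eq_bigr => j _.
  have [->|ji] := eqVneq j i; first by rewrite !site_in.
  rewrite !site_out // (_ : opmul (@opid _ _) (W j) = W j) ?W_unitary //.
  apply/funext => x; apply/funext => y; rewrite /opmul /opid (bigD1 x) //= big1 ?addr0.
    by rewrite eqxx mul1r.
  by move=> z zx; rewrite eq_sym (negbTE zx) mul0r.
apply: eq_bigr => k _; congr (_ * _).
rewrite /opmul (tens_site (dia g) (fun k' => tens W k' a')).
rewrite (bigD1 (k i)) //= big1 ?addr0 => [|l lk]; first by rewrite /dia eqxx mul1r upd_id.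
by rewrite /dia eq_sym (negbTE lk) !mul0r.
Qed.

(** Both sides are the expectation of [twist g] at site [i]. On the left, the [i]-th entry of [a]
    belongs to the replacement state [phi] and is summed out by its normalisation. *)
Lemma local_coords_expect i (g : 'I_(d i) -> C) (phi : 'I_(d i) -> C) (psi : Aidx d -> C) :
  unitv phi ->
  \sum_k g k * \sum_(a : Aidx d) `|phi (a i)| ^+ 2 * `|\sum_b W i k b * psi (upd a b)| ^+ 2
  = \sum_(k : Aidx d) g (k i) * `|local_coords psi k| ^+ 2.
Proof.
move=> phi1.
transitivity (\sum_(a : Aidx d) \sum_b `|phi (a i)| ^+ 2 * (psi (upd a b))^* * \sum_(b' : 'I_(d i)) twist g b b' * psi (upd a b')).
  under eq_bigr do rewrite mulr_sumr.
  rewrite exchange_big; apply: eq_bigr => a _ /=.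
  transitivity (\sum_k \sum_b \sum_b' `|phi (a i)| ^+ 2 * (psi (upd a b))^* *
     ((W i k b)^* * (g k * W i k b') * psi (upd a b'))).
    apply: eq_bigr => k _; rewrite [X in _ * (_ * X)]normCKC rmorph_sum mulr_suml !mulr_sumr.
    apply: eq_bigr => b _; rewrite !mulr_sumr; apply: eq_bigr => b' _.
    by rewrite rmorphM /=; ring.
  rewrite exchange_big; apply: eq_bigr => b _ /=.
  rewrite exchange_big mulr_sumr; apply: eq_bigr => b' _ /=.
  by rewrite twistE mulr_suml mulr_sumr.
rewrite (sum_upd_swap (fun a b => `|phi (a i)| ^+ 2 * (psi (upd a b))^* * \sum_(b' : 'I_(d i)) twist g b b' * psi (upd a b'))).
transitivity (\sum_(a : Aidx d) (psi a)^* * \sum_(a' : Aidx d) tens (site (twist g)) a a' * psi a').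
  apply: eq_bigr => a _; rewrite tens_site -[RHS]mul1r -phi1 mulr_suml.
  apply: eq_bigr => b _; rewrite upd_in upd_upd upd_id -normCKC mulrA.
  by congr (_ * _); apply: eq_bigr => b' _; rewrite upd_upd.
transitivity (\sum_(a : Aidx d) \sum_(a' : Aidx d) \sum_(k : Aidx d) (psi a)^* * ((tens W k a)^* * (g (k i) * tens W k a') * psi a')).
  apply: eq_bigr => a _; rewrite mulr_sumr; apply: eq_bigr => a' _.
  by rewrite tens_twist mulr_suml mulr_sumr.
under eq_bigr do rewrite exchange_big /=.
rewrite exchange_big; apply: eq_bigr => k _ /=.
rewrite /local_coords normCKC rmorph_sum mulr_suml mulr_sumr; apply: eq_bigr => a _.
by rewrite !mulr_sumr; apply: eq_bigr => a' _; rewrite rmorphM /=; ring.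
Qed.

Lemma sum_tagged (F : forall i : 'I_n, 'I_(d i) -> C) :
  \sum_(x : {i : 'I_n & 'I_(d i)}) F (tag x) (tagged x) = \sum_i \sum_k F i k.
Proof.
exact/esym/(@sig_big_dep _ _ _ _ (fun i : 'I_n => 'I_(d i)) (fun=> true) (fun=> xpredT) F).
Qed.

Variables (dL : nat) (V : Op R (Aidx d) 'I_dL) (phis : forall i : 'I_n, 'I_(d i) -> C).

(* The environment index is the erased site together with a vector of the
   eigenbasis [W] of its charge, so that the charge is diagonal. *)
Definition erasure_kraus (x : {i : 'I_n & 'I_(d i)}) (a : 'I_dL) (s : 'I_n * Aidx d) : C :=
  (s.1 == tag x)%:R * (((Num.sqrt (n%:R : R))%:C)%C)^-1 * @phis (tag x) (s.2 (tag x)) *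
  \sum_b W (tag x) (tagged x) b * V (upd s.2 b) a.

Lemma sum_W i b b' : \sum_k W i k b * (W i k b')^* = (b == b')%:R.
Proof.
have := congr1 (fun F => F b' b) (W_unitary i); rewrite /opmul /adj /opid eq_sym => <-.
by apply: eq_bigr => k _; rewrite mulrC.
Qed.

(** The partial trace over the erased site may be taken in the basis [W] by unitarity. *)
Lemma erasure_krausE A : erasure phis (enc V A) = kraus erasure_kraus A.
Proof.
apply/funext => s; apply/funext => t; rewrite /erasure /kraus.
pose F i (k : 'I_(d i)) := \sum_a \sum_b A a b *
  (erasure_kraus (Tagged (fun i => 'I_(d i)) k) a s * (erasure_kraus (Tagged (fun i => 'I_(d i)) k) b t)^*).
transitivity (\sum_(x : {i : 'I_n & 'I_(d i)}) F (tag x) (tagged x)); last first.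
  by apply: eq_bigr => -[i k] _.
rewrite sum_tagged; apply: eq_bigr => i _; rewrite /F /erasure_kraus /=.
set q := (_%:C)%C^-1; have qq : q * q^* = n%:R^-1.
  rewrite (_ : q^* = q) -?expr2 ?sqr_inv_sqrtC // /q fmorphV; congr (_^-1).
  exact: conjc_real.
set c := _ * _ * (_ * _).
transitivity (c * \sum_(k : 'I_(d i)) \sum_a \sum_b A a b * ((\sum_(e : 'I_(d i)) W i k e * V (upd s.2 e) a) *
     (\sum_(f : 'I_(d i)) W i k f * V (upd t.2 f) b)^*)); last first.
  rewrite mulr_sumr; apply: eq_bigr => k _; rewrite mulr_sumr; apply: eq_bigr => a _.
  rewrite mulr_sumr; apply: eq_bigr => b _; rewrite !rmorphM /= conjC_nat /c -qq -mulnb natrM; ring.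
congr (_ * _).
transitivity (\sum_(e : 'I_(d i)) \sum_a \sum_b A a b * (V (upd s.2 e) a * (V (upd t.2 e) b)^*)).
  apply: eq_bigr => e _; rewrite /enc /opmul /adj exchange_big /=.
  by apply: eq_bigr => b _; rewrite mulr_suml; apply: eq_bigr => a _; ring.
rewrite exchange_big [RHS]exchange_big; apply: eq_bigr => a _ /=.
rewrite exchange_big [RHS]exchange_big; apply: eq_bigr => b _ /=.
rewrite -!mulr_sumr; congr (_ * _).
transitivity (\sum_(e : 'I_(d i)) \sum_(f : 'I_(d i)) (e == f)%:R * (V (upd s.2 e) a * (V (upd t.2 f) b)^*)).
  apply: eq_bigr => e _; rewrite (bigD1 e) //= eqxx mul1r big1 ?addr0 // => f fe.
  by rewrite eq_sym (negbTE fe) mul0r.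
transitivity (\sum_(e : 'I_(d i)) \sum_(f : 'I_(d i)) \sum_(k : 'I_(d i)) (W i k e * V (upd s.2 e) a) * (W i k f * V (upd t.2 f) b)^*).
  apply: eq_bigr => e _; apply: eq_bigr => f _; rewrite -sum_W mulr_suml.
  by apply: eq_bigr => k _; rewrite rmorphM /=; ring.
under eq_bigr do rewrite exchange_big /=.
rewrite exchange_big; apply: eq_bigr => k _ /=.
rewrite rmorph_sum mulr_suml; apply: eq_bigr => e _.
by rewrite mulr_sumr.
Qed.

(** Each site is erased with probability [1/n], so the environment sees [1/n] times the expectation
    of the sum of the local observables. *)
Lemma erasure_kraus_expect (g : forall i : 'I_n, 'I_(d i) -> C) a :
  (forall i, unitv (@phis i)) ->
  \sum_x g (tag x) (tagged x) * \sum_s `|erasure_kraus x a s| ^+ 2 =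
  n%:R^-1 * \sum_(k : Aidx d) (\sum_i g i (k i)) * `|local_coords (V ^~ a) k| ^+ 2.
Proof.
move=> phis1.
pose F i (k : 'I_(d i)) := g i k * \sum_s `|erasure_kraus (Tagged (fun i => 'I_(d i)) k) a s| ^+ 2.
transitivity (\sum_(x : {i : 'I_n & 'I_(d i)}) F (tag x) (tagged x)).
  by apply: eq_bigr => -[i k] _.
rewrite sum_tagged.
transitivity (\sum_i n%:R^-1 * \sum_(k : Aidx d) g i (k i) * `|local_coords (V ^~ a) k| ^+ 2); last first.
  rewrite -mulr_sumr exchange_big; congr (_ * _); apply: eq_bigr => k _ /=.
  by rewrite mulr_suml.
apply: eq_bigr => i _; rewrite -(local_coords_expect _ _ (phis1 i)) mulr_sumr.
apply: eq_bigr => k _; rewrite /F mulrCA; congr (_ * _).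
rewrite sum_pair (bigD1 i) //= [X in _ + X]big1 ?addr0 => [|j ji]; last first.
  apply: big1 => s _; rewrite /erasure_kraus /= (negbTE ji) !mul0r normr0 expr0n //.
rewrite mulr_sumr; apply: eq_bigr => s _.
rewrite /erasure_kraus /= eqxx mul1r !normrM !exprMn -mulrA; congr (_ * _).
rewrite normfV exprVn -sqr_inv_sqrtC -exprVn; congr (_ ^+ 2); congr (_^-1).
by rewrite ger0_norm // lecR sqrtr_ge0.
Qed.

End Erasure.

(** * From single recoveries to the supremum *)

Section SupBound.
Variable R : realType.

(** The hypothesis bounds every [x] by [u = sqrt (1 - B^-2)], and this passes to the supremum
    whether or not it is attained. *)
Lemma sqrt_sup_ge (A : set R) (B : R) : 1 <= B ->
  (forall x, A x -> 0 <= x /\ 1 <= B ^+ 2 * (1 - x ^+ 2)) ->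
  1 <= B * Num.sqrt (1 - sup A ^+ 2).
Proof.
move=> B1 HA; have B0 : 0 < B by apply: lt_le_trans B1.
have BB0 : 0 < B ^+ 2 by rewrite exprn_gt0.
have iB0 : 0 <= B ^- 2 by rewrite invr_ge0 ltW.
have iB1 : B ^- 2 <= 1 by rewrite invf_le1 // exprn_ege1.
pose u := Num.sqrt (1 - B ^- 2).
have u0 : 0 <= u by exact: sqrtr_ge0.
have uu : u ^+ 2 = 1 - B ^- 2 by rewrite sqr_sqrtr // subr_ge0.
have Au x : A x -> x <= u.
  move=> /HA[x0 Hx]; rewrite -(@ler_pXn2r _ 2) ?nnegrE // uu.
  have : B ^- 2 <= 1 - x ^+ 2 by rewrite -div1r ler_pdivrMr // mulrC.
  lra.
have [sup0 supu] : 0 <= sup A /\ sup A <= u.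
  have [[x Ax]|A0] := pselect (A !=set0)%classic.
    split; last by apply: ge_sup; [exists x | move=> y /Au].
    apply: (le_trans (proj1 (HA _ Ax))); apply: ub_le_sup => //.
    by exists u => y /Au.
  (* On the empty set [sup] has the default value 0. *)
  by rewrite sup_out // => -[].
have : sup A ^+ 2 <= u ^+ 2 by rewrite ler_pXn2r ?nnegrE.
rewrite uu => H; rewrite -[leLHS](mulfV (lt0r_neq0 B0)) ler_pM2l //.
have -> : B^-1 = Num.sqrt (B ^- 2) by rewrite -exprVn sqrtr_sqr ger0_norm // invr_ge0 ltW.
have H' : B ^- 2 <= 1 - sup A ^+ 2 by rewrite lerBrDr addrC -lerBrDr.
exact: ler_wsqrtr.
Qed.
End SupBound.

(** * Charges and infidelities of a covariant code *)

Section CovariantCode.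
Variables (R : realType) (n d : nat) (dims : 'I_n -> nat).
Local Notation C := (R[i]).
Variables (V : Op R (Aidx dims) 'I_d.+1)
  (rep : forall i : 'I_n, Op R 'I_d.+1 'I_d.+1 -> Op R 'I_(dims i) 'I_(dims i))
  (phis : forall i : 'I_n, 'I_(dims i) -> C).
Arguments rep : clear implicits.
Arguments phis : clear implicits.
Hypotheses (n_gt0 : (0 < n)%N) (d_gt0 : (0 < d)%N) (dims_gt0 : forall i, (0 < dims i)%N).
Hypothesis V_isometry : is_isometry V.
Hypothesis rep_cont : forall i, is_cont_unitary_rep (rep i).
Hypothesis V_covariant : covariant V rep.
Hypothesis phis1 : forall i, unitv (phis i).

Let i0 : 'I_d.+1 := ord0.
Let i1 : 'I_d.+1 := ord_max.

Lemma levels_neq : i0 != i1.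
Proof. by rewrite -val_eqE /= eq_sym -lt0n. Qed.

Let tor (u : C) : Op R 'I_d.+1 'I_d.+1 := torus_elt (circle i0 i1 u).

Lemma site_weights i : exists Wq : Op R 'I_(dims i) 'I_(dims i) * ('I_(dims i) -> int),
  [/\ opmul (adj Wq.1) Wq.1 = @opid R _,
      forall u, `|u| = 1 -> opmul Wq.1 (rep i (tor u)) = fun k b => u ^ Wq.2 k * Wq.1 k b &
      forall k, ('C(absz (Wq.2 k) + d, d) <= dims i)%N].
Proof.
have [P Pu [q [qP qdim]]] := rep_weights levels_neq (rep_cont i).
exists ((fun k b => P k b), q); rewrite /=.
have PE : opmx (fun k b => P k b) = P by apply/matrixP => k b; rewrite mxE.
split=> // [|u u1].
  apply: opmx_inj; rewrite opmx_mul opmx_adj opmx_id PE.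
  exact/mulmx1C/unitarymxP.
apply/funext => k; apply/funext => b; have /rowP/(_ b) := qP u k u1.
rewrite -row_mul !mxE => <-; apply: eq_bigr => c _; by rewrite mxE.
Qed.

Let W i := (sval (cid (site_weights i))).1.
Let q i := (sval (cid (site_weights i))).2.

Arguments W : clear implicits.
Arguments q {i} _.

Lemma W_unitary i : opmul (adj (W i)) (W i) = @opid R _.
Proof. by have [] := svalP (cid (site_weights i)). Qed.

Lemma W_rep i u : `|u| = 1 -> opmul (W i) (rep i (tor u)) = fun k b => u ^ q k * W i k b.
Proof. by have [_ H _] := svalP (cid (site_weights i)); exact: H. Qed.

Lemma q_dim i (k : 'I_(dims i)) : ('C(absz (q k) + d, d) <= dims i)%N.
Proof. by have [_ _ H] := svalP (cid (site_weights i)); exact: H. Qed.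

Let energy (k : Aidx dims) : int := \sum_i q (k i).

Let coords a := local_coords W (V ^~ a).

Lemma prod_exprz (I : finType) (u : C) (f : I -> int) : u != 0 ->
  \prod_i u ^ f i = u ^ (\sum_i f i).
Proof.
move=> u0; elim/big_rec2: _ => [|i x y _ ->]; first by rewrite expr0z.
by rewrite expfzDr.
Qed.

Lemma coords_covariant u k a : `|u| = 1 ->
  \sum_s tens W k s * \sum_t UA rep (tor u) s t * V t a = u ^ energy k * coords a k.
Proof.
move=> u1; have u0 := norm1_neq0 u1.
transitivity (\sum_t opmul (tens W) (tens (fun i => rep i (tor u))) k t * V t a).
  rewrite /opmul; under [RHS]eq_bigr do rewrite mulr_suml.
  rewrite [RHS]exchange_big; apply: eq_bigr => s _ /=; rewrite mulr_sumr.
  by apply: eq_bigr => t _; rewrite mulrA.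
rewrite opmul_tens /coords /local_coords mulr_sumr; apply: eq_bigr => t _.
rewrite mulrA; congr (_ * _); rewrite /tens /energy -prod_exprz // -big_split /=.
by apply: eq_bigr => i _; rewrite W_rep.
Qed.

(** Covariance is tested on [|i0><i1|], which conjugation by the circle scales by [u^2]. *)
Lemma covariance_entries u s t : `|u| = 1 ->
  (\sum_s' UA rep (tor u) s s' * V s' i0) * (\sum_t' UA rep (tor u) t t' * V t' i1)^* =
  u ^+ 2 * (V s i0 * (V t i1)^*).
Proof.
move=> u1; have u0 := norm1_neq0 u1.
have Su : is_SU (tor u) by apply/torus_SU/in_torus_circle => //; exact: levels_neq.
pose X : Op R 'I_d.+1 'I_d.+1 := fun x y => (x == i0)%:R * (y == i1)%:R.
have encX (c : C) x y : enc V (fun a b => c * X a b) x y = c * (V x i0 * (V y i1)^*).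
  rewrite /enc /opmul /adj (bigD1 i1) //= [X in _ + X]big1 ?addr0 => [|b bi]; last first.
    by rewrite big1 ?mul0r // => a _; rewrite /X (negbTE bi) !mulr0.
  rewrite (bigD1 i0) //= big1 ?addr0 => [|a ai].
    by rewrite /X !eqxx !mulr1; ring.
  by rewrite /X (negbTE ai) mul0r !mulr0.
have := congr1 (fun F => F s t) (V_covariant Su X).
have -> : opmul (opmul (tor u) X) (adj (tor u)) = fun a b => u ^+ 2 * X a b.
  apply/funext => x; apply/funext => y; rewrite /opmul /adj /tor /torus_elt.
  rewrite (bigD1 y) //= [X in _ + X]big1 ?addr0 => [|z zy]; last first.
    by rewrite eq_sym (negbTE zy) mul0r conjC0 mulr0.
  rewrite (bigD1 x) //= [X in _ + X]big1 ?addr0 => [|z zx]; last first.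
    by rewrite eq_sym (negbTE zx) !mul0r.
  rewrite !eqxx !mul1r /X; case: (eqVneq x i0) => [->|_]; last by rewrite !mul0r mulr0 mul0r mulr0.
  case: (eqVneq y i1) => [->|_]; last by rewrite !mulr0 mul0r.
  rewrite /circle eqxx eq_sym (negbTE levels_neq) eqxx !mulr1.
  by rewrite fmorphV /= invC_norm norm_conjC u1 expr1n invr1 mul1r conjCK.
rewrite encX => ->.
have encX1 x y : enc V X x y = V x i0 * (V y i1)^*.
  rewrite -[RHS]mul1r -encX; congr (enc V _ x y).
  by apply/funext => a; apply/funext => b; rewrite mul1r.
rewrite /opmul /adj rmorph_sum mulr_sumr; apply: eq_bigr => t' _.
rewrite !mulr_suml; apply: eq_bigr => s' _.
by rewrite encX1 rmorphM /=; ring.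
Qed.

(** In the charge basis, conjugation scales the coefficient of [|V i0><V i1|] at [(k, l)] by [u] to
    the power [energy k - energy l]. Covariance under conjugation leaves a phase free, hence the
    comparison of two levels. *)
Lemma energy_gap k l : coords i0 k != 0 -> coords i1 l != 0 -> energy k = energy l + 2.
Proof.
move=> k0 l1; apply: (@expz_unit_inj R) => u u1; have u0 := norm1_neq0 u1.
have E : (u ^ energy k * coords i0 k) * (u ^ energy l * coords i1 l)^* =
    u ^+ 2 * (coords i0 k * (coords i1 l)^*).
  rewrite -!coords_covariant // /coords /local_coords [X in _ * X = _]rmorph_sum [X in _ = _ * (_ * X)]rmorph_sum !mulr_suml mulr_sumr.
  apply: eq_bigr => s _; rewrite [LHS]mulr_sumr [X in _ = _ * X]mulr_sumr [RHS]mulr_sumr; apply: eq_bigr => t _.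
  rewrite !rmorphM /= mulrACA covariance_entries //; ring.
have ul : (u ^ energy l)^* * u ^ energy l = 1.
  suff -> : (u ^ energy l)^* = (u ^ energy l)^-1 by rewrite mulVf // expfz_neq0.
  rewrite invC_norm (_ : `|u ^ energy l| = 1) ?expr1n ?invr1 ?mul1r //.
  case: (energy l) => e; first by rewrite -exprnP normrX u1 expr1n.
  by rewrite NegzE -exprnN normfV normrX u1 expr1n invr1.
have nz : coords i0 k * (coords i1 l)^* != 0 by rewrite mulf_neq0 ?conjC_eq0.
apply: (mulIf nz); rewrite expfzDr // -[RHS]mulrA -exprnP -E rmorphM /=.
transitivity ((u ^ energy l)^* * u ^ energy l * (u ^ energy k * (coords i0 k * (coords i1 l)^*))); last by ring.
by rewrite ul mul1r.
Qed.

Lemma coords_norm a : \sum_k `|coords a k| ^+ 2 = 1.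
Proof.
have WW s t : \sum_k (tens W k s)^* * tens W k t = (s == t)%:R.
  have : opmul (adj (tens W)) (tens W) = @opid R _.
    rewrite adj_tens opmul_tens -tens_id; apply/funext => x; apply/funext => y.
    by apply: eq_bigr => i _; rewrite W_unitary.
  by move=> /(congr1 (fun F => F s t)).
transitivity (\sum_s (V s a)^* * V s a); last first.
  have := congr1 (fun F => F a a) V_isometry.
  by rewrite /opmul /adj /opid eqxx.
transitivity (\sum_s \sum_t (s == t)%:R * ((V s a)^* * V t a)); last first.
  apply: eq_bigr => s _; rewrite (bigD1 s) //= eqxx mul1r big1 ?addr0 // => t ts.
  by rewrite eq_sym (negbTE ts) mul0r.
transitivity (\sum_k \sum_s \sum_t (tens W k s)^* * tens W k t * ((V s a)^* * V t a)).
  apply: eq_bigr => k _; rewrite normCKC /coords /local_coords rmorph_sum mulr_suml.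
  apply: eq_bigr => s _; rewrite mulr_sumr; apply: eq_bigr => t _.
  by rewrite rmorphM /=; ring.
rewrite exchange_big; apply: eq_bigr => s _ /=.
rewrite exchange_big; apply: eq_bigr => t _ /=.
by rewrite -mulr_suml WW.
Qed.

Lemma coords_neq0 a : exists k, coords a k != 0.
Proof.
apply: contrapT => H; have := coords_norm a; rewrite big1 => [/eqP|k _].
  by rewrite eq_sym oner_eq0.
have [->|k0] := eqVneq (coords a k) 0; first by rewrite normr0 expr0n.
by case: H; exists k.
Qed.

Let N := erasure_kraus W V phis.
Let Z (x : {i : 'I_n & 'I_(dims i)}) : C := n%:R * (q (tagged x))%:~R.
Let M : nat := \max_(x : {i : 'I_n & 'I_(dims i)}) absz (q (tagged x)).

Lemma n_neq0 : n%:R != 0 :> C.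
Proof. by rewrite pnatr_eq0 -lt0n. Qed.

Lemma kraus_norm a : \sum_x \sum_s `|N x a s| ^+ 2 = 1.
Proof.
transitivity (\sum_x 1 * \sum_s `|N x a s| ^+ 2).
  by apply: eq_bigr => x _; rewrite mul1r.
rewrite (erasure_kraus_expect W_unitary V (fun _ _ => 1) a phis1) -mulr_sumr coords_norm.
by rewrite sumr_const card_ord mulr1 mulVf // n_neq0.
Qed.

Lemma kraus_energy a : \sum_x Z x * \sum_s `|N x a s| ^+ 2 =
  \sum_k (energy k)%:~R * `|coords a k| ^+ 2.
Proof.
rewrite (erasure_kraus_expect W_unitary V (fun i k => n%:R * (q k)%:~R) a phis1) mulr_sumr.
apply: eq_bigr => k _; rewrite -mulr_sumr mulrA [n%:R^-1 * _]mulrA mulVf ?n_neq0 // mul1r.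
by rewrite /energy rmorph_sum.
Qed.

(** By [energy_gap] each of the two encoded levels is supported on a single total charge, so the
    expectations are these charges. *)
Lemma energy_diff : (\sum_x Z x * \sum_s `|N x i0 s| ^+ 2) - \sum_x Z x * \sum_s `|N x i1 s| ^+ 2 = 2.
Proof.
rewrite !kraus_energy.
have [k0 hk] := coords_neq0 i0; have [l1 hl] := coords_neq0 i1.
have const (a : 'I_d.+1) (e : int) : (forall k, coords a k != 0 -> energy k = e) ->
   \sum_k (energy k)%:~R * `|coords a k| ^+ 2 = e%:~R :> C.
  move=> H; rewrite -[RHS]mulr1 -(coords_norm a) mulr_sumr; apply: eq_bigr => k _.
  have [->|/H ->//] := eqVneq (coords a k) 0.
  by rewrite normr0 expr0n !mulr0.
rewrite (const i0 (energy l1 + 2)) => [|k hk']; last exact: energy_gap.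
rewrite (const i1 (energy l1)) => [|l hl'].
  by rewrite rmorphD /= addrAC subrr add0r.
by have := energy_gap hk hl; have := energy_gap hk hl'; lia.
Qed.

Lemma M_ge (x : {i : 'I_n & 'I_(dims i)}) : (absz (q (tagged x)) <= M)%N.
Proof. exact: (leq_bigmax x). Qed.

(** If all local charges vanished, the gap of 2 could not occur. *)
Lemma M_gt0 : (0 < M)%N.
Proof.
rewrite lt0n; apply/eqP => M0.
have e0 k : energy k = 0.
  apply: big1 => i _; have := M_ge (Tagged (fun i => 'I_(dims i)) (k i)).
  by rewrite M0 leqn0 absz_eq0 => /eqP.
have [k0 hk] := coords_neq0 i0; have [l1 hl] := coords_neq0 i1.
by have := energy_gap hk hl; rewrite !e0.
Qed.

Lemma M_dim : exists i, ('C(M + d, d) <= dims i)%N.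
Proof.
have X0 : (0 < #|{: {i : 'I_n & 'I_(dims i)}}|)%N.
  apply/card_gt0P; pose i := Ordinal n_gt0.
  by exists (Tagged (fun i => 'I_(dims i)) (Ordinal (dims_gt0 i))).
have [x xE] := bigop.eq_bigmax (fun x : {i : 'I_n & 'I_(dims i)} => absz (q (tagged x))) X0.
by exists (tag x); rewrite /M xE; exact: q_dim.
Qed.

Lemma covariant_kraus : erasure phis \o enc V = kraus N.
Proof. by apply/funext => A; exact: (erasure_krausE W_unitary V phis A). Qed.

(** This is [environment_bound] for [|Z| <= n M] and a charge difference of 2, divided by 4. *)
Lemma fidelity_bound (K : Op R ('I_n * Aidx dims)%type ('I_n * Aidx dims)%type -> Op R 'I_d.+1 'I_d.+1)
  (S : {set 'I_d.+1}) : is_channel K -> i0 \in S -> i1 \in S ->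
  1 <= 2 * (n%:R * M%:R) ^+ 2 * #|S|%:R *
       (1 - Fphi (max_entangled R S) (K \o (erasure phis \o enc V)) id ^+ 2).
Proof.
move=> chK S0 S1; rewrite covariant_kraus.
have Zz x : `|Z x| <= n%:R * M%:R.
  rewrite /Z normrM normr_nat; apply: ler_wpM2l => //.
  by rewrite -intr_norm -natr_absz ler_nat; exact: M_ge.
have := environment_bound chK kraus_norm Zz S0 S1 levels_neq.
rewrite energy_diff normr_nat.
move: (Fphi _ _ _) => F H.
have : ((4%:R : R)%:C <= (8 * (n%:R * M%:R) ^+ 2 * #|S|%:R * (1 - F ^+ 2) : R)%:C)%C.
  rewrite !(rmorphM, rmorphB, rmorphXn, rmorph_nat, rmorph1) /=.
  by apply: le_trans H; rewrite -natrX.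
rewrite lecR => H4; rewrite -(@ler_pM2l _ 4) // mulr1; apply: le_trans H4 _.
by rewrite le_eqVlt; apply/orP; left; apply/eqP; ring.
Qed.

Let Mch := erasure phis \o enc V.

Lemma nM_ge1 : 1 <= n%:R * M%:R :> R.
Proof. by rewrite -natrM ler1n muln_gt0 n_gt0 M_gt0. Qed.

Lemma Fphi_ge0 (K : Op R ('I_n * Aidx dims)%type ('I_n * Aidx dims)%type -> Op R 'I_d.+1 'I_d.+1)
  (phi : 'I_d.+1 * 'I_d.+1 -> C) :
  is_channel K -> unitv phi -> 0 <= Fphi phi (K \o Mch) id.
Proof. by move=> chK phi1; rewrite /Mch covariant_kraus; have [] := Fphi_sqr N chK phi1. Qed.

(** For each recovery the infimum over inputs is at most the fidelity on the pair [{i0, i1}]; there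
    [|S| = 2] turns the factor into [(2 n M)^2]. *)
Lemma eps_worst_bound : 1 <= 2 * n%:R * M%:R * eps_worst Mch.
Proof.
have nM1 := nM_ge1; rewrite -(mulrA 2).
apply: sqrt_sup_ge => [|x [K [chK ->]]]; first by lra.
set A := [set y | _]%classic.
pose S := [set i0; i1].
have S0 : (0 < #|S|)%N by apply/card_gt0P; exists i0; rewrite !inE eqxx.
have cS : #|S| = 2%N by rewrite cards2 levels_neq.
have A0 y : A y -> 0 <= y by move=> [phi [phi1 ->]]; exact: Fphi_ge0.
have AS : A (Fphi (max_entangled R S) (K \o Mch) id).
  by exists (max_entangled R S); split=> //; exact: max_entangled_unit.
have inf0 : 0 <= inf A by apply: lb_le_inf; [exists (Fphi (max_entangled R S) (K \o Mch) id) | move=> y /A0].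
have infS : inf A <= Fphi (max_entangled R S) (K \o Mch) id.
  by apply: ge_inf => //; exists 0 => y /A0.
split=> //.
have := @fidelity_bound K S chK; rewrite !inE !eqxx orbT cS => /(_ isT isT) H.
apply: le_trans H _.
have sq : inf A ^+ 2 <= Fphi (max_entangled R S) (K \o Mch) id ^+ 2.
  by rewrite ler_pXn2r ?nnegrE // A0.
have -> : 2 * (n%:R * M%:R) ^+ 2 * 2 = (2 * (n%:R * M%:R)) ^+ 2 :> R by ring.
by rewrite ler_wpM2l ?exprn_even_ge0 // lerD2l lerN2.
Qed.

Lemma phihat_max_entangled : phihat R (dL := d.+1) = max_entangled R [set: 'I_d.+1].
Proof.
by apply/funext => x; rewrite /phihat /max_entangled inE andbT cardsT card_ord.
Qed.

(** Here [S] consists of all levels, and [2 (n M)^2 dL <= (n M dL)^2] because [dL >= 2]. *)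
Lemma eps_e_bound : 1 <= 2 * n%:R * M%:R * (d.+1%:R * eps_e Mch / 2).
Proof.
have -> : 2 * n%:R * M%:R * (d.+1%:R * eps_e Mch / 2) =
   (n%:R * M%:R * d.+1%:R) * eps_e Mch by field.
have nM1 := nM_ge1.
have d2 : 2 <= d.+1%:R :> R by rewrite (ler_nat _ 2) ltnS.
have B1 : 1 <= n%:R * M%:R * d.+1%:R :> R.
  by apply: (le_trans nM1); rewrite ler_peMr; lra.
apply: sqrt_sup_ge => // x [K [chK ->]].
have F0 := Fphi_ge0 chK (max_entangled_unit R (S := [set: 'I_d.+1]) ltac:(by rewrite cardsT card_ord)).
rewrite phihat_max_entangled; split=> //.
have := @fidelity_bound K [set: 'I_d.+1] chK; rewrite !inE cardsT card_ord => /(_ isT isT) H.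
apply: le_trans (H) _.
have G0 : 0 <= 1 - Fphi (max_entangled R [set: 'I_d.+1]) (K \o Mch) id ^+ 2.
  have c0 : 0 < 2 * (n%:R * M%:R) ^+ 2 * d.+1%:R :> R.
    apply: mulr_gt0; last exact: ltr0Sn.
    by apply: mulr_gt0 => //; apply: exprn_gt0; exact: lt_le_trans nM1.
  by rewrite -(pmulr_rge0 _ c0); apply: le_trans H.
apply: ler_wpM2r => //; rewrite [leRHS]exprMn [2 * _]mulrC -mulrA.
apply: ler_wpM2l; first exact: exprn_even_ge0.
by rewrite expr2; apply: ler_wpM2r.
Qed.

Lemma maxlnd_ge : ln ('C(M + d, d)%:R : R) <= maxlnd R dims.
Proof.
have [i Mi] := M_dim; rewrite /maxlnd.
apply: (@le_trans _ _ (ln (dims i)%:R)); last first.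
  exact: (le_bigmax _ (fun i => ln (dims i)%:R : R) i).
rewrite ler_ln ?posrE ?ltr0n ?bin_gt0 ?leq_addl ?dims_gt0 //.
by rewrite ler_nat.
Qed.
End CovariantCode.

Theorem theorem4 (R : realType) :
  exists c : R,
  forall (n : nat) (d : 'I_n -> nat) (dL : nat)
    (V : Op R (Aidx d) 'I_dL)
    (rep : forall i : 'I_n, Op R 'I_dL 'I_dL -> Op R 'I_(d i) 'I_(d i))
    (phis : forall i : 'I_n, 'I_(d i) -> R[i]),
    (0 < n)%N -> (1 < dL)%N -> (forall i, 0 < d i)%N ->
    is_isometry V ->
    (forall i, is_cont_unitary_rep (rep i)) ->
    covariant V rep ->
    (forall i, unitv (phis i)) ->
    let M := erasure phis \o enc V in
    let ew := eps_worst M in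
    let ee := eps_e M in
    let D := maxlnd R d in
    [/\ ew >= (2 * n%:R * D)^-1 - c / (n%:R * dL%:R),
        dL%:R * ee / 2 >= (2 * n%:R * D)^-1 - c / (n%:R * dL%:R),
        D >= ln (dL%:R - 1) / (2 * n%:R * ew)
             - ln (1 + (2 * n%:R * ew)^-1) / (2 * n%:R * ew),
        D >= (dL%:R - 1) * ln ((2 * ew * n%:R * dL%:R)^-1) &
        D >= (dL%:R - 1) * ln ((2 * (dL%:R * ee / 2) * n%:R * dL%:R)^-1)].
Proof.
(* The constant is that of [eps_lower_bound] and is uniform in the code. The entanglement versions
   use the same estimates with [e = dL * ee / 2]. *)
exists 4 => n dims [//|d] V rep phis n0 d0 dims0 isoV cont cov phis1 M ew ee D.
have Dge := maxlnd_ge n0 d0 dims0 cont.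
have Mg := M_gt0 d0 isoV cont cov.
have worst := eps_worst_bound n0 d0 isoV cont cov phis1.
have ent := eps_e_bound n0 d0 isoV cont cov phis1.
have -> : d.+1%:R - 1 = d%:R :> R by rewrite -natr1 addrK.
split.
- exact: eps_lower_bound Dge worst.
- exact: eps_lower_bound Dge ent.
- exact: ln_dim_bound_entropic Dge worst.
- exact: ln_dim_bound_polynomial Dge worst.
- exact: ln_dim_bound_polynomial Dge ent.
Qed.
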